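(* Consider the decentralized stochastic convex optimization problem described in the context, with $M$ workers, smoothness $L$, noise level $\sigma$, heterogeneity at the optimum $\zeta_\star$, and gossip matrix $P$ with $1-\lambda_2(P)\ge\rho$, $\rho\in(0,1]$. Let $R>0$ satisfy $R\ge\|x_0-x^\star\|$. Fix a total sample budget $N$ and define $$\Lambda_N:=\frac{100N}{\sqrt M}\left(1+\frac{\zeta_\star+\sigma}{LR}\right),\qquad B:=\left\lceil\max\left\{1,\frac{20}{\sqrt\rho}\log\frac{\Lambda_N}{\rho}\right\}\right\rceil,$$ and assume that $T:=N/(MB)$ is a positive integer. Set $$\alpha_{\rm g}:=\tfrac12,\qquad \beta_{\rm g}:=\frac{1-\sqrt{\rho/2}}{1+\sqrt{\rho/2}},$$ $$a_t:=\frac{t+1}{128L},\quad A_t:=\sum_{i=0}^t a_i=\frac{(t+1)(t+2)}{256L},\quad \theta_t:=\frac{a_t}{A_t}=\frac{2}{t+2}\ (0\le t<T),\quad \theta_T:=0,$$ $$m_0:=0,\quad m_t:=\frac{t-1}{t+2}\ (1\le t\le T),\quad m_{T+1}:=0,$$ $$H_{T-1}:=\sqrt{\sum_{i=0}^{T-1}a_i^2},\quad \beta:=1+\frac{\sigma}{R\sqrt{MB}}H_{T-1},\quad \eta_t:=\frac{a_t}{\beta}\ (0\le t<T),\quad \eta_T:=0.$$ Run Algorithm DDA-SGD (defined in the context) with these parameters and common initial point $x_0\in\mathbb R^d$, and let $\widetilde x_{T,i}$ be the output held by node $i$ (the $i$-th column of $\widetilde X_T$). Then, for every node $i\in\{1,\dots,M\}$,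 $$\mathbb E[f(\widetilde x_{T,i})-f(x^\star)]\le\frac{14\sigma R}{\sqrt N}+\frac{2^{19}LR^2M^2}{\rho N^2}\log^2\frac{\Lambda_N}{\rho}.$$
   Context: Notation: $\|\cdot\|$ is the Euclidean norm, $\mathbf 1\in\mathbb R^M$ is the all-ones vector. Problem. $f(x)=\frac1M\sum_{i=1}^M f_i(x)$, where each $f_i:\mathbb R^d\to\mathbb R$ is convex, differentiable and $L$-smooth ($\|\nabla f_i(x)-\nabla f_i(y)\|\le L\|x-y\|$), $L>0$. The set of minimizers of $f$ is nonempty, and $x^\star\in\arg\min_x f(x)$ is fixed. Worker $i$ has a stochastic gradient oracle $G_i(x,\xi)$ with $\mathbb E[G_i(x,\xi)\mid x]=\nabla f_i(x)$ and $\mathbb E[\|G_i(x,\xi)-\nabla f_i(x)\|^2\mid x]\le\sigma^2$; all oracle samples are conditionally independent given past queries. Heterogeneity at the optimum: $\zeta_\star\ge0$ satisfies $\frac1M\sum_{i=1}^M\|\nabla f_i(x^\star)-\nabla f(x^\star)\|^2\le\zeta_\star^2$. Gossip matrix. $P\in[0,1]^{M\times M}$ is symmetric and doubly stochastic, supported on an undirected communication graph on $\{1,\dots,M\}$ (i.e. $P_{ij}=0$ if $i\ne j$ and $\{i,j\}$ is not an edge). Its eigenvalues are $1=\lambda_1(P)\ge\lambda_2(P)\ge\dots\ge\lambda_M(P)\ge-1$, and $1-\lambda_2(P)\ge\rho$ for some $\rho\in(0,1]$. Algorithm DDA-SGD. Inputs: $x_0$, macro horizon $T$, minibatch/gossip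 length $B$, $P$, $\alpha_{\rm g}\in(0,1]$, $\beta_{\rm g}\in[0,1)$, $(\theta_t)_{t=0}^T$, $(m_t)_{t=0}^{T+1}$, $(\eta_t)_{t=0}^T$. All capital states are $d\times M$ matrices whose $i$-th column is held by node $i$. Set $X_{-1}=X_0=Z_0=Q_0=\widetilde X_{-1}=x_0\mathbf 1^\top$. For $t=0,1,\dots,T$: (1) Let $q_{t,i}$ be the $i$-th column of $Q_t$; node $i$ draws fresh samples $\xi_{t,i}^{(1)},\dots,\xi_{t,i}^{(B)}$ and forms $g_{t,i}=\frac1B\sum_{s=1}^B G_i(q_{t,i},\xi_{t,i}^{(s)})$. (2) Accelerated gossip: $Y_t^{(-1)}=Y_t^{(0)}=X_t$, and for $s=1,\dots,B$: $V_t^{(s)}=Y_t^{(s-1)}+\beta_{\rm g}(Y_t^{(s-1)}-Y_t^{(s-2)})$, $Y_t^{(s)}=(1-\alpha_{\rm g})V_t^{(s)}+\alpha_{\rm g}V_t^{(s)}P$. (3) $\widetilde X_t=Y_t^{(B)}$ and $Q_{t+1}=\widetilde X_t+m_t(1+m_{t+1})(\widetilde X_t-\widetilde X_{t-1})$. (4) With $G_t=[g_{t,1},\dots,g_{t,M}]$: $Z_{t+1}=Z_t-\eta_tG_t$, $X_{t+1}=(1-\theta_t)X_t+\theta_tZ_{t+1}$. Output at node $i$: the $i$-th column $\widetilde x_{T,i}$ of $\widetilde X_T$. *)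

(* Defs.v *)
From HB Require Import structures.
From mathcomp Require Export all_boot all_order all_algebra.
From mathcomp Require Export all_classical all_reals all_analysis measurable_realfun.

Set Implicit Arguments.
Unset Strict Implicit.
Unset Printing Implicit Defensive.

Export Order.TTheory GRing.Theory Num.Theory.
Export numFieldNormedType.Exports.

Open Scope classical_set_scope.
Open Scope ring_scope.

Section Vectors.
Context {R : realType} {d : nat}.

(* The library norm on matrices is the max norm, hence a separate definition. *)
Definition enorm (v : 'cV[R]_d) : R := Num.sqrt (\sum_j v j 0 ^+ 2).

Definition grad (f : 'cV[R]_d -> R) (x : 'cV[R]_d) : 'cV[R]_d :=
  \col_j 'D_(delta_mx j 0) f x.

(* Only meaningful for differentiable [f]. *)
Definition smooth (L : R) (f : 'cV[R]_d -> R) : Prop :=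
  forall x y, enorm (grad f x - grad f y) <= L * enorm (x - y).

Definition is_minimizer (f : 'cV[R]_d -> R) (x : 'cV[R]_d) : Prop :=
  forall y, f x <= f y.

Definition average M (f : 'I_M -> 'cV[R]_d -> R) (x : 'cV[R]_d) : R :=
  M%:R^-1 * \sum_(i < M) f i x.

End Vectors.

Definition borel_cV (R : realType) (d : nat) :=
  g_sigma_algebraType (@open 'cV[R]_d).

Section GossipMatrix.
Context {R : realType} {M : nat}.

Definition doubly_stochastic (P : 'M[R]_M) : Prop :=
  [/\ forall i j, 0 <= P i j <= 1,
      forall i, \sum_j P i j = 1
    & forall j, \sum_i P i j = 1].

Definition supported_on (e : rel 'I_M) (P : 'M[R]_M) : Prop :=
  forall i j, i != j -> ~~ e i j -> P i j = 0.

(* [lam] lists the eigenvalues of [P] with multiplicity, in nonincreasing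
   order: the k-th largest one is lam`_(k.-1). *)
Definition spectrum (P : 'M[R]_M) (lam : seq R) : Prop :=
  sorted >=%R lam /\ char_poly P = \prod_(l <- lam) ('X - l%:P).

End GossipMatrix.

Section Oracle.
Context {R : realType} {d : nat} {dX : measure_display} {Xi : measurableType dX}.

(* Given a query [x], the oracle draws xi with law [D x] and returns [G x xi].
   The law may depend on the query; a fixed law is a constant kernel. *)
Definition stochastic_gradient_oracle (f : 'cV[R]_d -> R) (sigma : R)
    (D : R.-pker (borel_cV R d) ~> Xi) (G : 'cV[R]_d -> Xi -> 'cV[R]_d) : Prop :=
  [/\ measurable_fun [set: borel_cV R d * Xi]
        (fun p => G p.1 p.2 : borel_cV R d),
      forall x j, (D x).-integrable setT (fun z => (G x z j 0)%:E),
      forall x j, (\int[D x]_z (G x z j 0)%:E = (grad f x j 0)%:E)%E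
    & forall x, (\int[D x]_z (enorm (G x z - grad f x) ^+ 2)%:E
                 <= (sigma ^+ 2)%:E)%E].

End Oracle.

Section Algorithm.
Context {R : realType} {d M : nat} {Xi : Type}.

Section Gossip.
Variables (alpha beta : R) (P : 'M[R]_M) (X : 'M[R]_(d, M)).

(* (Y^(s), Y^(s-1)), with Y^(-1) = Y^(0) = X. *)
Fixpoint gossip_pair (s : nat) : 'M[R]_(d, M) * 'M[R]_(d, M) :=
  if s is s'.+1 then
    let: (Y, Y') := gossip_pair s' in
    let V := Y + beta *: (Y - Y') in
    ((1 - alpha) *: V + alpha *: (V *m P), Y)
  else (X, X).

Definition gossip (s : nat) : 'M[R]_(d, M) := (gossip_pair s).1.

End Gossip.

(* At the start of round t: X_t, Z_t, Q_t and Xtilde_(t-1). *)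
Record dda_state := DDAState {
  capX : 'M[R]_(d, M);
  capZ : 'M[R]_(d, M);
  capQ : 'M[R]_(d, M);
  prevXt : 'M[R]_(d, M) }.

Variables (B : nat) (P : 'M[R]_M) (alpha beta : R) (theta m eta : nat -> R).
Variables (x0 : 'cV[R]_d) (G : 'I_M -> 'cV[R]_d -> Xi -> 'cV[R]_d).

Definition minibatch (Q : 'M[R]_(d, M)) (z : 'I_M -> 'I_B -> Xi) :
    'M[R]_(d, M) :=
  \matrix_(j < d, i < M) (B%:R^-1 *: \sum_(s < B) G i (col i Q) (z i s)) j 0.

Definition dda_step (t : nat) (z : 'I_M -> 'I_B -> Xi) (S : dda_state) :
    dda_state :=
  let g := minibatch (capQ S) z in
  let Xt := gossip alpha beta P (capX S) B in
  let Z := capZ S - eta t *: g in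
  {| capX := (1 - theta t) *: capX S + theta t *: Z;
     capZ := Z;
     capQ := Xt + (m t * (1 + m t.+1)) *: (Xt - prevXt S);
     prevXt := Xt |}.

(* [z t i s] is the realisation of the s-th sample of node i in round t. *)
Fixpoint dda (z : nat -> 'I_M -> 'I_B -> Xi) (t : nat) : dda_state :=
  if t is t'.+1 then dda_step t' (z t') (dda z t')
  else let C := x0 *m (const_mx 1 : 'rV[R]_M) in DDAState C C C C.

Definition dda_query z t (i : 'I_M) : 'cV[R]_d := col i (capQ (dda z t)).

Definition dda_output z (T : nat) (i : 'I_M) : 'cV[R]_d :=
  col i (gossip alpha beta P (capX (dda z T)) B).

End Algorithm.

Section Sampling.
Context {R : realType} {d : nat} {dO dX : measure_display}.
Context {Omega : measurableType dO} {Xi : measurableType dX}.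

(* [p] is a version of the conditional probability Pr(E | <<s F >>). *)
Definition cond_prob (Pr : probability Omega R) (F : set (set Omega))
    (E : set Omega) (p : Omega -> \bar R) : Prop :=
  measurable_fun setT (p : g_sigma_algebraType F -> \bar R) /\
  forall H, <<s F >> H -> (\int[Pr]_(w in H) p w = Pr (E `&` H))%E.

Context {M B : nat}.

(* Generators of the sigma-algebra of all samples drawn before round [t]. *)
Definition history (xi : nat -> 'I_M -> 'I_B -> Omega -> Xi) (t : nat) :
    set (set Omega) :=
  [set E | exists t' i s A,
     [/\ (t' < t)%N, measurable A & E = xi t' i s @^-1` A]].

(* In each round t <= T, conditionally on the past, the samples are independent
   and the s-th sample of node i has law [D i] at the current query [q t i]. *)
Definition fresh_samples (Pr : probability Omega R)
    (D : 'I_M -> R.-pker (borel_cV R d) ~> Xi)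
    (q : Omega -> nat -> 'I_M -> 'cV[R]_d)
    (xi : nat -> 'I_M -> 'I_B -> Omega -> Xi) (T : nat) : Prop :=
  forall t, (t <= T)%N ->
    (forall i s, measurable_fun setT (xi t i s)) /\
    forall A : 'I_M -> 'I_B -> set Xi, (forall i s, measurable (A i s)) ->
      cond_prob Pr (history xi t)
        [set w | forall i s, A i s (xi t i s w)]
        (fun w => \prod_(i < M) \prod_(s < B) D i (q w t i) (A i s))%E.

End Sampling.

Section StepSizes.
Context {R : realType}.

Definition LambdaN (M N : nat) (L sigma zeta r : R) : R :=
  100 * N%:R / Num.sqrt M%:R * (1 + (zeta + sigma) / (L * r)).

Definition batch_len (rho Lam : R) : nat :=
  `|Num.ceil (Num.max 1%R (20 / Num.sqrt rho * ln (Lam / rho))%R)|%N.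

Definition gossip_momentum (rho : R) : R :=
  (1 - Num.sqrt (rho / 2)) / (1 + Num.sqrt (rho / 2)).

Definition step_a (L : R) (t : nat) : R := t.+1%:R / (128 * L).

Definition step_A (L : R) (t : nat) : R := \sum_(0 <= i < t.+1) step_a L i.

Definition step_theta (L : R) (T t : nat) : R :=
  if (t < T)%N then step_a L t / step_A L t else 0.

Definition step_m (T t : nat) : R :=
  if (1 <= t <= T)%N then (t%:R - 1) / (t%:R + 2) else 0.

Definition step_beta (M B T : nat) (L sigma r : R) : R :=
  1 + sigma / (r * Num.sqrt (M * B)%:R)
      * Num.sqrt (\sum_(0 <= i < T) step_a L i ^+ 2).

Definition step_eta (M B T : nat) (L sigma r : R) (t : nat) : R :=
  if (t < T)%N then step_a L t / step_beta M B T L sigma r else 0.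

End StepSizes.

(* Main.v *)
From HB Require Import structures.
From mathcomp Require Import ring lra sesquilinear spectral complex.
Require Import Defs.

(** Write x, z, q for the column averages of X, Z, Q, and F for f - f(x⋆).  Gossip
    preserves averages, so x and z follow accelerated dual averaging with the exact
    linear coupling x_(t+1) = (1 - θ) x_t + θ z_(t+1), except that the gradients are
    evaluated at scattered and slightly stale points.  Convexity and smoothness give,
    on every sample path,
      Φ_(t+1) <= Φ_t - a <n, z_t - x⋆> + (a²/β) |n|² + L A_t (dispersion of Q_t) / M,
      Φ_t = A_(t-1) F(x_t) + (β/2) |z_t - x⋆|² + (3/32) |z_t - z_(t-1)|²,
    where n is the averaged gradient noise; staleness is absorbed by the last term of
    Φ.  In expectation the inner product vanishes and |n|² contributes at most σ²/(MB),
    by disintegrating the law of the samples over the past.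

    Diagonalizing P reduces accelerated gossip to scalar recursions, which contract the
    dispersion by (B+1)(1 - sqrt(ρ/2))^B, a high negative power of Λ_N for the given B.
    All dispersions and distances are a priori bounded by powers of T, M, R and
    κ = 1 + (ζ⋆ + σ)/(LR), so by induction on t the consensus error stays negligible.
    Finally f(x̃) - f(x⋆) <= 2 F(x_T) + L |x̃ - x_T|². *)

Set Implicit Arguments.
Unset Strict Implicit.
Unset Printing Implicit Defensive.

(** * Disintegration over the past *)

(** The obstacle is a circle. Neither the domain nor the gradients are bounded, so the disagreement
    created in a round is controlled only through the potential, and the potential in turn contains
    the past disagreement. Power counting breaks the circle. The descent tolerates a query
    dispersion of order [M r^2 / T^3], while the dispersion handed to gossip is at most of order
    [T^4 M r^2 kappa^2]. A squared gossip rate below [1 / (25 M T^7 kappa^2)] therefore suffices,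
    and the factor 20 in the choice of [B] brings it down to [Lambda^-18].

    The law of a sample may depend on the query, hence on the whole past, so independence of samples
    and past cannot be used. Conditional statements are obtained by disintegration instead, and the
    variance reduction by [M B] rests on distinct samples of a round being uncorrelated.

    Probability and arithmetic are kept apart: each pathwise inequality is integrated on its own,
    and the bootstrap runs on sequences of real numbers. *)

Section GraphKernel.
Context {dO dT dZ : measure_display} {Omega : measurableType dO}
  {T : measurableType dT} {Z : measurableType dZ} {R : realType}.
Variables (K : R.-pker T ~> Z) (Y : {mfun Omega >-> T}).

(** The law of [(Y w, z)] with [z] drawn from [K (Y w)]. The [unit] factor is the source of the
    constant kernel composed with it below, since kernel composition passes the source point on. *)
Definition graph_law (x : unit * Omega) : {measure set (T * Z) -> \bar R} :=
  measure_function_pushforward__canonical__measure_function_Measure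
    (K (Y x.2)) (pair1_measurable (Y x.2)).

Let measurable_graph_law U : measurable U ->
  measurable_fun [set: unit * Omega] (graph_law ^~ U).
Proof.
move=> mU.
rewrite (_ : graph_law ^~ U = (fun y => K y (xsection U y)) \o Y \o snd).
  apply: measurableT_comp; last exact: measurable_snd.
  apply: measurableT_comp => //.
  by apply: measurable_fun_xsection_finite_kernel; rewrite inE.
apply/funext => x /=; rewrite /graph_law /= /pushforward /xsection.
by congr (K _ _); apply/seteqP; split => z; rewrite /= inE.
Qed.

HB.instance Definition _ := isKernel.Build _ _ _ _ _ graph_law
  measurable_graph_law.

Let graph_law_setT x : graph_law x [set: T * Z] = 1%E.
Proof. by rewrite /graph_law /= /pushforward preimage_setT; exact: prob_kernel. Qed.

HB.instance Definition _ := Kernel_isProbability.Build _ _ _ _ _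
  graph_law graph_law_setT.

End GraphKernel.

(** Since [setT] lies in [C], these rectangles contain the strips over [C] and over the second
    factor, and every measurable rectangle is an intersection of two strips from the sigma-algebra
    they generate. *)
Lemma prod_generator d1 d2 (T1 : measurableType d1) (T2 : measurableType d2)
    (C : set (set T1)) :
  @measurable _ T1 = <<s C >> -> C setT ->
  @measurable _ (T1 * T2)%type =
  <<s [set A `*` B | A in C & B in @measurable _ T2] >>.
Proof.
move=> C_gen CT; rewrite measurable_prod_measurableType; apply/seteqP; split.
  apply: smallest_sub; first exact: smallest_sigma_algebra.
  set G := [set A `*` B | A in C & B in @measurable _ T2].
  move=> _ [A mA [B mB <-]].
  have -> : A `*` B = (A `*` setT) `&` (setT `*` B) :> set (T1 * T2).
    by rewrite -{1}(setIT A) -{1}(setTI B) setXI.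
  apply: (@measurableI _ (g_sigma_algebraType G)); last first.
    by apply: sub_sigma_algebra; exists setT => //; exists B.
  have mfst : measurable_fun setT (fst : g_sigma_algebraType G -> T1).
    apply: (measurability C C_gen) => _ [H CH <-].
    apply: sub_sigma_algebra; exists H => //; exists setT => //.
    by apply/seteqP; split => x //= [].
  have := mfst measurableT A mA; rewrite setTI.
  by congr (measurable _); apply/seteqP; split => x //= [].
apply: smallest_sub; first exact: smallest_sigma_algebra.
move=> _ [A CA [B mB <-]]; apply: sub_sigma_algebra; exists A; last by exists B.
by rewrite /= C_gen; exact: sub_sigma_algebra.
Qed.

Section Disintegration.
Context {dO dT dZ : measure_display} {Omega : measurableType dO}
  {T : measurableType dT} {Z : measurableType dZ} {R : realType}.
Variables (Pr : probability Omega R) (K : R.-pker T ~> Z).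
Variables (Y : {mfun Omega >-> T}) (X : {mfun Omega >-> Z}).
Variable (C : set (set T)).
Hypotheses (C_gen : @measurable _ T = <<s C>>) (C_setI : setI_closed C)
  (C_setT : C setT).
Hypothesis law : forall H A, C H -> measurable A ->
  Pr (Y @^-1` H `&` X @^-1` A) = (\int[Pr]_(w in Y @^-1` H) K (Y w) A)%E.

Let const_law : R.-pker unit ~> Omega :=
  kprobability (@measurable_cst _ _ unit (pprobability Omega R) setT Pr).

Let measurable_joint : measurable_fun setT (fun w => (Y w, X w)).
Proof. exact: measurable_fun_pair. Qed.

Let joint_law : {measure set (T * Z) -> \bar R} :=
  measure_function_pushforward__canonical__measure_function_Measure Pr
    measurable_joint.

Let joint_lawE (U : set (T * Z)) : measurable U ->
  joint_law U = mkcomp const_law (graph_law K Y) tt U.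
Proof.
move=> mU.
have gen := @prod_generator _ _ T Z C C_gen C_setT.
apply: (@measure_unique _ R _ _ (fun=> setT) gen _ _ _ joint_law
  (mkcomp const_law (graph_law K Y) tt)) => //.
- move=> _ _ [A CA [B mB <-]] [A' CA' [B' mB' <-]].
  exists (A `&` A'); first exact: C_setI.
  by exists (B `&` B'); [exact: measurableI|rewrite setXI].
- by move=> _; exists setT => //; exists setT => //; rewrite setXTT.
- by apply/seteqP; split => // x _; exists 0%N.
- move=> _ [H CH [A mA <-]].
  have mH : measurable H by rewrite C_gen; exact: sub_sigma_algebra.
  transitivity (Pr (Y @^-1` H `&` X @^-1` A)) => //.
  rewrite law// /mkcomp /kcomp /= integral_mkcond.
  apply: eq_integral => w _.
  rewrite /patch /graph_law /= /pushforward; case: ifPn => wH.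
    congr (K _ _); apply/seteqP; split => z //=; last by case.
    by move=> Az; split => //; rewrite inE in wH.
  rewrite (_ : _ @^-1` _ = set0) ?measure0//.
  by apply/seteqP; split => z //= [? _]; move/negP: wH; apply; rewrite inE.
- move=> _; rewrite /joint_law /= /pushforward preimage_setT probability_setT.
  exact: ltry.
Qed.

(** The two candidate joint laws agree on rectangles with first side in the pi-system [C], hence
    everywhere. The freedom in [C] serves the case where [Y] is itself a pair and [law] is available
    on rectangles only. *)
Lemma ge0_integral_disintegration (phi : T * Z -> \bar R) :
  (forall p, 0 <= phi p)%E -> measurable_fun setT phi ->
  (\int[Pr]_w phi (Y w, X w) = \int[Pr]_w \int[K (Y w)]_z phi (Y w, z))%E.
Proof.
move=> phi0 mphi.
transitivity (\int[joint_law]_p phi p)%E.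
  by rewrite ge0_integral_pushforward.
transitivity (\int[mkcomp const_law (graph_law K Y) tt]_p phi p)%E.
  by apply: eq_measure_integral => U mU _; exact: joint_lawE.
rewrite integral_kcomp//=.
apply: eq_integral => w _.
by rewrite ge0_integral_pushforward.
Qed.

End Disintegration.

Section Centered.
Context {dO dT dZ : measure_display} {Omega : measurableType dO}
  {T : measurableType dT} {Z : measurableType dZ} {R : realType}.
Variables (Pr : probability Omega R) (K : R.-pker T ~> Z).
Variables (Y : {mfun Omega >-> T}) (X : {mfun Omega >-> Z}).
Variable (C : set (set T)).
Hypotheses (C_gen : @measurable _ T = <<s C>>) (C_setI : setI_closed C)
  (C_setT : C setT).
Hypothesis law : forall H A, C H -> measurable A ->
  Pr (Y @^-1` H `&` X @^-1` A) = (\int[Pr]_(w in Y @^-1` H) K (Y w) A)%E.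

(** Disintegration is stated for nonnegative functions, so the positive and negative parts of the
    product are disintegrated separately. Their inner integrals coincide because [e] is centered,
    and integrability of the product makes the common value finite. *)
Lemma integral_centered (h : T -> R) (e : T * Z -> R) :
  measurable_fun setT h -> measurable_fun setT e ->
  (forall y, (K y).-integrable setT (fun z => (e (y, z))%:E)) ->
  (forall y, \int[K y]_z (e (y, z))%:E = 0)%E ->
  Pr.-integrable setT (fun w => (h (Y w) * e (Y w, X w))%:E) ->
  (\int[Pr]_w (h (Y w) * e (Y w, X w))%:E = 0)%E.
Proof.
move=> mh me Ie e0 Iphi.
pose phi (p : T * Z) : \bar R := (h p.1 * e p)%:E.
have mphi : measurable_fun setT phi.
  apply/measurable_EFinP; apply: measurable_funM => //.
  exact: measurableT_comp.
have Kphi y : (K y).-integrable setT (fun z => phi (y, z)).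
  by rewrite /phi /=; under eq_fun do rewrite EFinM; exact: integrableZl.
have pE (U : Type) (g : U -> T * Z) u : (phi \o g)^\+%E u = phi^\+%E (g u).
  by rewrite !unlock.
have nE (U : Type) (g : U -> T * Z) u : (phi \o g)^\-%E u = phi^\-%E (g u).
  by rewrite !unlock.
have posneg y : (\int[K y]_z (phi^\+ (y, z)) = \int[K y]_z (phi^\- (y, z)))%E.
  have : (\int[K y]_z phi (y, z) = 0)%E.
    rewrite /phi /=; under eq_integral do rewrite EFinM.
    by rewrite integralZl// e0 mule0.
  rewrite integralE => /eqP; rewrite sube_eq//; last first.
    exact: (integrable_pos_fin_num measurableT (Kphi y)).
  rewrite add0e => /eqP.
  under eq_integral do rewrite (pE _ (pair y)).
  by under [in RHS]eq_integral do rewrite (nE _ (pair y)).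
rewrite integralE.
under eq_integral do rewrite (pE _ (fun w => (Y w, X w))).
under [X in (_ - X)%E]eq_integral do rewrite (nE _ (fun w => (Y w, X w))).
rewrite (ge0_integral_disintegration C_gen C_setI C_setT law)//; last first.
  exact: measurable_funepos.
rewrite [X in (X - _)%E](eq_integral _ _ (fun w _ => posneg (Y w))).
rewrite -(ge0_integral_disintegration C_gen C_setI C_setT law)//; last first.
  exact: measurable_funeneg.
under eq_integral do rewrite -(nE _ (fun w => (Y w, X w))).
by rewrite subee//; exact: (integrable_neg_fin_num measurableT Iphi).
Qed.

End Centered.

Section PullbackKernel.
Context {dS dT dZ : measure_display} {S : measurableType dS}
  {T : measurableType dT} {Z : measurableType dZ} {R : realType}.
Variables (K : R.-pker T ~> Z) (g : {mfun S >-> T}).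

Definition kpullback (x : S) : {measure set Z -> \bar R} := K (g x).

Let measurable_kpullback U : measurable U ->
  measurable_fun [set: S] (kpullback ^~ U).
Proof. by move=> mU; exact: (measurableT_comp (measurable_kernel K U mU)). Qed.

HB.instance Definition _ := isKernel.Build _ _ _ _ _ kpullback
  measurable_kpullback.

Let kpullback_setT x : kpullback x [set: Z] = 1%E.
Proof. exact: prob_kernel. Qed.

HB.instance Definition _ := Kernel_isProbability.Build _ _ _ _ _
  kpullback kpullback_setT.

End PullbackKernel.

Lemma measurable_generates d (T : measurableType d) :
  @measurable _ T = <<s @measurable _ T >>.
Proof. by rewrite sigma_algebra_id//; exact: sigma_algebra_measurable. Qed.

Section PairLaw.
Context {dO dT dZ : measure_display} {Omega : measurableType dO}
  {T : measurableType dT} {Z : measurableType dZ} {R : realType}.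
Variables (Pr : probability Omega R) (K1 K2 : R.-pker T ~> Z).
Variables (Y : {mfun Omega >-> T}) (X1 X2 : {mfun Omega >-> Z}).
Hypothesis law2 : forall H A1 A2, measurable H -> measurable A1 -> measurable A2 ->
  Pr (Y @^-1` H `&` (X1 @^-1` A1 `&` X2 @^-1` A2)) =
  (\int[Pr]_(w in Y @^-1` H) (K1 (Y w) A1 * K2 (Y w) A2))%E.

Let law1 H A1 : measurable H -> measurable A1 ->
  Pr (Y @^-1` H `&` X1 @^-1` A1) = (\int[Pr]_(w in Y @^-1` H) K1 (Y w) A1)%E.
Proof.
move=> mH mA1; have := law2 mH mA1 measurableT.
rewrite preimage_setT setIT => ->; apply: eq_integral => w _.
by rewrite prob_kernel mule1.
Qed.

(** Conditional independence lets the first sample join the conditioning variable without changing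
    the law of the second; this is what makes the errors of distinct samples uncorrelated. *)
Lemma pair_law H A : [set U `*` V | U in @measurable _ T & V in @measurable _ Z] H ->
  measurable A ->
  Pr ((fun w => (Y w, X1 w)) @^-1` H `&` X2 @^-1` A) =
  (\int[Pr]_(w in (fun w => (Y w, X1 w)) @^-1` H) K2 (Y w) A)%E.
Proof.
case=> U mU [V mV <-] mA.
transitivity (Pr (Y @^-1` U `&` (X1 @^-1` V `&` X2 @^-1` A))).
  by congr (Pr _); apply/seteqP; split => w /=; tauto.
rewrite law2// integral_mkcond.
(* Disintegrating [phi] over [X1] replaces the indicator of [V] by [K1 (Y w) V], the factor supplied
   by [law2]. *)
pose phi (p : T * Z) : \bar R := ((\1_U p.1 * \1_V p.2)%:E * K2 p.1 A)%E.
have mphi : measurable_fun setT phi.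
  apply: emeasurable_funM.
    apply/measurable_EFinP; apply: measurable_funM.
      exact: (measurableT_comp (measurable_indic mU) measurable_fst).
    exact: (measurableT_comp (measurable_indic mV) measurable_snd).
  exact: (measurableT_comp (measurable_kernel K2 A mA) measurable_fst).
have /= E := ge0_integral_disintegration (measurable_generates T) (@measurableI _ T) measurableT law1 (phi := phi) _ mphi.
transitivity (\int[Pr]_w phi (Y w, X1 w))%E.
  rewrite E => [|p]; last first.
    by rewrite mule_ge0// lee_fin mulr_ge0.
  apply: eq_integral => w _; rewrite /phi /= /patch indicE.
  rewrite (_ : (w \in Y @^-1` U) = (Y w \in U)); last first.
    by apply/idP/idP; rewrite !inE.
  have [wU|wU] := boolP (Y w \in U); last first.
    by under [RHS]eq_integral do rewrite mul0r mul0e; rewrite integral0.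
  under [RHS]eq_integral do rewrite mul1r muleC.
  rewrite ge0_integralZl//; last exact/measurable_EFinP.
  by rewrite integral_indic// setIT muleC.
rewrite [RHS]integral_mkcond; apply: eq_integral => w _.
rewrite /phi /= /patch !indicE; case: ifPn => [|] wUV; rewrite ?inE/= in wUV.
  by case: wUV => wU wV; rewrite !mem_set// mulr1 mul1e.
have [wU|wU] := boolP (Y w \in U); last by rewrite mul0r mul0e.
have [wV|wV] := boolP (X1 w \in V); last by rewrite mulr0 mul0e.
by exfalso; move/negP: wUV; apply; rewrite inE /=; split; exact/set_mem.
Qed.

End PairLaw.

(** * Borel structure on column vectors *)

Section BorelVectors.
Context {R : realType} {d : nat}.

Definition rat_box (ab : 'cV[rat]_d * 'cV[rat]_d) : set 'cV[R]_d :=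
  [set v | forall j, v j 0 \in `]ratr (ab.1 j 0), ratr (ab.2 j 0)[].

Lemma open_bigcup_rat_box (U : set 'cV[R]_d) : open U ->
  U = \bigcup_(ab in [set ab | rat_box ab `<=` U]) rat_box ab.
Proof.
move=> oU; apply/seteqP; split => [v Uv|v [ab abU]]; last exact: abU.
have /nbhs_ballP[e e0 eU] : nbhs v U by exact: open_nbhs_nbhs.
have a_ex j : exists q : rat, v j 0 - e < ratr q < v j 0.
  have [|q] := @rat_in_itvoo R (v j 0 - e) (v j 0).
    by rewrite ltrBlDr ltrDl.
  by rewrite in_itv /=; exists q.
have b_ex j : exists q : rat, v j 0 < ratr q < v j 0 + e.
  have [|q] := @rat_in_itvoo R (v j 0) (v j 0 + e); first by rewrite ltrDl.
  by rewrite in_itv /=; exists q.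
have [a aP] := fin_all_exists a_ex.
have [b bP] := fin_all_exists b_ex.
exists (\col_j a j, \col_j b j) => /=; last first.
  move=> j; rewrite /= !mxE in_itv /=.
  by have /andP[_ ->] := aP j; have /andP[-> _] := bP j.
move=> u abu; apply: eU; split=> // i j; rewrite (ord1 j).
have := abu i; rewrite /= !mxE in_itv /= => /andP[au ub].
have /andP[va _] := aP i; have /andP[_ bv] := bP i.
rewrite /ball /= ltr_distlC (lt_trans va au) /=.
exact: lt_trans ub bv.
Qed.

(** Open sets are countable unions of rational boxes, whose preimages are finite intersections of
    coordinate conditions. *)
Lemma measurable_fun_borel_cV dS (S : measurableType dS) (g : S -> 'cV[R]_d) :
  (forall j, measurable_fun setT (fun s => g s j 0)) ->
  measurable_fun setT (g : S -> borel_cV R d).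
Proof.
move=> mg; apply: (@measurability _ _ _ (borel_cV R d) setT g (@open 'cV[R]_d) erefl) => _ [U oU <-].
rewrite setTI (open_bigcup_rat_box oU) preimage_bigcup bigcup_mkcond.
apply: countable_bigcupT_measurable; first exact: countableP.
move=> ab; case: ifPn => // _.
rewrite (_ : _ @^-1` _ = \bigcap_(j in [set: 'I_d])
  ((fun s => g s j 0) @^-1` `]ratr (ab.1 j 0), ratr (ab.2 j 0)[%classic)).
  apply: fin_bigcap_measurable => [|j _]; first exact: finite_finset.
  rewrite -[X in measurable X]setTI; by apply: mg => //; exact: measurable_itv.
by apply/seteqP; split => [s gs j _|s gs j]; [exact: gs|exact: gs].
Qed.

Lemma measurable_continuous_cV (h : 'cV[R]_d -> R) : continuous h ->
  measurable_fun setT (h : borel_cV R d -> R).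
Proof.
move=> ch; apply: (measurability _ (RGenOpens.measurableE R)) => _ [U [x [y ->]] <-].
rewrite setTI; apply: sub_sigma_algebra.
by move/continuousP : ch; apply; exact: interval_open.
Qed.

Lemma measurable_coord_cV (j : 'I_d) :
  measurable_fun setT (fun v : borel_cV R d => (v : 'cV[R]_d) j 0).
Proof. exact: measurable_continuous_cV (@coord_continuous _ _ _ j 0). Qed.

End BorelVectors.

(** * Smooth convex functions *)

Section Euclid.
Context {R : realType} {d : nat}.
Implicit Types (u v w : 'cV[R]_d) (a b c : R).

Definition dotv u v : R := \sum_j u j 0 * v j 0.

Definition sqn v : R := dotv v v.

Lemma dotvC u v : dotv u v = dotv v u.
Proof. by apply: eq_bigr => j _; rewrite mulrC. Qed.

Lemma dotvDl u v w : dotv (u + v) w = dotv u w + dotv v w.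
Proof. by rewrite -big_split; apply: eq_bigr => j _; rewrite mxE mulrDl. Qed.

Lemma dotvZl a u v : dotv (a *: u) v = a * dotv u v.
Proof. by rewrite mulr_sumr; apply: eq_bigr => j _; rewrite mxE mulrA. Qed.

Lemma dotvNl u v : dotv (- u) v = - dotv u v.
Proof. by rewrite -scaleN1r dotvZl mulN1r. Qed.

Lemma dotvDr u v w : dotv w (u + v) = dotv w u + dotv w v.
Proof. by rewrite dotvC dotvDl !(dotvC _ w). Qed.

Lemma dotvZr a u v : dotv u (a *: v) = a * dotv u v.
Proof. by rewrite dotvC dotvZl dotvC. Qed.

Lemma dotvNr u v : dotv u (- v) = - dotv u v.
Proof. by rewrite dotvC dotvNl dotvC. Qed.

Lemma dotv_suml I (r : seq I) (F : I -> 'cV[R]_d) v :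
  dotv (\sum_(i <- r) F i) v = \sum_(i <- r) dotv (F i) v.
Proof.
elim: r => [|i r IH]; last by rewrite !big_cons dotvDl IH.
by rewrite !big_nil /dotv big1// => j _; rewrite mxE mul0r.
Qed.

Lemma dotv0l v : dotv 0 v = 0.
Proof. by rewrite -(scale0r 0) dotvZl mul0r. Qed.

Definition dotvE := (dotvDl, dotvDr, dotvNl, dotvNr, dotvZl, dotvZr).

Lemma sqn_ge0 v : 0 <= sqn v.
Proof. by apply: sumr_ge0 => j _; rewrite -expr2 sqr_ge0. Qed.

Lemma sqnZ a v : sqn (a *: v) = a ^+ 2 * sqn v.
Proof. by rewrite /sqn !dotvE mulrA. Qed.

Lemma sqnN v : sqn (- v) = sqn v.
Proof. by rewrite /sqn !dotvE opprK. Qed.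

Lemma sqn0 : sqn 0 = 0.
Proof. exact: dotv0l. Qed.

Lemma sqnE v : sqn v = \sum_j v j 0 ^+ 2.
Proof. by apply: eq_bigr => j _; rewrite expr2. Qed.

Lemma sqr_enorm v : enorm v ^+ 2 = sqn v.
Proof. by rewrite /enorm -sqnE sqr_sqrtr ?sqn_ge0. Qed.

Lemma enorm_ge0 v : 0 <= enorm v.
Proof. exact: sqrtr_ge0. Qed.

Lemma cVB_coord u v j : (u - v) j 0 = u j 0 - v j 0.
Proof. by rewrite mxE [(- v) j 0]mxE. Qed.

Lemma coord_sqr_le v j : v j 0 ^+ 2 <= sqn v.
Proof.
rewrite sqnE (bigD1 j)//= lerDl; apply: sumr_ge0 => i _; exact: sqr_ge0.
Qed.

Lemma dotv_young c u v : 0 < c ->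
  2 * dotv u v <= c * sqn u + c^-1 * sqn v.
Proof.
move=> c0; have /(ler_wpM2l (ltW c0)) : 0 <= sqn (u - c^-1 *: v) by exact: sqn_ge0.
rewrite mulr0 /sqn !dotvE (dotvC v u) -subr_ge0 => H2.
rewrite -subr_ge0; move: H2; congr (_ <= _).
by field; rewrite gt_eqF.
Qed.

Lemma dotv_CS u v : dotv u v ^+ 2 <= sqn u * sqn v.
Proof.
have [v0|v0] := eqVneq (sqn v) 0.
  have vz j : v j 0 = 0.
    apply/eqP; rewrite -sqrf_eq0 eq_le sqr_ge0 andbT -v0; exact: coord_sqr_le.
  rewrite v0 mulr0 /dotv big1 ?expr0n//= => j _; by rewrite vz mulr0.
have v1 : 0 < sqn v by rewrite lt0r v0 sqn_ge0.
have := sqn_ge0 (sqn v *: u - dotv u v *: v).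
rewrite {1}/sqn !dotvE (dotvC v u) -!/(sqn _) => H.
have : 0 <= sqn v * (sqn u * sqn v - dotv u v ^+ 2).
  by move: H; congr (_ <= _); ring.
by rewrite pmulr_rge0// subr_ge0.
Qed.

Lemma sqnD u v : sqn (u + v) = sqn u + 2 * dotv u v + sqn v.
Proof. by rewrite /sqn !dotvE (dotvC v u); ring. Qed.

Lemma sqn_conv t u v : 0 <= t <= 1 ->
  sqn ((1 - t) *: u + t *: v) <= (1 - t) * sqn u + t * sqn v.
Proof.
move=> /andP[t0 t1]; rewrite -subr_ge0.
have : 0 <= t * (1 - t) * sqn (u - v).
  by rewrite !mulr_ge0 ?sqn_ge0 ?subr_ge0.
by congr (_ <= _); rewrite /sqn !dotvE (dotvC v u); ring.
Qed.

Lemma sqn_sum_le (n : nat) (F : 'I_n -> 'cV[R]_d) :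
  sqn (\sum_i F i) <= n%:R * \sum_i sqn (F i).
Proof.
pose s := \sum_i F i.
have H : 0 <= \sum_i sqn (n%:R *: F i - s) by apply: sumr_ge0 => i _; exact: sqn_ge0.
have E : \sum_i sqn (n%:R *: F i - s) = n%:R * (n%:R * (\sum_i sqn (F i)) - sqn s).
  rewrite (eq_bigr (fun i => n%:R ^+ 2 * sqn (F i) - 2 * n%:R * dotv (F i) s + sqn s)); last first.
    by move=> i _; rewrite /sqn !dotvE (dotvC s (F i)); ring.
  rewrite big_split sumrB -!mulr_sumr -dotv_suml -/s sumr_const card_ord -/(sqn s) -mulr_natl.
  by rewrite /=; ring.
case: n F @s H E => [|n] F s H E; first by rewrite !big_ord0 sqn0 mul0r.
by move: H; rewrite E pmulr_rge0 ?ltr0n// subr_ge0.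
Qed.

Lemma sqnD_le u v : sqn (u + v) <= 2 * (sqn u + sqn v).
Proof.
by have := @sqn_sum_le 2 (fun i => if i == ord0 then u else v);
  rewrite !big_ord_recl !big_ord0 /= !addr0.
Qed.

End Euclid.

Section Gradient.
Context {R : realType} {d : nat}.
Implicit Types (f : 'cV[R]_d -> R) (x y h : 'cV[R]_d).

Lemma derive_grad f x h : differentiable f x ->
  'D_h f x = dotv (grad f x) h.
Proof.
move=> df; rewrite deriveE//.
have hE : h = \sum_j h j 0 *: delta_mx j 0.
  by rewrite [LHS]matrix_sum_delta; apply: eq_bigr => j _; rewrite big_ord1.
rewrite [in LHS]hE linear_sum /dotv; apply: eq_bigr => j _.
by rewrite linearZ /= -deriveE// mxE mulrC.
Qed.

Lemma is_derive_line f x h t : differentiable f (x + t *: h) ->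
  is_derive t (1 : R) (fun s : R => f (x + s *: h)) (dotv (grad f (x + t *: h)) h).
Proof.
move=> df.
(* The difference quotient along the line is the one that defines the directional derivative at
   [x + t h]. *)
have E : (fun s : R => s^-1 *: (((fun s : R => f (x + s *: h)) \o shift t) (s *: (1 : R)) - f (x + t *: h))) =
         (fun s : R => s^-1 *: ((f \o shift (x + t *: h)) (s *: h) - f (x + t *: h))).
  apply/funext => s /=; congr (_ *: (f _ - _)).
  by rewrite [s *: 1]mulr1 scalerDl addrCA.
split; first by rewrite /derivable E; exact: diff_derivable.
by rewrite -derive_grad// /derive E.
Qed.

Variables (f : 'cV[R]_d -> R) (L : R).
Hypotheses (L_ge0 : 0 <= L) (f_diff : forall x, differentiable f x) (f_smooth : smooth L f).

Lemma smooth_sqn x y : sqn (grad f x - grad f y) <= L ^+ 2 * sqn (x - y).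
Proof.
rewrite -!sqr_enorm -exprMn ler_sqr ?nnegrE ?mulr_ge0 ?enorm_ge0//.
Qed.

Lemma grad_monotone_line x h c : 0 <= c ->
  `|dotv (grad f (x + c *: h) - grad f x) h| <= L * c * sqn h.
Proof.
move=> c0; rewrite -ler_sqr ?nnegrE ?mulr_ge0 ?sqn_ge0//.
rewrite real_normK ?num_real//.
apply: le_trans (dotv_CS _ _) _.
rewrite [leRHS]exprMn [sqn h ^+ 2]expr2 mulrA ler_wpM2r ?sqn_ge0//.
apply: le_trans (smooth_sqn _ _) _.
by rewrite [x + _]addrC addrK sqnZ exprMn mulrA.
Qed.

Let continuous_line x h (A : set R) :
  {within A, continuous (fun s : R => f (x + s *: h))}.
Proof.
apply: continuous_subspaceT => t.
apply: differentiable_continuous; apply/derivable1_diffP.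
exact: (@ex_derive _ _ _ _ _ _ _ (is_derive_line (f_diff _))).
Qed.

Let mvt_line x h t : 0 < t -> exists2 c, 0 < c < t &
  f (x + t *: h) - f x = dotv (grad f (x + c *: h)) h * t.
Proof.
move=> t0; have [s _||c] := @MVT R (fun s => f (x + s *: h))
  (fun s => dotv (grad f (x + s *: h)) h) 0 t t0.
- exact: is_derive_line.
- exact: continuous_line.
by rewrite in_itv /= scale0r addr0 subr0; exists c.
Qed.

Lemma smooth_upper x y :
  f y <= f x + dotv (grad f x) (y - x) + L / 2 * sqn (y - x).
Proof.
set h := y - x; have -> : y = x + 1 *: h by rewrite scale1r /h addrC subrK.
(* Subtracting the linear and the quadratic term makes the derivative of [psi] nonpositive on the
   unit interval, so the mean value theorem gives [psi 1 <= psi 0] and no integral of the gradient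
   is taken. *)
pose psi t := f (x + t *: h) - t * dotv (grad f x) h - L / 2 * sqn h * t ^+ 2.
pose dpsi t := dotv (grad f (x + t *: h)) h - dotv (grad f x) h - L * sqn h * t.
have dpsiP t : is_derive t (1 : R) psi (dpsi t).
  have D := is_derive_line (f_diff (x + t *: h)).
  apply: is_derive_eq.
  by rewrite scaler0 add0r /dpsi /GRing.scale /=; field.
have [|c] := @MVT R psi dpsi 0 1 ltr01 (fun s _ => dpsiP s).
  apply: continuous_subspaceT => s.
  apply: differentiable_continuous; apply/derivable1_diffP.
  exact: (@ex_derive _ _ _ _ _ _ _ (dpsiP s)).
rewrite in_itv /= => /andP[c0 c1].
rewrite /psi scale0r addr0 /dpsi => E.
have := grad_monotone_line x h (ltW c0).
rewrite ler_norml => /andP[_].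
rewrite dotvDl dotvNl; lra.
Qed.

(** Convexity bounds [f y - f x] from below by the slope at an intermediate point [x + c h].
    Smoothness moves this slope to [x] at the cost [L c |h|^2], which vanishes with the chord
    parameter [t]. *)
Lemma convex_lower x y : convex_function setT f ->
  f x + dotv (grad f x) (y - x) <= f y.
Proof.
move=> cf; set h := y - x.
have seg t : 0 <= t <= 1 -> f (x + t *: h) <= (1 - t) * f x + t * f y.
  move=> t01.
  have := cf (Itv01 (andP t01).1 (andP t01).2) y x (mem_set I) (mem_set I).
  rewrite convRE /= /conv /=; rewrite addrC [leRHS]addrC; congr (f _ <= _).
  by rewrite /h /unstable.onem scalerBr scalerBl scale1r -addrA; congr (_ + _); rewrite addrC.
apply/ler_addgt0Pl => eps eps0.
(* This [t] gives [L t |h|^2 <= eps]; the [+ 1] keeps the denominator positive when [h = 0]. *)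
pose t := Num.min 1 (eps / (L * sqn h + 1)).
have S0 : 0 <= L * sqn h by rewrite mulr_ge0 ?sqn_ge0.
have t0 : 0 < t by rewrite lt_min ltr01 divr_gt0// ltr_wpDl.
have tS : L * t * sqn h <= eps.
  have : t * (L * sqn h + 1) <= eps.
    by rewrite -ler_pdivlMr ?ltr_wpDl// ge_min lexx orbT.
  by move: t0; lra.
have [c /andP[c0 ct] cE] := mvt_line x h t0.
have /seg st : 0 <= t <= 1 by rewrite (ltW t0) /= ge_min lexx.
have : dotv (grad f (x + c *: h)) h <= f y - f x.
  by rewrite -(ler_pM2r t0) -cE; lra.
have := grad_monotone_line x h (ltW c0).
rewrite ler_norml dotvDl dotvNl => /andP[+ _].
have : L * c * sqn h <= L * t * sqn h.
  by rewrite -!mulrA mulrCA [leRHS]mulrCA ler_wpM2r// ltW.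
by lra.
Qed.

End Gradient.

(** * Accelerated gossip *)

Section ScalarGossip.
Context {R : realType}.

(** Accelerated gossip along one eigenvector: [w] is the corresponding eigenvalue of the lazy matrix
    [(1 - a) I + a P]. *)
Fixpoint scalar_pair (w b : R) (s : nat) : R * R :=
  if s is s'.+1 then
    let: (y, y') := scalar_pair w b s' in (w * (y + b * (y - y')), y)
  else (1, 1).

(** The recursion has characteristic polynomial [x^2 - 2 h x + w b]. At [w = 1 - q^2] it has the
    double root [1 - q]; for [0 < w < 1 - q^2] its roots are complex, with real part [h] and modulus
    [sqrt (w b) <= 1 - q]. The associated quadratic form bounds [y_(s+1) - h y_s] without solving
    the recursion, and the double root accounts for the factor [s + 1]. *)
Lemma scalar_pair_bound (q w : R) s : 0 < q < 1 -> 0 <= w <= 1 - q ^+ 2 ->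
  `|(scalar_pair w ((1 - q) / (1 + q)) s).1| <= s.+1%:R * (1 - q) ^+ s.
Proof.
move=> /andP[q0 q1] /andP[w0 w1]; set b := (1 - q) / (1 + q); set r := 1 - q.
have r0 : 0 <= r by rewrite subr_ge0 ltW.
have q1' : 1 + q != 0 by rewrite gt_eqF// addr_gt0.
have b0 : 0 <= b by rewrite divr_ge0// addr_ge0// ltW.
have bE : 1 + b = 2 / (1 + q) by rewrite /b; field.
pose h := w / (1 + q).
have h0 : 0 <= h by rewrite divr_ge0// addr_ge0// ltW.
have hE : w * (1 + b) = 2 * h by rewrite bE /h; field.
have hr : h <= r.
  rewrite ler_pdivrMr ?addr_gt0//; apply: le_trans w1 _.
  by rewrite /r; lra.
have wb0 : 0 <= w * b by exact: mulr_ge0.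
have wb : w * b <= r ^+ 2.
  have -> : r ^+ 2 = (1 - q ^+ 2) * b by rewrite /r /b; field.
  exact: ler_wpM2r.
have hwb : h ^+ 2 <= w * b.
  have -> : w * b = h * r by rewrite /h /b /r; field.
  by rewrite expr2 ler_wpM2l.
(* [E] is multiplied by [w * b <= r ^+ 2] at each step, and it dominates
   [(p.1 - h * p.2) ^+ 2]. *)
pose E (p : R * R) := p.1 ^+ 2 - 2 * h * p.1 * p.2 + w * b * p.2 ^+ 2.
have E_le n : 0 <= E (scalar_pair w b n) <= r ^+ n ^+ 2.
  elim: n => [|n]; rewrite /E /=.
    by rewrite !expr1n !mulr1; move: hE w0 w1 (sqr_ge0 q); lra.
  case: (scalar_pair w b n) => y y' /= /andP[IH0 IH1].
  set z := (X in _ <= X <= _).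
  have -> : z = w * b * (y ^+ 2 - 2 * h * y * y' + w * b * y' ^+ 2).
    by rewrite /z -hE; ring.
  rewrite [r ^+ n.+1]exprS exprMn mulr_ge0//=.
  exact: ler_pM.
elim: s => [|m IH]; first by rewrite /= normr1 mulr1.
have := E_le m.+1; move: IH; rewrite /E /=.
case: (scalar_pair w b m) => y y' /= IH /andP[_].
set z := w * _ => zE.
have zr : `|z - h * y| <= r ^+ m.+1.
  rewrite -ler_sqr ?nnegrE ?exprn_ge0// real_normK ?num_real//.
  apply: le_trans zE; rewrite -subr_ge0.
  have : 0 <= (w * b - h ^+ 2) * y ^+ 2 by rewrite mulr_ge0 ?sqr_ge0 ?subr_ge0.
  by congr (_ <= _); ring.
have hy : `|h * y| <= m.+1%:R * r ^+ m.+1.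
  rewrite normrM (ger0_norm h0) exprS mulrCA; exact: ler_pM.
rewrite -(subrK (h * y) z); apply: le_trans (ler_normD _ _) _.
by rewrite -[m.+2%:R]natr1 mulrDl mul1r addrC lerD.
Qed.

End ScalarGossip.

Section SymmetricDiagonalization.
Local Open Scope sesquilinear_scope.
Context {R : realType} {M : nat}.
Local Notation C := (R[i]).
Local Notation toC := (real_complex R).

Lemma char_poly_diag_conj (F : fieldType) (U A : 'M[F]_M) (D : 'rV[F]_M) :
  U \in unitmx -> U *m A = diag_mx D *m U ->
  char_poly A = \prod_k ('X - (D 0 k)%:P).
Proof.
move=> uU UA.
have -> : \prod_k ('X - (D 0 k)%:P) = char_poly (diag_mx D).
  rewrite char_poly_trig ?diag_mx_is_trig//.
  by apply: eq_bigr => k _; rewrite mxE eqxx mulr1n.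
have dU : \det (map_mx polyC U) != 0.
  by rewrite det_map_mx polyC_eq0 -unitfE -unitmxE.
apply: (mulfI dU); rewrite [RHS]mulrC /char_poly -!det_mulmx; congr (\det _).
rewrite /char_poly_mx mulmxBr mulmxBl.
by rewrite -!map_mxM UA scalar_mxC.
Qed.

(** The spectral theorem is applied over the complex numbers, where a real symmetric matrix is
    Hermitian, hence normal. The eigenvalues come out real, but the basis [U] stays complex. The
    factored characteristic polynomial ties [D], with multiplicities, to the prescribed list of
    eigenvalues. *)
Lemma symmetric_diagonalization (P : 'M[R]_M) : P^T = P ->
  exists (U : 'M[C]_M) (D : 'rV[R]_M),
    [/\ U *m U ^t* = 1%:M,
        map_mx toC P *m U ^t* = U ^t* *m diag_mx (map_mx toC D)
      & char_poly P = \prod_k ('X - (D 0 k)%:P)].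
Proof.
move=> P_sym; pose A := map_mx toC P.
have A_sym : A \is symmetricmx.
  apply/is_hermitianmxP; rewrite expr0 scale1r map_mx_id//.
  by rewrite /A map_trmx P_sym.
have A_real : A \is a realmx.
  by apply/mxOverP => i j; rewrite mxE; apply/complex_realP; exists (P i j).
have A_herm := realsym_hermsym A_sym A_real.
have A_norm := hermitian_normalmx A_herm.
pose U := spectralmx A.
have U_unitary : U \is unitarymx := spectral_unitarymx A.
have UU : U *m U ^t* = 1%:M by apply/unitarymxP.
have AE : A = invmx U *m diag_mx (spectral_diag A) *m U by apply/orthomx_spectralP.
pose D : 'rV[R]_M := map_mx (@complex.Re R) (spectral_diag A).
have DE : map_mx toC D = spectral_diag A.
  apply/rowP => k; rewrite !mxE; apply: RRe_real.
  by have /mxOverP := hermitian_spectral_diag_real A_herm; apply.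
exists U, D; split => //.
  by rewrite -/A AE invmx_unitary// DE -!mulmxA UU mulmx1.
have uU : U \in unitmx := unitarymx_unit U_unitary.
have /(char_poly_diag_conj uU) E : U *m A = diag_mx (map_mx toC D) *m U.
  by rewrite AE DE -!mulmxA mulKVmx.
have inj := map_poly_inj (real_complex R : {rmorphism R -> C}).
apply: inj; rewrite map_char_poly -/A E rmorph_prod.
by apply: eq_bigr => k _; rewrite rmorphB /= map_polyX map_polyC mxE.
Qed.

End SymmetricDiagonalization.

Lemma sorted_count_le1 (R : realType) (lam : seq R) (t : R) :
  sorted >=%R lam -> ((1 < size lam)%N -> lam`_1 <= t) ->
  (count (fun l => (t < l)%R) lam <= 1)%N.
Proof.
case: lam => [|l0 [|l1 s]] //= srt; first by case: (t < l0).
move=> /(_ isT) l1t; have /andP[_ p1] := srt.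
rewrite [(t < l1)]ltNge l1t /= add0n.
suff -> : count (fun l => (t < l)%R) s = 0%N by case: (t < l0).
apply/eqP; rewrite -leqn0 leqNgt -has_count; apply/hasPn => x xs.
rewrite -leNgt; apply: le_trans l1t.
by have /allP := order_path_min (rev_trans le_trans) p1; apply.
Qed.

Section GossipContraction.
Local Open Scope sesquilinear_scope.
Context {R : realType} {M : nat}.
Local Notation C := (R[i]).
Local Notation toC := (real_complex R).

Variables (P : 'M[R]_M) (lam : seq R) (rho : R).
Hypotheses (M_gt0 : (0 < M)%N) (P_sym : P^T = P) (P_stoch : doubly_stochastic P)
  (P_spec : spectrum P lam) (gap : (1 < M)%N -> rho <= 1 - lam`_1)
  (rho_gt0 : 0 < rho).

Variables (U : 'M[C]_M) (D : 'rV[R]_M).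
Hypotheses (UU : U *m U ^t* = 1%:M)
  (PU : map_mx toC P *m U ^t* = U ^t* *m diag_mx (map_mx toC D))
  (P_char : char_poly P = \prod_k ('X - (D 0 k)%:P)).

Let UU' : U ^t* *m U = 1%:M. Proof. exact: mulmx1C. Qed.

Let UP : U *m map_mx toC P = diag_mx (map_mx toC D) *m U.
Proof.
by rewrite -[LHS]mulmx1 -UU' mulmxA -(mulmxA U) PU !mulmxA UU mul1mx.
Qed.

Let conj_toC (x : R) : (toC x)^* = toC x.
Proof. exact: conjc_real. Qed.

(** For the unit eigenvector [u], the nonnegative sum of [P i j |u_i + u_j|^2] over all pairs equals
    [2 (1 + D 0 k)], because rows and columns of [P] sum to one. *)
Lemma eigen_ge_N1 k : -1 <= D 0 k.
Proof.
have [P01 Pr Pc] := P_stoch.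
pose u j := U k j.
have u1 : \sum_j u j * (u j)^* = 1.
  have := congr1 (fun A : 'M[C]_M => A k k) UU; rewrite !mxE eqxx mulr1n => <-.
  by apply: eq_bigr => j _; rewrite !mxE.
have uP j : \sum_i u i * toC (P i j) = toC (D 0 k) * u j.
  have := congr1 (fun A : 'M[C]_M => A k j) UP.
  rewrite mul_diag_mx !mxE => <-.
  by apply: eq_bigr => i _; rewrite !mxE.
have Pij i j : P i j = P j i by rewrite -[in LHS]P_sym mxE.
have S0 : 0 <= \sum_i \sum_j toC (P i j) * ((u i + u j) * (u i + u j)^*).
  apply: sumr_ge0 => i _; apply: sumr_ge0 => j _.
  rewrite mulr_ge0 ?mul_conjC_ge0//.
  by rewrite lecR; have /andP[] := P01 i j.
have E : \sum_i \sum_j toC (P i j) * ((u i + u j) * (u i + u j)^*) =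
    2 * (1 + toC (D 0 k)).
  transitivity (\sum_i (u i * (u i)^* * toC (\sum_j P i j)) +
      \sum_j (u j * (u j)^* * toC (\sum_i P i j)) +
      (\sum_j (\sum_i u i * toC (P i j)) * (u j)^* +
      \sum_i (\sum_j u j * toC (P j i)) * (u i)^*)).
    under [X in _ = X + _ + _]eq_bigr do rewrite rmorph_sum mulr_sumr.
    under [X in _ = _ + X + _]eq_bigr do rewrite rmorph_sum mulr_sumr.
    under [X in _ = _ + _ + (X + _)]eq_bigr do rewrite mulr_suml.
    under [X in _ = _ + _ + (_ + X)]eq_bigr do rewrite mulr_suml.
    rewrite [X in _ = _ + X + _]exchange_big.
    rewrite [X in _ = _ + _ + (X + _)]exchange_big.
    rewrite -!big_split; apply: eq_bigr => i _.
    rewrite -!big_split; apply: eq_bigr => j _ /=.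
    by rewrite rmorphD /= (Pij j i); ring.
  under eq_bigr do rewrite Pr rmorph1 mulr1.
  under [X in _ + X + _]eq_bigr do rewrite Pc rmorph1 mulr1.
  under [X in _ + _ + (X + _)]eq_bigr do rewrite uP -mulrA.
  under [X in _ + _ + (_ + X)]eq_bigr do rewrite uP -mulrA.
  by rewrite -!mulr_sumr u1; ring.
move: S0; rewrite E pmulr_rge0//.
have -> : 1 + toC (D 0 k) = toC (1 + D 0 k) by rewrite rmorphD rmorph1.
by rewrite lecR; lra.
Qed.

Definition spectral_coords d (X : 'M[R]_(d, M)) : 'M[C]_(d, M) :=
  map_mx toC X *m U ^t*.

Let scD d (X Y : 'M[R]_(d, M)) :
  spectral_coords (X + Y) = spectral_coords X + spectral_coords Y.
Proof. by rewrite /spectral_coords map_mxD mulmxDl. Qed.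

Let scDE d (X Y : 'M[C]_(d, M)) i k : (X + Y) i k = X i k + Y i k.
Proof. exact: mxE. Qed.

Let scZE d c (X : 'M[C]_(d, M)) i k : (c *: X) i k = c * X i k.
Proof. exact: mxE. Qed.

Let scZ d c (X : 'M[R]_(d, M)) :
  spectral_coords (c *: X) = toC c *: spectral_coords X.
Proof. by rewrite /spectral_coords map_mxZ scalemxAl. Qed.

Lemma spectral_coords_norm d (X : 'M[R]_(d, M)) :
  \sum_i \sum_k spectral_coords X i k * (spectral_coords X i k)^* =
  toC (\sum_i \sum_j X i j ^+ 2).
Proof.
have trE (Y : 'M[C]_(d, M)) : \sum_i \sum_k Y i k * (Y i k)^* = \tr (Y *m Y ^t*).
  apply: eq_bigr => i _; rewrite !mxE; apply: eq_bigr => k _.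
  by rewrite !mxE.
rewrite trE /spectral_coords trmx_mul map_mxM /= trmxCK mulmxA -(mulmxA (map_mx _ _)) UU' mulmx1.
rewrite -trE rmorph_sum; apply: eq_bigr => i _; rewrite rmorph_sum.
by apply: eq_bigr => j _; rewrite !mxE conj_toC rmorphXn expr2.
Qed.

Lemma spectral_coords_gossip d (X : 'M[R]_(d, M)) a b s i k :
  let w := (1 - a) + a * D 0 k in
  spectral_coords (gossip_pair a b P X s).1 i k =
    toC (scalar_pair w b s).1 * spectral_coords X i k /\
  spectral_coords (gossip_pair a b P X s).2 i k =
    toC (scalar_pair w b s).2 * spectral_coords X i k.
Proof.
move=> w; elim: s => [|s [IH1 IH2]] /=; first by rewrite !mul1r.
case: (gossip_pair a b P X s) IH1 IH2 => Y Y' /=.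
case: (scalar_pair w b s) => y y' /= IH1 IH2; split => //.
set V := Y + _.
have VE : spectral_coords V i k = toC (y + b * (y - y')) * spectral_coords X i k.
  rewrite /V scD scZ -(scaleN1r Y') scD scZ !(scDE, scZE) IH1 IH2.
  by rewrite !(rmorphD, rmorphM, rmorphB, rmorphN, rmorph1) /=; ring.
have VPE : spectral_coords (V *m P) i k = toC (D 0 k) * spectral_coords V i k.
  by rewrite /spectral_coords map_mxM /= -mulmxA PU mulmxA mul_mx_diag !mxE mulrC.
rewrite scD !scZ !(scDE, scZE) VPE VE /w !(rmorphM, rmorphD, rmorphB, rmorph1) /=.
ring.
Qed.

(* At most one eigenvalue exceeds [1 - rho]; its eigenvector is then the all-ones
   vector, to which the rows of [X] are orthogonal. *)
Lemma spectral_coords_centered d (X : 'M[R]_(d, M)) i k :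
  (forall i, \sum_j X i j = 0) -> 1 - rho < D 0 k -> spectral_coords X i k = 0.
Proof.
move=> X0 Dk; have [P01 Pr Pc] := P_stoch.
have [lam_sorted lam_char] := P_spec.
have lam_perm : perm_eq [seq D 0 k | k : 'I_M] lam.
  apply: prod_XsubC_eq; rewrite -lam_char P_char big_image /=.
  exact: eq_bigr.
have lam_size : size lam = M by rewrite -(perm_size lam_perm) size_map size_enum_ord.
have uniqk k' : 1 - rho < D 0 k' -> k' = k.
  have := @sorted_count_le1 R lam (1 - rho) lam_sorted.
  rewrite lam_size => /(_ (fun h => ltac:(by move: (gap h); lra))).
  rewrite -(permP lam_perm) count_map => cnt Dk'.
  apply/eqP; apply: contraTT cnt => kk'; rewrite -ltnNge.
  rewrite -size_filter; apply: (@uniq_leq_size _ [:: k; k']).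
    by rewrite /= inE eq_sym kk'.
  by move=> l; rewrite !inE mem_filter mem_enum /= andbT => /orP[]/eqP->.
pose o : 'M[R]_(1, M) := const_mx 1.
have oP : o *m P = o.
  apply/rowP => j; rewrite !mxE -[RHS](Pc j); apply: eq_bigr => l _.
  by rewrite mxE mul1r.
have c_eig l : spectral_coords o 0 l * toC (D 0 l) = spectral_coords o 0 l.
  rewrite -{2}oP /spectral_coords map_mxM /= -mulmxA PU mulmxA mul_mx_diag.
  by rewrite !mxE.
have c0 l : l != k -> spectral_coords o 0 l = 0.
  move=> lk; apply/eqP; apply: contraNT lk => cl; apply/eqP; apply: uniqk.
  have : toC (D 0 l) = toC 1.
    by apply: (mulfI cl); rewrite c_eig rmorph1 mulr1.
  by move/complexI ->; move: rho_gt0; lra.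
have ck : spectral_coords o 0 k != 0.
  apply/negP => /eqP ck; have := spectral_coords_norm o.
  rewrite big_ord1 big1 => [|l _]; last first.
    by have [->|/c0 ->] := eqVneq l k; rewrite ?ck mul0r.
  rewrite big_ord1; under eq_bigr do rewrite mxE expr1n.
  rewrite sumr_const card_ord => /esym/eqP.
  by rewrite -(rmorph0 toC) => /eqP/complexI/eqP; rewrite pnatr_eq0 eqn0Ngt M_gt0.
have : \sum_l spectral_coords X i l * (spectral_coords o 0 l)^* = 0.
  transitivity ((spectral_coords X *m (spectral_coords o) ^t*) i 0).
    by rewrite [RHS]mxE; apply: eq_bigr => l _; congr (_ * _); rewrite !mxE.
  rewrite /spectral_coords trmx_mul map_mxM /= trmxCK mulmxA -(mulmxA (map_mx _ _)) UU' mulmx1 mxE.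
  rewrite -[RHS](rmorph0 toC) -(X0 i) rmorph_sum; apply: eq_bigr => j _.
  by rewrite !mxE !rmorph1 mulr1.
rewrite (bigD1 k)//= big1 => [|l lk]; last first.
  by rewrite c0// conjC0 mulr0.
rewrite addr0 => /eqP; rewrite mulf_eq0 conjC_eq0 (negbTE ck) orbF.
by move/eqP.
Qed.

End GossipContraction.

Definition gossip_rate (R : realType) (rho : R) (B : nat) : R :=
  B.+1%:R * (1 - Num.sqrt (rho / 2)) ^+ B.

Definition colavg (R : realType) d M (X : 'M[R]_(d, M)) : 'cV[R]_d :=
  M%:R^-1 *: \sum_i col i X.

Definition dispersion (R : realType) d M (X : 'M[R]_(d, M)) : R :=
  \sum_i sqn (col i X - colavg X).

(** For an eigenvalue in [[-1, 1 - rho]] the lazy weight [1 / 2] puts [w] in [[0, 1 - rho / 2]],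
    exactly the range of [scalar_pair_bound] for [q = sqrt (rho / 2)]; this explains
    [gossip_momentum]. Coordinates on a larger eigenvalue vanish, and Parseval sums the rest. *)
Lemma gossip_contraction (R : realType) M (P : 'M[R]_M) (lam : seq R) (rho : R)
    d (X : 'M[R]_(d, M)) B :
  (0 < M)%N -> P^T = P -> doubly_stochastic P -> spectrum P lam ->
  ((1 < M)%N -> rho <= 1 - lam`_1) -> 0 < rho <= 1 ->
  (forall i, \sum_j X i j = 0) ->
  \sum_i \sum_j gossip (1 / 2) (gossip_momentum rho) P X B i j ^+ 2 <=
  gossip_rate rho B ^+ 2 * \sum_i \sum_j X i j ^+ 2.
Proof.
move=> M0 Ps Pst Psp gap /andP[r0 r1] X0.
have [U [D [UU PU Pchar]]] := symmetric_diagonalization Ps.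
rewrite -lecR rmorphM /= -!(spectral_coords_norm UU) mulr_sumr.
apply: ler_sum => i _; rewrite mulr_sumr; apply: ler_sum => k _.
have [] := spectral_coords_gossip PU X (1 / 2) (gossip_momentum rho) B i k.
set w := 1 - 1 / 2 + _ => -> _.
have DN1 := eigen_ge_N1 Ps Pst UU PU k.
have [Dk|Dk] := leP (D 0 k) (1 - rho); last first.
  by rewrite (spectral_coords_centered M0 Pst Psp gap r0 UU PU Pchar i X0 Dk) !(mulr0, mul0r).
have s0 : 0 < Num.sqrt (rho / 2) by rewrite sqrtr_gt0; lra.
have s1 : Num.sqrt (rho / 2) < 1.
  by rewrite -[ltRHS]sqrtr1 ltr_sqrt ?ltr01//; lra.
have conj_toC (x : R) : (x%:C%C)^* = x%:C%C :> R[i] by exact: conjc_real.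
rewrite rmorphM /= conj_toC mulrACA -rmorphM ler_wpM2r ?mul_conjC_ge0//.
rewrite lecR -expr2 -(real_normK (num_real _)) ler_sqr ?nnegrE//.
  by apply: scalar_pair_bound; rewrite ?s0// sqr_sqrtr /w; lra.
by rewrite mulr_ge0// exprn_ge0// subr_ge0; exact: ltW.
Qed.

Section GossipAverage.
Context {R : realType} {d M : nat}.
Variables (P : 'M[R]_M) (lam : seq R) (rho : R).
Hypotheses (M_gt0 : (0 < M)%N) (P_sym : P^T = P) (P_stoch : doubly_stochastic P)
  (P_spec : spectrum P lam) (gap : (1 < M)%N -> rho <= 1 - lam`_1)
  (hrho : 0 < rho <= 1).
Implicit Types (X Y : 'M[R]_(d, M)).

Lemma colavgE X i : colavg X i 0 = M%:R^-1 * \sum_j X i j.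
Proof.
by rewrite mxE summxE; congr (_ * _); apply: eq_bigr => j _; rewrite mxE.
Qed.

Lemma colavgD X Y : colavg (X + Y) = colavg X + colavg Y.
Proof.
apply/colP => i; rewrite [RHS]mxE !colavgE -mulrDr -big_split.
by congr (_ * _); apply: eq_bigr => j _; rewrite mxE.
Qed.

Lemma colavgZ c X : colavg (c *: X) = c *: colavg X.
Proof.
apply/colP => i; rewrite [RHS]mxE !colavgE mulrCA; congr (_ * _).
by rewrite mulr_sumr; apply: eq_bigr => j _; rewrite mxE.
Qed.

Lemma colavgB X Y : colavg (X - Y) = colavg X - colavg Y.
Proof. by rewrite -scaleN1r colavgD colavgZ scaleN1r. Qed.

Lemma colavg_mulP X : colavg (X *m P) = colavg X.
Proof.
have [_ Pr _] := P_stoch.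
apply/colP => i; rewrite !colavgE; congr (_ * _).
under eq_bigr do rewrite mxE.
rewrite exchange_big; apply: eq_bigr => j _.
by rewrite -mulr_sumr Pr mulr1.
Qed.

Lemma colavg_gossip_pair a b X s :
  colavg (gossip_pair a b P X s).1 = colavg X /\
  colavg (gossip_pair a b P X s).2 = colavg X.
Proof.
elim: s => [//|s [IH1 IH2]] /=.
case: (gossip_pair a b P X s) IH1 IH2 => Y Y' /= IH1 IH2; split => //.
rewrite !(colavgB, colavgD, colavgZ, colavg_mulP) IH1 IH2 subrr scaler0 addr0.
by rewrite -scalerDl subrK scale1r.
Qed.

Lemma colavg_gossip a b X s : colavg (gossip a b P X s) = colavg X.
Proof. by have [] := colavg_gossip_pair a b X s. Qed.

Definition consensus (v : 'cV[R]_d) : 'M[R]_(d, M) := v *m const_mx 1.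

Lemma consensusE v i j : consensus v i j = v i 0.
Proof. by rewrite mxE big_ord1 mxE mulr1. Qed.

Lemma consensus_mulP v : consensus v *m P = consensus v.
Proof.
have [_ _ Pc] := P_stoch.
apply/matrixP => i j; rewrite mxE consensusE.
by under eq_bigr do rewrite consensusE; rewrite -mulr_sumr Pc mulr1.
Qed.

Lemma gossip_pairB a b X v s :
  gossip_pair a b P (X - consensus v) s =
  ((gossip_pair a b P X s).1 - consensus v, (gossip_pair a b P X s).2 - consensus v).
Proof.
elim: s => [//|s] /=; case: (gossip_pair a b P X s) => Y Y' /= ->.
congr (_, _); set K := consensus v; set V := Y + b *: (Y - Y').
have -> : Y - K + b *: (Y - K - (Y' - K)) = V - K.
  by rewrite /V opprB addrA subrK addrAC.
rewrite mulmxBl consensus_mulP !scalerBr addrACA -opprD -scalerDl subrK.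
by rewrite scale1r.
Qed.

Lemma dispersionE X : dispersion X = \sum_i \sum_j (X - consensus (colavg X)) i j ^+ 2.
Proof.
rewrite exchange_big; apply: eq_bigr => j _; rewrite sqnE.
apply: eq_bigr => i _; rewrite [(X - _) i j]mxE [(- consensus _) i j]mxE consensusE.
by rewrite [in LHS]mxE [(col _ _) _ _]mxE [(- colavg _) _ _]mxE.
Qed.

(** Consensus matrices are fixed by [P], so gossip commutes with subtracting the average, and the
    centered rows meet the hypothesis of [gossip_contraction]. *)
Lemma dispersion_gossip X B :
  dispersion (gossip (1 / 2) (gossip_momentum rho) P X B) <=
  gossip_rate rho B ^+ 2 * dispersion X.
Proof.
rewrite !dispersionE colavg_gossip.
have -> : gossip (1 / 2) (gossip_momentum rho) P X B - consensus (colavg X) =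
    gossip (1 / 2) (gossip_momentum rho) P (X - consensus (colavg X)) B.
  by rewrite /gossip gossip_pairB.
apply: gossip_contraction P_spec gap hrho _ => // i.
rewrite (eq_bigr (fun j => X i j - colavg X i 0)); last first.
  move=> j _; rewrite [(X - _) i j]mxE [(- consensus _) i j]mxE.
  by rewrite consensusE.
rewrite sumrB sumr_const card_ord colavgE -[X in _ - X]mulr_natl mulrA.
by rewrite divff ?mul1r ?subrr// pnatr_eq0 -lt0n.
Qed.

End GossipAverage.

Section Dispersion.
Context {R : realType} {d M : nat}.
Hypothesis M_gt0 : (0 < M)%N.
Implicit Types (X Y : 'M[R]_(d, M)) (v : 'cV[R]_d).

Let M_neq0 : M%:R != 0 :> R. Proof. by rewrite pnatr_eq0 -lt0n. Qed.

Lemma sum_col X : \sum_i col i X = M%:R *: colavg X.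
Proof. by rewrite scalerA mulfV// scale1r. Qed.

(** Bias-variance identity: deviations from the average sum to zero, which removes the cross
    term. *)
Lemma sum_sqn_col X v :
  \sum_i sqn (col i X - v) = dispersion X + M%:R * sqn (colavg X - v).
Proof.
rewrite (eq_bigr (fun i => sqn (col i X - colavg X) +
    2 * dotv (col i X - colavg X) (colavg X - v) + sqn (colavg X - v))).
  rewrite !big_split /= sumr_const card_ord -[X in _ + X]mulr_natl -mulr_sumr.
  rewrite -dotv_suml sumrB sumr_const card_ord sum_col scaler_nat subrr dotv0l.
  by rewrite mulr0 addr0.
by move=> i _; rewrite -sqnD addrA subrK.
Qed.

Lemma dispersion_le X v : dispersion X <= \sum_i sqn (col i X - v).
Proof. by rewrite sum_sqn_col lerDl mulr_ge0 ?sqn_ge0. Qed.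

Lemma dispersion_ge0 X : 0 <= dispersion X.
Proof. by apply: sumr_ge0 => i _; exact: sqn_ge0. Qed.

Lemma colE (X Y : 'M[R]_(d, M)) a b i :
  col i (a *: X + b *: Y) = a *: col i X + b *: col i Y.
Proof. by apply/colP => j; rewrite !mxE. Qed.

Lemma dispersion_conv t X Y : 0 <= t <= 1 ->
  dispersion ((1 - t) *: X + t *: Y) <= (1 - t) * dispersion X + t * dispersion Y.
Proof.
move=> t01; rewrite /dispersion !mulr_sumr -big_split; apply: ler_sum => i _.
rewrite colE colavgD !colavgZ opprD addrACA -!scalerBr; exact: sqn_conv.
Qed.

(** The exact identity [H] leaves at most [(1 + 2 c) ((1 + c) |u|^2 + c |v|^2)], and [c = 2] yields
    15 and 10. The range of [c] covers the coefficient [m_t (1 + m_(t+1))] of the algorithm. *)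
Lemma sqn_extrapolate c (u v : 'cV[R]_d) : 0 <= c <= 2 ->
  sqn (u + c *: (u - v)) <= 15 * sqn u + 10 * sqn v.
Proof.
move=> /andP[c0 c2].
have H : sqn (u + c *: (u - v)) + c * (1 + c) * sqn (u + v) =
    (1 + 2 * c) * ((1 + c) * sqn u + c * sqn v).
  by rewrite /sqn !dotvE (dotvC v u); ring.
have H1 : 0 <= c * (1 + c) * sqn (u + v).
  by rewrite !mulr_ge0 ?sqn_ge0 ?addr_ge0.
have U0 := sqn_ge0 u; have V0 := sqn_ge0 v.
have : (1 + 2 * c) * ((1 + c) * sqn u + c * sqn v) <= 5 * (3 * sqn u + 2 * sqn v).
  apply: ler_pM; rewrite ?addr_ge0 ?mulr_ge0 ?addr_ge0//; first lra.
  by apply: lerD; apply: ler_wpM2r => //; lra.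
lra.
Qed.

Lemma dispersion_extrapolate c X Y : 0 <= c <= 2 ->
  dispersion (X + c *: (X - Y)) <= 15 * dispersion X + 10 * dispersion Y.
Proof.
move=> c02; rewrite /dispersion !mulr_sumr -big_split; apply: ler_sum => i _.
have -> : col i (X + c *: (X - Y)) - colavg (X + c *: (X - Y)) =
    (col i X - colavg X) + c *: ((col i X - colavg X) - (col i Y - colavg Y)).
  rewrite colavgD colavgZ colavgB; apply/colP => j; rewrite !mxE; ring.
exact: sqn_extrapolate.
Qed.

Lemma colavg_consensus v : colavg (consensus (M := M) v) = v :> 'cV[R]_d.
Proof.
apply/colP => j; rewrite colavgE.
under eq_bigr do rewrite consensusE.
by rewrite sumr_const card_ord -[X in _ * X]mulr_natl mulKf.
Qed.

Lemma dispersion_consensus v : dispersion (consensus (M := M) v) = 0.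
Proof.
apply/eqP; rewrite eq_le dispersion_ge0 andbT.
apply: le_trans (dispersion_le _ v) _; rewrite big1// => i _.
rewrite (_ : col i _ - v = 0) ?sqn0//.
by apply/colP => j; rewrite mxE [col _ _ _ _]mxE consensusE [(- v) _ _]mxE subrr mxE.
Qed.

Lemma dispersion_sum_le n (eta : nat -> R) (Gs : nat -> 'M[R]_(d, M)) v :
  dispersion (consensus v - \sum_(s < n) eta s *: Gs s) <=
  n%:R * \sum_(s < n) eta s ^+ 2 * dispersion (Gs s).
Proof.
rewrite [in leRHS](eq_bigr (fun s : 'I_n =>
  \sum_i eta s ^+ 2 * sqn (col i (Gs s) - colavg (Gs s)))); last first.
  by move=> s _; rewrite mulr_sumr.
rewrite exchange_big mulr_sumr; apply: ler_sum => i _.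
pose W (s : nat) := - eta s *: (col i (Gs s) - colavg (Gs s)).
set Y := \sum_(s < n) _.
have YE : col i Y - colavg Y = - \sum_(s < n) W s.
  rewrite /Y /W; elim/big_ind2 : _ => [|a a' b b' Ea Eb|s _].
  - have -> : colavg (0 : 'M[R]_(d, M)) = 0
      by have := colavgZ 0 (0 : 'M[R]_(d, M)); rewrite !scale0r.
    by rewrite !oppr0 addr0; apply/colP => j; rewrite !mxE.
  - rewrite opprD -Ea -Eb colavgD; apply/colP => j; rewrite !mxE; ring.
  - by rewrite colavgZ; apply/colP => j; rewrite !mxE; ring.
rewrite (_ : col i _ - _ = \sum_(s < n) W s).
  apply: le_trans (sqn_sum_le _) _; rewrite ler_wpM2l//.
  by apply: ler_sum => s _; rewrite sqnZ sqrrN.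
rewrite colavgB colavg_consensus -[RHS]opprK -YE.
apply/colP => j; rewrite !mxE big_ord1 !mxE; ring.
Qed.

End Dispersion.

(** * Pathwise descent *)

Section OneStep.
Context {R : realType} {d M : nat}.
Variables (f : 'I_M -> 'cV[R]_d -> R) (L : R) (xstar : 'cV[R]_d).
Hypotheses (M_gt0 : (0 < M)%N) (L_gt0 : 0 < L).
Hypotheses (f_convex : forall i, convex_function setT (f i))
  (f_diff : forall i x, differentiable (f i) x)
  (f_smooth : forall i, smooth L (f i)).
Hypothesis xstar_min : is_minimizer (average f) xstar.

Let M_neq0 : M%:R != 0 :> R. Proof. by rewrite pnatr_eq0 -lt0n. Qed.

Let natlE (c : R) : M%:R * c = \sum_(i < M) c.
Proof. by rewrite sumr_const card_ord mulr_natl. Qed.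

Definition excess x : R := average f x - average f xstar.

Lemma excess_ge0 x : 0 <= excess x.
Proof. by rewrite subr_ge0; exact: xstar_min. Qed.

(** Each gradient has its own evaluation point; for a constant [q] this stands for the gradient of
    [average f]. *)
Definition mean_grad (q : 'I_M -> 'cV[R]_d) : 'cV[R]_d :=
  M%:R^-1 *: \sum_i grad (f i) (q i).

Lemma average_upper x y :
  average f y <= average f x + dotv (mean_grad (fun=> x)) (y - x) +
    L / 2 * sqn (y - x).
Proof.
rewrite /average /mean_grad dotvZl dotv_suml -mulrDr -big_split /=.
rewrite -[X in _ + X](mulKf M_neq0) -mulrDr ler_wpM2l ?invr_ge0//.
rewrite natlE -big_split; apply: ler_sum => i _ /=.
exact: smooth_upper (ltW L_gt0) (f_diff i) (f_smooth i) x y.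
Qed.

(** The step [x - g / L] cannot go below the minimum, while smoothness guarantees a decrease of
    [|g|^2 / (2 L)]. *)
Lemma sqn_mean_grad_le x : sqn (mean_grad (fun=> x)) <= 2 * L * excess x.
Proof.
set g := mean_grad _.
have := le_trans (xstar_min _) (average_upper x (x - L^-1 *: g)).
have -> : x - L^-1 *: g - x = - (L^-1 *: g) by rewrite addrAC subrr add0r.
rewrite sqnN sqnZ dotvNr dotvZr -/g -/(sqn g) -subr_ge0 => H.
rewrite -subr_ge0 /excess -/g.
rewrite [leRHS](_ : _ = 2 * L * (average f x - L^-1 * sqn g +
    L / 2 * (L^-1 ^+ 2 * sqn g) - average f xstar)).
  by rewrite mulr_ge0// mulr_ge0// ltW.
by field; rewrite gt_eqF.
Qed.

(** Young's inequality with weight [L] splits the linear term into [L / 2 |y - x|^2] and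
    [|g|^2 / (2 L)], the latter at most [excess x]. At [x = xstar] the bound becomes the quadratic
    growth that makes the excess integrable. *)
Lemma excess_perturb x y : excess y <= 2 * excess x + L * sqn (y - x).
Proof.
have up := average_upper x y.
have gx := sqn_mean_grad_le x.
have yg := dotv_young (y - x) (mean_grad (fun=> x)) L_gt0.
have : L^-1 * sqn (mean_grad (fun=> x)) <= 2 * excess x.
  by rewrite mulrC ler_pdivrMr// mulrAC.
by move: up yg; rewrite dotvC /excess; lra.
Qed.

Variables (q : 'I_M -> 'cV[R]_d) (y : 'cV[R]_d).

(** Each [f i] is bounded above at [v] by smoothness and below at [u] by convexity, both from the
    base point [q i], so the values at [q i] cancel. The reference point [y] is free here; in
    [one_step] it is the coupling point. *)
Lemma average_linearization u v :
  average f v - average f u <= dotv (mean_grad q) (v - u) + L * sqn (v - y)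
    + L * (M%:R^-1 * \sum_i sqn (q i - y)).
Proof.
rewrite /average /mean_grad dotvZl dotv_suml -mulrBr -sumrB.
rewrite [leRHS](_ : _ = M%:R^-1 * \sum_i (dotv (grad (f i) (q i)) (v - u) +
    L * sqn (v - y) + L * sqn (q i - y))); last first.
  by rewrite !big_split -natlE -mulr_sumr /=; field.
rewrite ler_wpM2l ?invr_ge0//; apply: ler_sum => i _ /=.
have lo := convex_lower (ltW L_gt0) (f_diff i) (f_smooth i) (q i) u (f_convex i).
have up := smooth_upper (ltW L_gt0) (f_diff i) (f_smooth i) (q i) v.
have : L * sqn (v - q i) <= L * (2 * (sqn (v - y) + sqn (q i - y))).
  rewrite ler_wpM2l ?(ltW L_gt0)//.
  rewrite -(sqnN (q i - y)) opprB.
  by have -> : v - q i = v - y + (y - q i); [rewrite subrKA|exact: sqnD_le].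
move: lo up; rewrite !dotvE; lra.
Qed.

Variables (x z n : 'cV[R]_d) (a A beta th : R).
Let g := mean_grad q + n.
Let z' := z - (a / beta) *: g.
Let x' := (1 - th) *: x + th *: z'.
Hypotheses (yE : y = (1 - th) *: x + th *: z) (a_ge0 : 0 <= a) (A_gt0 : 0 < A)
  (thE : A * th = a) (beta_ge1 : 1 <= beta) (th_01 : 0 <= th <= 1)
  (LA_small : L * A * th ^+ 2 <= 1 / 64).

Lemma average_conv u v : average f ((1 - th) *: u + th *: v) <=
  (1 - th) * average f u + th * average f v.
Proof.
rewrite [leRHS](_ : _ = M%:R^-1 * \sum_i ((1 - th) * f i u + th * f i v)); last first.
  by rewrite big_split -!mulr_sumr /average /=; ring.
rewrite ler_wpM2l ?invr_ge0//; apply: ler_sum => i _ /=.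
have cf := f_convex i.
have := cf (Itv01 (andP th_01).1 (andP th_01).2) v u (mem_set I) (mem_set I).
by rewrite convRE /conv /= addrC [leRHS]addrC.
Qed.

Lemma one_step :
  A * excess x' + beta / 2 * sqn (z' - xstar) + 3 / 32 * sqn (z' - z) <=
  (A - a) * excess x + beta / 2 * sqn (z - xstar) - a * dotv n (z - xstar)
  + a ^+ 2 / beta * sqn n + L * A * (M%:R^-1 * \sum_i sqn (q i - y)).
Proof.
have beta_gt0 : 0 < beta := lt_le_trans ltr01 beta_ge1.
(* Comparison point chosen so that [x' - u] is [th (z' - xstar)]: after multiplication by [A] the
   linear term is that of the mirror step. *)
pose u := (1 - th) *: x + th *: xstar.
have lin := average_linearization u x'.
have cv : average f u <= _ := average_conv x xstar.
have xu : x' - u = th *: (z' - xstar).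
  by rewrite /x' /u; apply/colP => j; rewrite !mxE; ring.
have xy : x' - y = th *: (z' - z).
  by rewrite /x' yE; apply/colP => j; rewrite !mxE; ring.
rewrite xu xy sqnZ dotvZr in lin.
set gap := L * (M%:R^-1 * _) in lin.
have -> : L * A * (M%:R^-1 * \sum_i sqn (q i - y)) = A * gap.
  by rewrite /gap; ring.
have D0 := sqn_ge0 (z' - z).
have LAD : L * A * th ^+ 2 * sqn (z' - z) <= 1 / 64 * sqn (z' - z).
  exact: ler_wpM2r.
(* three-point identity for the mirror step *)
have three : a * dotv g (z' - xstar) =
    beta / 2 * (sqn (z - xstar) - sqn (z' - xstar) - sqn (z' - z)).
  have -> : z' - xstar = (z - xstar) - (a / beta) *: g by rewrite addrAC.
  have -> : z' - z = - ((a / beta) *: g) by rewrite addrAC subrr add0r.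
  have key (w v : 'cV[R]_d) : a * dotv v (w - (a / beta) *: v) = beta / 2 *
      (sqn w - sqn (w - (a / beta) *: v) - sqn (- ((a / beta) *: v))).
    by rewrite /sqn !dotvE (dotvC w v); field; rewrite gt_eqF.
  exact: key.
(* Half of the [beta / 2 |z' - z|^2] gained in the mirror step is spent on the noise. *)
have young : - (a * dotv n (z' - z)) <= a ^+ 2 / beta * sqn n + beta / 4 * sqn (z' - z).
  have c0 : 0 < beta / 4 * 2 by rewrite mulr_gt0 ?divr_gt0.
  have := dotv_young (z' - z) (- (a *: n)) c0.
  rewrite sqnN sqnZ dotvNr dotvZr dotvC.
  have -> : (beta / 4 * 2)^-1 * (a ^+ 2 * sqn n) = 2 * (a ^+ 2 / beta * sqn n).
    by field; rewrite gt_eqF.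
  by lra.
have gE : dotv (mean_grad q) (z' - xstar) = dotv g (z' - xstar) - dotv n (z' - xstar).
  by rewrite /g dotvDl addrK.
have nE : dotv n (z' - xstar) = dotv n (z' - z) + dotv n (z - xstar).
  by rewrite -dotvDr addrA subrK.
have Alin : A * (average f x' - average f u) <=
    a * dotv (mean_grad q) (z' - xstar) + L * A * th ^+ 2 * sqn (z' - z) + A * gap.
  have := ler_wpM2l (ltW A_gt0) lin; congr (_ <= _).
  by rewrite -{1}thE; ring.
have Acv : A * average f u <= (A - a) * average f x + a * average f xstar.
  have := ler_wpM2l (ltW A_gt0) cv; congr (_ <= _).
  by rewrite -{1 2}thE; ring.
(* As [beta >= 1], the other half is at least [1 / 4]. Smoothness takes [1 / 64] of it, and what
   remains exceeds the [3 / 32] kept to pay for staleness. *)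
have BD : beta / 4 * sqn (z' - z) >= 1 / 4 * sqn (z' - z).
  by apply: ler_wpM2r => //; apply: ler_wpM2r.
rewrite gE nE in Alin.
move: Alin Acv three young LAD BD; rewrite /excess.
clear -D0.
move: (average f x') (average f u) (average f x) (average f xstar) (sqn (z' - z)) D0 (sqn (z' - xstar)) (sqn (z - xstar)) (dotv n (z' - z)) (dotv n (z - xstar)) (dotv g (z' - xstar)) gap (sqn n) => f1 f2 f3 f4 D D0 s1 s2 d1 d2 d3 e s3.
lra.
Qed.

End OneStep.

(** * Identities and bounds for the step sizes *)

Section StepSizeFacts.
Context {R : realType}.
Variables (L : R) (T : nat).
Hypothesis L_gt0 : 0 < L.
Let L_neq0 : L != 0. Proof. exact: lt0r_neq0. Qed.

Lemma step_AE t : step_A L t = t.+1%:R * t.+2%:R / (256 * L).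
Proof.
elim: t => [|t IH]; rewrite /step_A.
  by rewrite big_nat1 /step_a mul1r; field.
rewrite big_nat_recr//= -/(step_A L t) IH /step_a -[t.+3%:R]natr1 -[t.+2%:R]natr1.
by field.
Qed.

Lemma step_a_gt0 t : 0 < step_a L t.
Proof. by rewrite divr_gt0 ?ltr0n// mulr_gt0 ?ltr0n ?L_gt0. Qed.

Lemma step_A_gt0 t : 0 < step_A L t.
Proof. by rewrite step_AE divr_gt0 ?mulr_gt0 ?ltr0n ?L_gt0. Qed.

Lemma step_thetaE t : (t < T)%N -> step_theta L T t = 2 / t.+2%:R.
Proof.
move=> tT; rewrite /step_theta tT step_AE /step_a; field.
by rewrite L_neq0 -(natrD _ 2) nat1r !pnatr_eq0.
Qed.

Lemma step_theta01 t : 0 <= step_theta L T t <= 1.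
Proof.
have [tT|tT] := ltnP t T; last by rewrite /step_theta ltnNge tT /= lexx ler01.
by rewrite step_thetaE// divr_ge0//= ler_pdivrMr// mul1r ler_nat.
Qed.

Lemma step_mSE t : (t < T)%N -> step_m T t.+1 = t%:R / t.+3%:R :> R.
Proof.
move=> tT; rewrite /step_m /= tT; congr (_ / _).
  by rewrite -natr1 addrK.
by rewrite -natrD addn2.
Qed.

Lemma step_m01 t : 0 <= (step_m T t : R) <= 1.
Proof.
case: t => [|t]; first by rewrite /step_m lexx ler01.
have [tT|tT] := ltnP t T; last first.
  by rewrite /step_m /= [(t < T)%N]ltnNge tT /= lexx ler01.
by rewrite step_mSE// divr_ge0//= ler_pdivrMr// mul1r ler_nat -addn3 leq_addr.
Qed.

(** This compatibility makes extrapolation with weight [m] coincide with linear coupling with weight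
    [theta], as [momentum] spells out. *)
Lemma step_m_theta t : (t.+1 < T)%N ->
  step_m T t.+1 * step_theta L T t = step_theta L T t.+1 * (1 - step_theta L T t).
Proof.
move=> tT; rewrite step_mSE ?step_thetaE// 1?ltnW// -[t.+3%:R]natr1 -[t.+2%:R]natr1 -[t.+1%:R]natr1.
have t0 : 0 <= t%:R :> R by [].
by field; apply/andP; split; apply: lt0r_neq0; lra.
Qed.

(** Bounding [1 + m] by 2 turns the left side into [(t + 3) / (16 (t + 2))], largest at [t = 0]:
    this is the origin of [3 / 32]. *)
Lemma delay_coeff t : (t < T)%N ->
  L * step_A L t.+1 * ((1 + step_m T t.+1) * step_theta L T t) ^+ 2 <= 3 / 32.
Proof.
move=> tT; have LA0 := ltW (mulr_gt0 L_gt0 (step_A_gt0 t.+1)).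
have [m0 m1] := andP (step_m01 t.+1).
have [th0 th1] := andP (step_theta01 t).
apply: (@le_trans _ _ (L * step_A L t.+1 * (2 * step_theta L T t) ^+ 2)).
  apply: (ler_wpM2l LA0).
  have Hl : 0 <= (1 + step_m T t.+1) * step_theta L T t by apply: mulr_ge0 => //; lra.
  have Hr : 0 <= 2 * step_theta L T t by lra.
  rewrite ler_sqr ?nnegrE ?Hl ?Hr//; apply: ler_wpM2r => //; lra.
clear -tT L_gt0 L_neq0; rewrite step_AE step_thetaE//.
rewrite (_ : L * _ * _ = (3 + t%:R) / (16 * (2 + t%:R))); last first.
  rewrite -[t.+3%:R]natr1 -[t.+2%:R]natr1 -[t.+1%:R]natr1; field.
  by rewrite -(natrD _ 2) pnatr_eq0 /= gt_eqF.
have t0 : 0 <= t%:R :> R by [].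
have s2 : 0 < 16 * (2 + t%:R) :> R by lra.
by rewrite ler_pdivrMr ?s2//; lra.
Qed.

End StepSizeFacts.

Lemma potential_arith (R : realType)
    (As a b e1 e0 s1 s0 D D' dn sn dQ c L k : R) :
  (As + a) * e1 + b / 2 * s1 + 3 / 32 * D <=
    (As + a - a) * e0 + b / 2 * s0 - a * dn + k * sn + L * (As + a) * (dQ + c * D') ->
  L * (As + a) * c * D' <= 3 / 32 * D' ->
  (As + a) * e1 + b / 2 * s1 + 3 / 32 * D <=
    As * e0 + b / 2 * s0 + 3 / 32 * D' - a * dn + k * sn + L * (As + a) * dQ.
Proof. lra. Qed.

(** * The averaged iterates along one sample path *)

Section Path.
Context {R : realType} {d M B : nat} {Xi : Type}.
Variables (f : 'I_M -> 'cV[R]_d -> R) (L r sigma rho : R) (T : nat)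
  (x0 xstar : 'cV[R]_d) (P : 'M[R]_M) (lam : seq R)
  (G : 'I_M -> 'cV[R]_d -> Xi -> 'cV[R]_d) (smp : nat -> 'I_M -> 'I_B -> Xi).
Hypotheses (M_gt0 : (0 < M)%N) (L_gt0 : 0 < L) (r_gt0 : 0 < r) (sigma_ge0 : 0 <= sigma).
Hypotheses (f_convex : forall i, convex_function setT (f i))
  (f_diff : forall i x, differentiable (f i) x)
  (f_smooth : forall i, smooth L (f i)).
Hypothesis xstar_min : is_minimizer (average f) xstar.
Hypotheses (P_sym : P^T = P) (P_stoch : doubly_stochastic P)
  (P_spec : spectrum P lam) (gap : (1 < M)%N -> rho <= 1 - lam`_1)
  (hrho : 0 < rho <= 1).

Local Notation theta := (step_theta L T).
Local Notation m := (step_m T).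
Local Notation beta := (step_beta M B T L sigma r).
Local Notation eta := (step_eta M B T L sigma r).
Local Notation a := (step_a L).
Local Notation A := (step_A L).
Let S t := dda P (1 / 2) (gossip_momentum rho) theta m eta x0 G smp t.
Let Gr t := minibatch G (capQ (S t)) (smp t).
Let x t := colavg (capX (S t)).
Let z t := colavg (capZ (S t)).
Let q t (i : 'I_M) := col i (capQ (S t)).

Definition node_noise t i : 'cV[R]_d := col i (Gr t) - grad (f i) (q t i).
Definition mean_noise t : 'cV[R]_d := M%:R^-1 *: \sum_i node_noise t i.

Lemma step_beta_ge1 : 1 <= beta.
Proof.
by rewrite /step_beta lerDl mulr_ge0 ?sqrtr_ge0// divr_ge0// mulr_ge0 ?sqrtr_ge0// ltW.
Qed.

Lemma step_eta_le t : 0 <= eta t <= a t.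
Proof.
have b0 : 0 < beta := lt_le_trans ltr01 step_beta_ge1.
have a0 := step_a_gt0 L_gt0 t.
rewrite /step_eta; case: ifP => _; last by rewrite lexx ltW.
apply/andP; split; first exact: divr_ge0 (ltW a0) (ltW b0).
by rewrite ler_pdivrMr// ler_peMr ?step_beta_ge1// ltW.
Qed.

Lemma colavg_Gr t : colavg (Gr t) = mean_grad f (q t) + mean_noise t.
Proof.
rewrite /mean_grad /mean_noise -scalerDr -big_split; congr (_ *: _).
by apply: eq_bigr => i _ /=; rewrite addrCA subrr addr0.
Qed.

Lemma zS t : z t.+1 = z t - eta t *: colavg (Gr t).
Proof. by rewrite /z /= colavgB colavgZ. Qed.

Lemma xS t : x t.+1 = (1 - theta t) *: x t + theta t *: z t.+1.
Proof. by rewrite /x /= colavgD !colavgZ. Qed.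

Let xprev t := if t is s.+1 then x s else x0.

Lemma colavg_prevXt t : colavg (prevXt (S t)) = xprev t.
Proof. by case: t => [|t] /=; [exact: colavg_consensus|rewrite colavg_gossip]. Qed.

Lemma x0E : x 0 = x0. Proof. exact: colavg_consensus. Qed.
Lemma z0E : z 0 = x0. Proof. exact: colavg_consensus. Qed.

Lemma qbarS t : colavg (capQ (S t.+1)) =
  x t + (m t * (1 + m t.+1)) *: (x t - xprev t).
Proof.
rewrite [capQ _]/= colavgD colavgZ colavgB colavg_gossip//.
by rewrite colavg_prevXt.
Qed.

Lemma momentum t : (t < T)%N -> m t *: (x t - xprev t) = theta t *: (z t - x t).
Proof.
case: t => [|t] tT.
  by rewrite /xprev x0E z0E subrr !scaler0.
rewrite [xprev _]/= xS; have E := step_m_theta L_gt0 tT.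
have -> : (1 - theta t) *: x t + theta t *: z t.+1 - x t = theta t *: (z t.+1 - x t).
  by apply/colP => j; rewrite !mxE; ring.
have -> : z t.+1 - ((1 - theta t) *: x t + theta t *: z t.+1) =
    (1 - theta t) *: (z t.+1 - x t).
  by apply/colP => j; rewrite !mxE; ring.
by rewrite !scalerA E.
Qed.

(** The query is formed before [x_(t+1)] is known. Its average is
    [x_t + (1 + m_(t+1)) theta_t (z_t - x_t)], whereas the coupling point is the same expression
    with [z_(t+1)] in place of [z_t], so the error is a multiple of one mirror step. *)
Lemma query_delay t : (t.+1 < T)%N ->
  colavg (capQ (S t.+1)) - ((1 - theta t.+1) *: x t.+1 + theta t.+1 *: z t.+1) =
  - ((1 + m t.+1) * theta t) *: (z t.+1 - z t).
Proof.
move=> tT; have Mt := momentum (ltnW tT); have MtS := momentum tT.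
rewrite [xprev _]/= in MtS.
have -> : (1 - theta t.+1) *: x t.+1 + theta t.+1 *: z t.+1 =
    x t.+1 + m t.+1 *: (x t.+1 - x t).
  by rewrite MtS; apply/colP => j; rewrite !mxE; ring.
rewrite qbarS mulrC -scalerA Mt xS; apply/colP => j; rewrite !mxE; ring.
Qed.

(* The last term pays for the staleness of the query point, which extrapolates
   the gossip output of the previous round. *)
Definition potential t : R :=
  (if t is s.+1 then A s else 0) * excess f xstar (x t)
  + beta / 2 * sqn (z t - xstar)
  + 3 / 32 * (if t is s.+1 then sqn (z t - z s) else 0).

Lemma potential_step t : (t < T)%N ->
  potential t.+1 <= potential t - a t * dotv (mean_noise t) (z t - xstar)
    + a t ^+ 2 / beta * sqn (mean_noise t)
    + L * A t * (M%:R^-1 * dispersion (capQ (S t))).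
Proof.
move=> tT.
have thE : A t * theta t = a t.
  by rewrite /step_theta tT mulrC divfK// gt_eqF// step_A_gt0.
have LA : L * A t * theta t ^+ 2 <= 1 / 64.
  rewrite -mulrA expr2 (mulrA (A t)) thE step_thetaE// /step_a.
  rewrite (_ : L * _ = t.+1%:R / t.+2%:R / 64); last first.
    by field; rewrite -(natrD _ 2) pnatr_eq0 /= gt_eqF.
  by rewrite ler_pM2r ?invr_gt0// ler_pdivrMr// mul1r ler_nat.
have := @one_step _ _ _ f L xstar M_gt0 L_gt0 f_convex f_diff f_smooth (q t)
  ((1 - theta t) *: x t + theta t *: z t) (x t) (z t) (mean_noise t)
  (a t) (A t) beta (theta t) erefl (step_A_gt0 L_gt0 t)
  thE step_beta_ge1 (step_theta01 T L_gt0 t) LA.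
rewrite -colavg_Gr (_ : a t / beta = eta t); last by rewrite /step_eta tT.
(* The query error splits into the dispersion of the queries and the distance of their average from
   the coupling point. *)
rewrite -zS -xS sum_sqn_col//.
have M0 : M%:R != 0 :> R by rewrite pnatr_eq0 -lt0n.
rewrite [M%:R^-1 * (_ + _)]mulrDr mulKf//.
rewrite {1}/potential => one.
(* In round 0 the average query is exactly the coupling point and [A 0 = a 0], so neither staleness
   nor a previous excess appears. *)
case: t tT thE LA one => [|s] tT thE LA one.
  have Q0 : colavg (capQ (S 0)) - ((1 - theta 0) *: x 0 + theta 0 *: z 0) = 0.
    rewrite z0E x0E [capQ _]/= colavg_consensus//.
    by rewrite -scalerDl subrK scale1r subrr.
  have A0 : A 0 = a 0 by rewrite /step_A big_nat1.
  move: one; rewrite Q0 sqn0 A0 /potential.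
  move: (excess _ _ (x 1)) (excess _ _ (x 0)) (sqn (z 1 - xstar))
    (sqn (z 0 - xstar)) (sqn (z 1 - z 0)) (dotv _ _) (sqn (mean_noise 0))
    (dispersion _) => e1 e0 s1 s0 D dn sn dQ.
  lra.
rewrite query_delay// (sqnZ (- _)) sqrrN in one.
have D0 := sqn_ge0 (z s.+1 - z s).
have AS : A s.+1 = A s + a s.+1 by rewrite /step_A big_nat_recr.
have := ler_wpM2r D0 (delay_coeff L_gt0 (ltnW tT)).
move: one; rewrite AS /potential.
exact: potential_arith.
Qed.

Local Notation delta2 := (gossip_rate rho B ^+ 2).

Lemma excess_position_le t :
  sqn (x t.+1 - xstar) <= (1 - theta t) * sqn (x t - xstar) + theta t * sqn (z t.+1 - xstar).
Proof.
have -> : x t.+1 - xstar = (1 - theta t) *: (x t - xstar) + theta t *: (z t.+1 - xstar).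
  rewrite xS; apply/colP => j; rewrite !mxE; ring.
by apply: sqn_conv; exact: step_theta01.
Qed.

Lemma extrapolation_coeff t : 0 <= (m t * (1 + m t.+1) : R) <= 2.
Proof.
have /andP[m0 m1] := @step_m01 R T t; have /andP[n0 n1] := @step_m01 R T t.+1.
have h : 0 <= 1 + m t.+1 :> R by exact: addr_ge0.
apply/andP; split; first exact: mulr_ge0.
have : m t * (1 + m t.+1) <= 1 * (1 + m t.+1) :> R by exact: ler_wpM2r.
by move/le_trans; apply; rewrite mul1r [leRHS](_ : _ = 1 + 1)// lerD2l.
Qed.

(** At [t = 0] the predecessor [t.-1] is again [0], in agreement with the convention
    [X_(-1) = X_0]. *)
Lemma query_average_le t : sqn (colavg (capQ (S t.+1)) - xstar) <=
  15 * sqn (x t - xstar) + 10 * sqn (x t.-1 - xstar).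
Proof.
have xpE : xprev t = x t.-1 by case: t => [|t] //=; rewrite x0E.
rewrite qbarS xpE.
have -> : x t + (m t * (1 + m t.+1)) *: (x t - x t.-1) - xstar =
    (x t - xstar) + (m t * (1 + m t.+1)) *: ((x t - xstar) - (x t.-1 - xstar)).
  by apply/colP => j; rewrite !mxE; ring.
exact: sqn_extrapolate (extrapolation_coeff t).
Qed.

Lemma dispersion_X_le t : dispersion (capX (S t.+1)) <=
  (1 - theta t) * dispersion (capX (S t)) + theta t * dispersion (capZ (S t.+1)).
Proof. by apply: dispersion_conv; exact: step_theta01. Qed.

Lemma capZ_sum t : capZ (S t) = consensus x0 - \sum_(s < t) eta s *: Gr s.
Proof.
elim: t => [|t IH]; first by rewrite big_ord0 subr0.
by rewrite big_ord_recr opprD addrA -IH.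
Qed.

Lemma dispersion_Z_le t : dispersion (capZ (S t)) <=
  t%:R * \sum_(s < t) eta s ^+ 2 * dispersion (Gr s).
Proof. by rewrite capZ_sum; exact: dispersion_sum_le. Qed.

(** Measured from the gradient of [average f] at [xstar], each column is noise plus heterogeneity at
    the optimum plus a drift bounded by [L |q_i - xstar|]. The 3 is Cauchy-Schwarz on these three
    terms. *)
Lemma dispersion_Gr_le zeta t :
  M%:R^-1 * \sum_(i < M)
      enorm (grad (f i) xstar - grad (average f) xstar) ^+ 2 <= zeta ^+ 2 ->
  dispersion (Gr t) <= 3 * (\sum_i sqn (node_noise t i)
    + M%:R * zeta ^+ 2
    + L ^+ 2 * (dispersion (capQ (S t)) + M%:R * sqn (colavg (capQ (S t)) - xstar))).
Proof.
move=> het; set v := grad (average f) xstar in het *.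
apply: le_trans (dispersion_le M_gt0 _ v) _.
have het' : \sum_i sqn (grad (f i) xstar - v) <= M%:R * zeta ^+ 2.
  rewrite -ler_pdivrMl ?ltr0n//; move: het.
  by under eq_bigr do rewrite sqr_enorm.
rewrite -(sum_sqn_col M_gt0) mulr_sumr.
apply: (@le_trans _ _ (3 * (\sum_i sqn (node_noise t i)
  + \sum_i sqn (grad (f i) xstar - v) + \sum_i L ^+ 2 * sqn (q t i - xstar)))); last first.
  by rewrite ler_pM2l ?ltr0n// lerD2r lerD2l.
rewrite -!big_split mulr_sumr; apply: ler_sum => i _ /=.
set n := node_noise t i.
have -> : col i (Gr t) - v = n + (grad (f i) xstar - v) + (grad (f i) (q t i) - grad (f i) xstar).
  by rewrite /n /node_noise; apply/colP => j; rewrite !mxE; ring.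
have := @sqn_sum_le R d 3 (fun k => if k == 0%N :> nat then n else
  if k == 1%N :> nat then grad (f i) xstar - v else grad (f i) (q t i) - grad (f i) xstar).
rewrite !big_ord_recl !big_ord0 /= !addr0 !addrA => /le_trans; apply.
rewrite ler_pM2l ?ltr0n// lerD2l; exact: smooth_sqn (ltW L_gt0) (f_smooth i) _ _.
Qed.

Lemma dispersion_prevXt_le t :
  dispersion (prevXt (S t)) <= delta2 * dispersion (capX (S t.-1)).
Proof.
case: t => [|t]; last exact: dispersion_gossip P_spec gap hrho _ _.
by rewrite [prevXt _]/= [capX _]/= dispersion_consensus// mulr0.
Qed.

Lemma dispersion_Q_le t : dispersion (capQ (S t.+1)) <=
  delta2 * (15 * dispersion (capX (S t)) + 10 * dispersion (capX (S t.-1))).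
Proof.
have := dispersion_extrapolate (gossip (1 / 2) (gossip_momentum rho) P (capX (S t)) B)
  (prevXt (S t)) (extrapolation_coeff t).
move=> /le_trans; apply; rewrite mulrDr !(mulrCA delta2).
apply: lerD; rewrite ler_pM2l ?ltr0n//.
  exact: dispersion_gossip P_spec gap hrho _ _.
exact: dispersion_prevXt_le.
Qed.

Lemma dispersion_Q0 : dispersion (capQ (S 0)) = 0.
Proof. exact: dispersion_consensus. Qed.

Lemma dispersion_X0 : dispersion (capX (S 0)) = 0.
Proof. exact: dispersion_consensus. Qed.

Lemma output_excess_le i :
  excess f xstar (dda_output P (1 / 2) (gossip_momentum rho) theta m eta x0 G smp T i)
  <= 2 * excess f xstar (x T) + L * (delta2 * dispersion (capX (S T))).
Proof.
apply: le_trans (excess_perturb M_gt0 L_gt0 f_diff f_smooth xstar_min (x T) _) _.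
rewrite lerD2l ler_pM2l//.
apply: le_trans (dispersion_gossip M_gt0 P_sym P_stoch P_spec gap hrho _ _).
rewrite /dispersion (bigD1 i)//= colavg_gossip// lerDl.
by apply: sumr_ge0 => j _; exact: sqn_ge0.
Qed.

End Path.

(** * Second moments and oracle noise *)

Section SecondMoments.
Context {R : realType} {dO : measure_display} {Omega : measurableType dO}.
Variable Pr : probability Omega R.
Implicit Types (X Y : Omega -> R) (c : R).

Definition L1 X : Prop := Pr.-integrable setT (EFin \o X).
(** Measurability of [X] is asked separately, since integrability gives it only for the square. *)
Definition L2 X : Prop := measurable_fun setT X /\ L1 (fun w => X w ^+ 2).
Definition mean X : R := \int[Pr]_w X w.

Lemma mean_integral X : L1 X -> (\int[Pr]_w (X w)%:E = (mean X)%:E)%E.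
Proof. by move=> iX; rewrite /mean /Rintegral fineK//; exact: integrable_fin_num. Qed.

Lemma L1_cst c : L1 (fun=> c).
Proof. exact: (finite_measure_integrable_cst Pr c). Qed.

Lemma L1D X Y : L1 X -> L1 Y -> L1 (fun w => X w + Y w).
Proof. by move=> iX iY; exact: (integrableD measurableT iX iY). Qed.

Lemma L1Z c X : L1 X -> L1 (fun w => c * X w).
Proof. by move=> iX; exact: (integrableZl measurableT c iX). Qed.

Lemma L1N X : L1 X -> L1 (fun w => - X w).
Proof. by move=> /(L1Z (-1)); rewrite /L1; under eq_fun do rewrite /= mulN1r. Qed.

Lemma L1B X Y : L1 X -> L1 Y -> L1 (fun w => X w - Y w).
Proof. by move=> iX iY; apply: L1D => //; exact: L1N. Qed.

Lemma L1_sum I (s : seq I) (F : I -> Omega -> R) :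
  (forall i, L1 (F i)) -> L1 (fun w => \sum_(i <- s) F i w).
Proof.
move=> iF; elim: s => [|i s IH].
  by under eq_fun do rewrite big_nil; exact: L1_cst.
by under eq_fun do rewrite big_cons; exact: L1D.
Qed.

Lemma L1_dominated X Y : measurable_fun setT X -> L1 Y ->
  (forall w, `|X w| <= Y w) -> L1 X.
Proof.
move=> mX iY XY; apply: le_integrable iY => //; first exact/measurable_EFinP.
by move=> w _; rewrite /= lee_fin (le_trans (XY w))// ler_norm.
Qed.

Lemma meanD X Y : L1 X -> L1 Y -> mean (fun w => X w + Y w) = mean X + mean Y.
Proof. by move=> iX iY; exact: RintegralD. Qed.

Lemma meanZ c X : L1 X -> mean (fun w => c * X w) = c * mean X.
Proof. by move=> iX; exact: RintegralZl. Qed.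

Lemma meanB X Y : L1 X -> L1 Y -> mean (fun w => X w - Y w) = mean X - mean Y.
Proof. by move=> iX iY; exact: RintegralB. Qed.

Lemma mean_cst c : mean (fun=> c) = c.
Proof.
rewrite /mean Rintegral_cst//; have -> : fine (Pr setT) = 1 by rewrite probability_setT.
by rewrite mulr1.
Qed.

Lemma mean_sum I (s : seq I) (F : I -> Omega -> R) : (forall i, L1 (F i)) ->
  mean (fun w => \sum_(i <- s) F i w) = \sum_(i <- s) mean (F i).
Proof.
move=> iF; elim: s => [|i s IH].
  by under eq_fun do rewrite big_nil; rewrite big_nil mean_cst.
under eq_fun do rewrite big_cons.
by rewrite big_cons meanD// ?IH//; exact: L1_sum.
Qed.

Lemma le_mean X Y : L1 X -> L1 Y -> (forall w, X w <= Y w) -> mean X <= mean Y.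
Proof. by move=> iX iY XY; exact: le_Rintegral. Qed.

Lemma mean_ge0 X : (forall w, 0 <= X w) -> 0 <= mean X.
Proof. by move=> X0; exact: Rintegral_ge0. Qed.

Lemma L2M X Y : L2 X -> L2 Y -> L1 (fun w => X w * Y w).
Proof.
move=> [mX iX] [mY iY]; apply: L1_dominated (L1D iX iY) _ => [|w].
  exact: measurable_funM.
have := sqr_ge0 (`|X w| - `|Y w|); have := sqr_ge0 (`|X w| + `|Y w|).
by rewrite normrM -(real_normK (num_real (X w))) -(real_normK (num_real (Y w))); lra.
Qed.

Lemma L2D X Y : L2 X -> L2 Y -> L2 (fun w => X w + Y w).
Proof.
move=> hX hY; have iXY := L2M hX hY; have [[mX iX] [mY iY]] := (hX, hY).
split; first exact: measurable_funD.
rewrite (_ : (fun _ => _) = fun w => X w ^+ 2 + 2 * (X w * Y w) + Y w ^+ 2).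
  by apply: L1D => //; apply: L1D => //; exact: L1Z.
by apply/funext => w; ring.
Qed.

Lemma L2Z c X : L2 X -> L2 (fun w => c * X w).
Proof.
move=> [mX iX]; split; first exact: measurable_funM.
by under eq_fun do rewrite exprMn; exact: L1Z.
Qed.

Lemma L2_cst c : L2 (fun=> c).
Proof. by split; [exact: measurable_cst|exact: L1_cst]. Qed.

Lemma L2N X : L2 X -> L2 (fun w => - X w).
Proof. by move=> /(L2Z (-1)); under eq_fun do rewrite mulN1r. Qed.

Definition L2mx d M (X : Omega -> 'M[R]_(d, M)) : Prop :=
  forall j i, L2 (fun w => X w j i).

Lemma L2mxD d M (X Y : Omega -> 'M[R]_(d, M)) :
  L2mx X -> L2mx Y -> L2mx (fun w => X w + Y w).
Proof.
by move=> hX hY j i; under eq_fun do rewrite mxE; exact: L2D.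
Qed.

Lemma L2mxZ d M c (X : Omega -> 'M[R]_(d, M)) :
  L2mx X -> L2mx (fun w => c *: X w).
Proof. by move=> hX j i; under eq_fun do rewrite mxE; exact: L2Z. Qed.

Lemma L2mxB d M (X Y : Omega -> 'M[R]_(d, M)) :
  L2mx X -> L2mx Y -> L2mx (fun w => X w - Y w).
Proof.
move=> hX hY; apply: L2mxD => // j i; under eq_fun do rewrite mxE.
exact: L2N.
Qed.

Lemma L2mx_cst d M (X : 'M[R]_(d, M)) : L2mx (fun=> X).
Proof. by move=> j i; exact: L2_cst. Qed.

Lemma L2mx_sum d M I (s : seq I) (F : I -> Omega -> 'M[R]_(d, M)) :
  (forall i, L2mx (F i)) -> L2mx (fun w => \sum_(i <- s) F i w).
Proof.
move=> iF; elim: s => [|i s IH].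
  by under eq_fun do rewrite big_nil; exact: L2mx_cst.
by under eq_fun do rewrite big_cons; exact: L2mxD.
Qed.

Lemma L2mx_col d M (X : Omega -> 'M[R]_(d, M)) i :
  L2mx X -> L2mx (fun w => col i (X w)).
Proof. by move=> hX j k; under eq_fun do rewrite mxE; exact: hX. Qed.

Lemma L1_dotv d (U V : Omega -> 'cV[R]_d) : L2mx U -> L2mx V ->
  L1 (fun w => dotv (U w) (V w)).
Proof. by move=> hU hV; apply: L1_sum => j; exact: L2M. Qed.

Lemma L1_sqn d (U : Omega -> 'cV[R]_d) : L2mx U -> L1 (fun w => sqn (U w)).
Proof. by move=> hU; exact: L1_dotv. Qed.

Lemma L2mx_sqn d (U : Omega -> 'cV[R]_d) :
  (forall j, measurable_fun setT (fun w => U w j 0)) ->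
  L1 (fun w => sqn (U w)) -> L2mx U.
Proof.
move=> mU iU j i; rewrite (ord1 i); split => //.
apply: L1_dominated iU _ => [|w]; first exact: measurable_funX.
by rewrite ger0_norm ?sqr_ge0//; exact: coord_sqr_le.
Qed.

End SecondMoments.

Section SubSigmaAlgebra.
Context {dO : measure_display} {Omega : measurableType dO}.
Variable F : set (set Omega).
Hypothesis F_sub : F `<=` @measurable _ Omega.

Lemma sub_salgebra_measurable (H : set Omega) : <<s F >> H -> measurable H.
Proof.
move: H; apply: smallest_sub => //; exact: sigma_algebra_measurable.
Qed.

Lemma measurable_fun_sub_salgebra d (T : measurableType d) (g : Omega -> T) :
  measurable_fun setT (g : g_sigma_algebraType F -> T) -> measurable_fun setT g.
Proof.
move=> mg _ A mA; have := mg measurableT A mA.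
exact: sub_salgebra_measurable.
Qed.

(** The past enters the disintegration as a random variable, namely the identity read into the
    coarser space. *)
Lemma measurable_id_sub_salgebra :
  measurable_fun setT (id : Omega -> g_sigma_algebraType F).
Proof. by move=> _ A mA; rewrite setTI; exact: sub_salgebra_measurable. Qed.

End SubSigmaAlgebra.

(** * Bias, variance and correlation of the oracle errors *)

Section OracleNoise.
Context {R : realType} {d : nat} {dX : measure_display} {Xi : measurableType dX}.
Variables (f : 'cV[R]_d -> R) (L sigma : R) (D : R.-pker (borel_cV R d) ~> Xi)
  (G : 'cV[R]_d -> Xi -> 'cV[R]_d).
Hypotheses (L_ge0 : 0 <= L) (f_smooth : smooth L f)
  (oracle : stochastic_gradient_oracle f sigma D G).

Lemma continuous_grad_coord j : continuous (fun x => grad f x j 0).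
Proof.
move=> /= x s /= /(nbhs_ballP (grad f x j 0))[e /= e0 es]; apply/nbhs_ballP.
have c0 : 0 < L * d.+1%:R + 1 by rewrite ltr_wpDl ?mulr_ge0.
(* Balls are those of the max norm, and [d + 1] is a crude comparison factor with the Euclidean
   norm. The [+ 1] in the denominator makes the final inequality strict and covers [L = 0]. *)
pose del := e / (L * d.+1%:R + 1).
have del0 : 0 < del by rewrite divr_gt0.
exists del => //= y [_ xy]; apply: es; rewrite /ball /=.
have S : sqn (x - y) <= (d.+1%:R * del) ^+ 2.
  rewrite sqnE; apply: (@le_trans _ _ (\sum_(i < d) del ^+ 2)).
    apply: ler_sum => i _; rewrite cVB_coord.
    rewrite -(real_normK (num_real _)) ler_sqr ?nnegrE ?(ltW del0)//.
    exact: ltW (xy i 0).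
  rewrite sumr_const card_ord [leRHS]exprMn -[leLHS]mulr_natl.
  apply: ler_wpM2r; first exact: sqr_ge0.
  by rewrite -natrX ler_nat (leq_trans (leqnSn d))// expnS expn1 leq_pmulr.
rewrite -ltr_sqr ?nnegrE ?(ltW e0)// real_normK ?num_real//.
apply: (@le_lt_trans _ _ (L ^+ 2 * (d.+1%:R * del) ^+ 2)).
  apply: le_trans (ler_wpM2l (sqr_ge0 L) S).
  apply: le_trans (smooth_sqn L_ge0 f_smooth x y).
  by have := coord_sqr_le (grad f x - grad f y) j; rewrite cVB_coord.
have Ld0 : 0 <= L * (d.+1%:R * del).
  by apply: mulr_ge0 => //; apply: mulr_ge0; [exact: ler0n|exact: ltW].
rewrite -exprMn ltr_sqr ?nnegrE ?(ltW e0)//.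
have -> : L * (d.+1%:R * del) = e * (L * d.+1%:R / (L * d.+1%:R + 1)).
  by rewrite /del; ring.
by rewrite gtr_pMr// ltr_pdivrMr// mul1r ltrDl.
Qed.

Definition oracle_error (x : 'cV[R]_d) (u : Xi) : 'cV[R]_d := G x u - grad f x.

Lemma measurable_grad_coord j :
  measurable_fun setT (fun x : borel_cV R d => grad f x j 0).
Proof. apply: (measurable_continuous_cV (h := fun x => grad f x j 0)); exact: continuous_grad_coord. Qed.

Lemma measurable_oracle_error dS (S : measurableType dS)
    (q : S -> 'cV[R]_d) (u : S -> Xi) j :
  (forall j, measurable_fun setT (fun s => q s j 0)) -> measurable_fun setT u ->
  measurable_fun setT (fun s => oracle_error (q s) (u s) j 0).
Proof.
move=> mq mu; have [mG _ _ _] := oracle.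
have mq' := measurable_fun_borel_cV mq.
under eq_fun do rewrite cVB_coord; apply: measurable_funB.
  have := measurableT_comp (@measurable_coord_cV R d j) (measurableT_comp mG (measurable_fun_pair mq' mu)).
  exact.
exact: (measurableT_comp (measurable_grad_coord j) mq').
Qed.

Lemma oracle_error_centered x j :
  (D x).-integrable setT (fun u => (oracle_error x u j 0)%:E) /\
  (\int[D x]_u (oracle_error x u j 0)%:E = 0)%E.
Proof.
have [_ iG EG _] := oracle.
have ic : (D x).-integrable setT (EFin \o cst (grad f x j 0)).
  apply/integrableP; split; first exact/measurable_EFinP/measurable_cst.
  by rewrite /= integral_cst// prob_kernel mule1 ltry.
have E : (fun u => (oracle_error x u j 0)%:E) =
    ((fun u => (G x u j 0%R)%:E) \- (EFin \o cst (grad f x j 0%R)))%E.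
  by apply/funext => u; rewrite cVB_coord EFinB.
rewrite E; split; first exact: integrableB.
rewrite integralB//= EG integral_cst// prob_kernel mule1 subee//.
Qed.

Lemma oracle_error_variance x :
  (\int[D x]_u (sqn (oracle_error x u))%:E <= (sigma ^+ 2)%:E)%E.
Proof.
have [_ _ _ V] := oracle; apply: le_trans (V x).
by under eq_integral do rewrite -sqr_enorm.
Qed.

Context {dO : measure_display} {Omega : measurableType dO}.
Variables (Pr : probability Omega R).

Section OneSample.
Variables (F : set (set Omega)) (q : Omega -> 'cV[R]_d) (xi : Omega -> Xi).
Hypotheses (F_sub : F `<=` @measurable _ Omega)
  (mq : forall j, measurable_fun setT
    ((fun w => q w j 0) : g_sigma_algebraType F -> R))
  (mxi : measurable_fun setT xi).
Hypothesis law : forall H A, <<s F >> H -> measurable A ->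
  Pr (xi @^-1` A `&` H) = (\int[Pr]_(w in H) D (q w) A)%E.

Let FT := g_sigma_algebraType F.
Let idF : {mfun Omega >-> FT} := HB.pack (id : Omega -> FT)
  (isMeasurableFun.Build _ _ _ _ (id : Omega -> FT) (measurable_id_sub_salgebra F_sub)).
Let qF : {mfun FT >-> borel_cV R d} := HB.pack (q : FT -> borel_cV R d)
  (isMeasurableFun.Build _ _ _ _ (q : FT -> borel_cV R d) (measurable_fun_borel_cV mq)).
Let xiF : {mfun Omega >-> Xi} := HB.pack xi (isMeasurableFun.Build _ _ _ _ xi mxi).
Let K : R.-pker FT ~> Xi := kpullback D qF.

Let lawF H A : @measurable _ FT H -> measurable A ->
  Pr (idF @^-1` H `&` xiF @^-1` A) = (\int[Pr]_(w in idF @^-1` H) K (idF w) A)%E.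
Proof. by move=> mH mA; rewrite setIC; exact: law. Qed.

Let mqO j : measurable_fun setT (fun w => q w j 0).
Proof. exact: measurable_fun_sub_salgebra F_sub _ _ _ (mq j). Qed.

(** The squared error is nonnegative, so it can be disintegrated before integrability is known; the
    conditional bound [sigma^2] then gives integrability and the moment at once. *)
Lemma L1_oracle_error : L1 Pr (fun w => sqn (oracle_error (q w) (xi w))) /\
  mean Pr (fun w => sqn (oracle_error (q w) (xi w))) <= sigma ^+ 2.
Proof.
pose phi (p : FT * Xi) : \bar R := (sqn (oracle_error (q p.1) p.2))%:E.
have msq dS (S : measurableType dS) (g : S -> 'cV[R]_d) :
    (forall j, measurable_fun setT (fun s => g s j 0)) ->
    measurable_fun setT (fun s => sqn (g s)).
  by move=> mg; apply: measurable_sum => j; exact: measurable_funM.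
have mphi : measurable_fun setT phi.
  apply/measurable_EFinP; apply: msq => j; apply: measurable_oracle_error.
    by move=> k; exact: (measurableT_comp (mq k) measurable_fst).
  exact: measurable_snd.
have phi0 p : (0 <= phi p)%E by rewrite lee_fin sqn_ge0.
have E := ge0_integral_disintegration (measurable_generates FT) (@measurableI _ FT)
  measurableT lawF phi0 mphi.
have le : (\int[Pr]_w (sqn (oracle_error (q w) (xi w)))%:E <= (sigma ^+ 2)%:E)%E.
  rewrite [leLHS]E.
  apply: (@le_trans _ _ (\int[Pr]_w (sigma ^+ 2)%:E)%E); last first.
    rewrite integral_cst// [X in (_ * X)%E](_ : _ = 1%E) ?mule1//.
    exact: probability_setT.
  apply: ge0_le_integral => //.
  - by move=> w _; apply: integral_ge0.
  - apply: (measurable_fun_sub_salgebra F_sub).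
    exact: (measurable_fun_integral_finite_kernel phi K).
  - by move=> w _; exact: oracle_error_variance.
have int : L1 Pr (fun w => sqn (oracle_error (q w) (xi w))).
  apply/integrableP; split.
    by apply/measurable_EFinP; apply: msq => j; exact: measurable_oracle_error.
  under eq_integral do rewrite /= ger0_norm ?sqn_ge0//.
  exact: le_lt_trans le (ltry _).
by split => //; rewrite -lee_fin -mean_integral.
Qed.

Lemma mean_oracle_error (h : Omega -> R) j :
  measurable_fun setT (h : FT -> R) ->
  L1 Pr (fun w => h w * oracle_error (q w) (xi w) j 0) ->
  mean Pr (fun w => h w * oracle_error (q w) (xi w) j 0) = 0.
Proof.
move=> mh ih.
have me : measurable_fun setT (fun p : FT * Xi => oracle_error (q p.1) p.2 j 0).
  apply: measurable_oracle_error; last exact: measurable_snd.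
  by move=> k; exact: (measurableT_comp (mq k) measurable_fst).
have := integral_centered (measurable_generates FT) (@measurableI _ FT)
  measurableT lawF mh me (fun y => (oracle_error_centered (q y) j).1)
  (fun y => (oracle_error_centered (q y) j).2) ih.
by rewrite /mean /Rintegral => ->.
Qed.

End OneSample.
End OracleNoise.

Section TwoSamples.
Context {R : realType} {d : nat} {dX dO : measure_display} {Xi : measurableType dX}
  {Omega : measurableType dO}.
Variables (f1 f2 : 'cV[R]_d -> R) (L sigma : R) (D1 D2 : R.-pker (borel_cV R d) ~> Xi)
  (G1 G2 : 'cV[R]_d -> Xi -> 'cV[R]_d).
Hypotheses (L_ge0 : 0 <= L) (f1_smooth : smooth L f1) (f2_smooth : smooth L f2)
  (oracle1 : stochastic_gradient_oracle f1 sigma D1 G1)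
  (oracle2 : stochastic_gradient_oracle f2 sigma D2 G2).
Variables (Pr : probability Omega R) (F : set (set Omega))
  (q1 q2 : Omega -> 'cV[R]_d) (xi1 xi2 : Omega -> Xi).
Hypotheses (F_sub : F `<=` @measurable _ Omega)
  (mq1 : forall j, measurable_fun setT
    ((fun w => q1 w j 0) : g_sigma_algebraType F -> R))
  (mq2 : forall j, measurable_fun setT
    ((fun w => q2 w j 0) : g_sigma_algebraType F -> R))
  (mxi1 : measurable_fun setT xi1) (mxi2 : measurable_fun setT xi2).
Hypothesis law : forall H A1 A2, <<s F >> H -> measurable A1 -> measurable A2 ->
  Pr ((xi1 @^-1` A1 `&` xi2 @^-1` A2) `&` H) =
  (\int[Pr]_(w in H) (D1 (q1 w) A1 * D2 (q2 w) A2))%E.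

Let FT := g_sigma_algebraType F.
Let idF : {mfun Omega >-> FT} := HB.pack (id : Omega -> FT)
  (isMeasurableFun.Build _ _ _ _ (id : Omega -> FT) (measurable_id_sub_salgebra F_sub)).
Let q1F : {mfun FT >-> borel_cV R d} := HB.pack (q1 : FT -> borel_cV R d)
  (isMeasurableFun.Build _ _ _ _ (q1 : FT -> borel_cV R d) (measurable_fun_borel_cV mq1)).
Let q2F : {mfun FT >-> borel_cV R d} := HB.pack (q2 : FT -> borel_cV R d)
  (isMeasurableFun.Build _ _ _ _ (q2 : FT -> borel_cV R d) (measurable_fun_borel_cV mq2)).
Let xi1F : {mfun Omega >-> Xi} := HB.pack xi1 (isMeasurableFun.Build _ _ _ _ xi1 mxi1).
Let xi2F : {mfun Omega >-> Xi} := HB.pack xi2 (isMeasurableFun.Build _ _ _ _ xi2 mxi2).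
Let K1 : R.-pker FT ~> Xi := kpullback D1 q1F.
Let K2 : R.-pker FT ~> Xi := kpullback D2 q2F.
Let past_fst : {mfun (FT * Xi)%type >-> FT} := HB.pack (@fst FT Xi)
  (isMeasurableFun.Build _ _ _ _ (@fst FT Xi) measurable_fst).
Let K2' : R.-pker (FT * Xi)%type ~> Xi := kpullback K2 past_fst.
Let past : {mfun Omega >-> (FT * Xi)%type} := HB.pack (fun w => (idF w, xi1F w))
  (isMeasurableFun.Build _ _ _ _ (fun w => (idF w, xi1F w))
    (measurable_fun_pair (measurable_funPT idF) (measurable_funPT xi1F))).

Let lawF H A1 A2 : @measurable _ FT H -> measurable A1 -> measurable A2 ->
  Pr (idF @^-1` H `&` (xi1F @^-1` A1 `&` xi2F @^-1` A2)) =
  (\int[Pr]_(w in idF @^-1` H) (K1 (idF w) A1 * K2 (idF w) A2))%E.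
Proof. by move=> mH mA1 mA2; rewrite setIC; exact: law. Qed.

(** The first sample is counted as part of the past. By [pair_law] the second keeps its law, so its
    error is centered and the first error is merely a past-measurable weight. *)
Lemma mean_oracle_error_pair j :
  L1 Pr (fun w => oracle_error f1 G1 (q1 w) (xi1 w) j 0 * oracle_error f2 G2 (q2 w) (xi2 w) j 0) ->
  mean Pr (fun w => oracle_error f1 G1 (q1 w) (xi1 w) j 0 * oracle_error f2 G2 (q2 w) (xi2 w) j 0) = 0.
Proof.
move=> ih.
pose h (p : FT * Xi) := oracle_error f1 G1 (q1 p.1) p.2 j 0.
pose e (p : (FT * Xi) * Xi) := oracle_error f2 G2 (q2 p.1.1) p.2 j 0.
have mh : measurable_fun setT h.
  apply: (measurable_oracle_error L_ge0 f1_smooth oracle1); last exact: measurable_snd.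
  by move=> k; exact: (measurableT_comp (mq1 k) measurable_fst).
have me : measurable_fun setT e.
  apply: (measurable_oracle_error L_ge0 f2_smooth oracle2); last exact: measurable_snd.
  move=> k; exact: (measurableT_comp (measurableT_comp (mq2 k) measurable_fst) measurable_fst).
have gen := @prod_generator _ _ FT Xi _ (measurable_generates FT) measurableT.
have CI : setI_closed [set A `*` B | A in @measurable _ FT & B in @measurable _ Xi].
  move=> _ _ [A mA [B mB <-]] [A' mA' [B' mB' <-]].
  exists (A `&` A'); first exact: measurableI.
  by exists (B `&` B'); [exact: measurableI|rewrite setXI].
have CT : [set A `*` B | A in @measurable _ FT & B in @measurable _ Xi] setT.
  by exists setT => //; exists setT => //; rewrite setXTT.
have lawP := pair_law lawF.
have := @integral_centered _ _ _ _ _ _ _ Pr K2' past xi2F _ gen CI CT lawP h e mh me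
  (fun y => (oracle_error_centered oracle2 (q2 y.1) j).1)
  (fun y => (oracle_error_centered oracle2 (q2 y.1) j).2) ih.
by rewrite /mean /Rintegral => ->.
Qed.

End TwoSamples.

Section LinearlyClosed.
Context {R : realType} {Omega : Type}.
Implicit Types (Q : (Omega -> R) -> Prop).

(** Apart from the minibatch, a round is linear in the state. One induction on this abstract
    property thus serves both uses: measurability with respect to the history, and square
    integrability. *)
Definition linearly_closed Q : Prop :=
  [/\ forall c, Q (fun=> c),
      forall X Y, Q X -> Q Y -> Q (fun w => X w + Y w)
    & forall c X, Q X -> Q (fun w => c * X w)].

Definition entries Q d M (X : Omega -> 'M[R]_(d, M)) : Prop :=
  forall j i, Q (fun w => X w j i).

Variable Q : (Omega -> R) -> Prop.
Hypothesis Qlin : linearly_closed Q.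

Let Qc c : Q (fun=> c). Proof. by case: Qlin. Qed.
Let QD X Y : Q X -> Q Y -> Q (fun w => X w + Y w). Proof. by case: Qlin => _ H _; exact: H. Qed.
Let QZ c X : Q X -> Q (fun w => c * X w). Proof. by case: Qlin => _ _ H; exact: H. Qed.

Lemma closed_sum I (s : seq I) (F : I -> Omega -> R) :
  (forall i, Q (F i)) -> Q (fun w => \sum_(i <- s) F i w).
Proof.
move=> iF; elim: s => [|i s IH].
  by under eq_fun do rewrite big_nil; exact: Qc.
by under eq_fun do rewrite big_cons; exact: QD.
Qed.

Lemma entriesD d M (X Y : Omega -> 'M[R]_(d, M)) :
  entries Q X -> entries Q Y -> entries Q (fun w => X w + Y w).
Proof. by move=> hX hY j i; under eq_fun do rewrite mxE; exact: QD. Qed.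

Lemma entriesZ d M c (X : Omega -> 'M[R]_(d, M)) :
  entries Q X -> entries Q (fun w => c *: X w).
Proof. by move=> hX j i; under eq_fun do rewrite mxE; exact: QZ. Qed.

Lemma entriesB d M (X Y : Omega -> 'M[R]_(d, M)) :
  entries Q X -> entries Q Y -> entries Q (fun w => X w - Y w).
Proof.
move=> hX hY; apply: entriesD => // j i; under eq_fun do rewrite mxE -mulN1r.
exact: QZ.
Qed.

Lemma entries_mulmx d M N (X : Omega -> 'M[R]_(d, M)) (P : 'M[R]_(M, N)) :
  entries Q X -> entries Q (fun w => X w *m P).
Proof.
move=> hX j i; under eq_fun do rewrite mxE; apply: closed_sum => k.
by under eq_fun do rewrite mulrC; exact: QZ.
Qed.

Lemma entries_gossip_pair d M a b (P : 'M[R]_M) (X : Omega -> 'M[R]_(d, M)) s :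
  entries Q X ->
  entries Q (fun w => (gossip_pair a b P (X w) s).1) /\
  entries Q (fun w => (gossip_pair a b P (X w) s).2).
Proof.
move=> hX; elim: s => [//|s [IH1 IH2]].
pose Y w := (gossip_pair a b P (X w) s).1; pose Y' w := (gossip_pair a b P (X w) s).2.
have E w : gossip_pair a b P (X w) s.+1 =
  ((1 - a) *: (Y w + b *: (Y w - Y' w)) + a *: ((Y w + b *: (Y w - Y' w)) *m P), Y w).
  by rewrite /Y /Y' /=; case: gossip_pair.
have hV : entries Q (fun w => Y w + b *: (Y w - Y' w)).
  by apply: entriesD => //; apply: entriesZ; exact: entriesB.
split; last first.
  by move=> j i; under eq_fun do rewrite E; exact: IH1.
move=> j i; under eq_fun do rewrite E; move: j i.
apply: entriesD; first exact: entriesZ.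
by apply: entriesZ; exact: entries_mulmx.
Qed.

Lemma entries_gossip d M a b (P : 'M[R]_M) (X : Omega -> 'M[R]_(d, M)) s :
  entries Q X -> entries Q (fun w => gossip a b P (X w) s).
Proof. by move=> hX; have [] := entries_gossip_pair a b P s hX. Qed.

Lemma entries_col d M (X : Omega -> 'M[R]_(d, M)) i :
  entries Q X -> entries Q (fun w => col i (X w)).
Proof. by move=> hX j k; under eq_fun do rewrite mxE; exact: hX. Qed.

Definition state_entries d M (S : Omega -> @dda_state R d M) : Prop :=
  [/\ entries Q (fun w => capX (S w)), entries Q (fun w => capZ (S w)),
      entries Q (fun w => capQ (S w)) & entries Q (fun w => prevXt (S w))].

Lemma state_entries_step d M B (Xi : Type) (P : 'M[R]_M) a b theta m eta
    (G : 'I_M -> 'cV[R]_d -> Xi -> 'cV[R]_d) t (z : Omega -> 'I_M -> 'I_B -> Xi)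
    (S : Omega -> dda_state) :
  state_entries S -> entries Q (fun w => minibatch G (capQ (S w)) (z w)) ->
  state_entries (fun w => dda_step P a b theta m eta G t (z w) (S w)).
Proof.
move=> [hX hZ hQ hp] hG.
have hZ' : entries Q (fun w => capZ (S w) - eta t *: minibatch G (capQ (S w)) (z w)).
  by apply: entriesB => //; exact: entriesZ.
have hXt := entries_gossip a b P B hX.
split => //=.
- by apply: entriesD; exact: entriesZ.
- by apply: entriesD => //; apply: entriesZ; exact: entriesB.
Qed.

Lemma state_entries0 d M (v : 'cV[R]_d) :
  let C := v *m (const_mx 1 : 'rV[R]_M) in
  state_entries (fun _ : Omega => DDAState C C C C).
Proof. by split => j i /=; exact: Qc. Qed.

End LinearlyClosed.

Lemma linearly_closed_measurable (R : realType) d (T : measurableType d) :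
  linearly_closed (fun X : T -> R => measurable_fun setT X).
Proof.
split=> [c|X Y mX mY|c X mX]; first exact: measurable_cst.
- exact: measurable_funD.
- exact: measurable_funM.
Qed.

Lemma linearly_closed_L2 (R : realType) d (T : measurableType d) (Pr : probability T R) :
  linearly_closed (L2 Pr).
Proof.
by split=> [c|X Y|c X]; [exact: L2_cst|exact: L2D|exact: L2Z].
Qed.

Lemma measurable_fun_gen_mono d (T : measurableType d) (Omega : pointedType)
    (F F' : set (set Omega)) (X : Omega -> T) : F `<=` F' ->
  measurable_fun setT (X : g_sigma_algebraType F -> T) ->
  measurable_fun setT (X : g_sigma_algebraType F' -> T).
Proof.
move=> FF' mX _ A mA; have := mX measurableT A mA.
exact: sub_sigma_algebra2.
Qed.

(** * Adaptedness of the iterates and moments of the minibatch noise *)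

Section History.
Context {R : realType} {d : nat} {dO dX : measure_display}.
Context {Omega : measurableType dO} {Xi : measurableType dX}.
Variables (M B T : nat) (f : 'I_M -> 'cV[R]_d -> R) (L sigma : R) (x0 : 'cV[R]_d)
  (P : 'M[R]_M) (a b : R) (theta m eta : nat -> R) (Pr : probability Omega R)
  (D : 'I_M -> R.-pker (borel_cV R d) ~> Xi)
  (G : 'I_M -> 'cV[R]_d -> Xi -> 'cV[R]_d)
  (xi : nat -> 'I_M -> 'I_B -> Omega -> Xi).
Hypotheses (L_ge0 : 0 <= L) (f_smooth : forall i, smooth L (f i))
  (B_gt0 : (0 < B)%N) (M_gt0 : (0 < M)%N)
  (oracle : forall i, stochastic_gradient_oracle (f i) sigma (D i) (G i)).
Let S t w := dda P a b theta m eta x0 G (fun t i s => xi t i s w) t.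
Hypothesis samples : fresh_samples Pr D
  (fun w => dda_query P a b theta m eta x0 G (fun t i s => xi t i s w)) xi T.

Let q t i w := col i (capQ (S t w)).
Definition sample_error t i s w : 'cV[R]_d := oracle_error (f i) (G i) (q t i w) (xi t i s w).

Lemma measurable_sample t i s : (t <= T)%N -> measurable_fun setT (xi t i s).
Proof. by move=> tT; have [H _] := samples tT; exact: H. Qed.

Lemma history_sub t : (t <= T.+1)%N -> history xi t `<=` @measurable _ Omega.
Proof.
move=> tT E [t' [i [s [A [t't mA ->]]]]].
have := @measurable_sample t' i s (leq_trans t't tT) measurableT A mA.
by rewrite setTI.
Qed.

Lemma history_mono t : history xi t `<=` history xi t.+1.
Proof.
by move=> E [t' [i [s [A [t't mA ->]]]]]; exists t', i, s, A; split => //; exact: leqW.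
Qed.

Lemma history_sample t i s :
  measurable_fun setT (xi t i s : g_sigma_algebraType (history xi t.+1) -> Xi).
Proof.
by move=> _ A mA; rewrite setTI; apply: sub_sigma_algebra; exists t, i, s, A.
Qed.

Lemma minibatch_col t i w : col i (minibatch G (capQ (S t w)) (fun i s => xi t i s w)) =
  B%:R^-1 *: \sum_s (grad (f i) (q t i w) + sample_error t i s w).
Proof.
apply/colP => j; rewrite [LHS]mxE [LHS]mxE.
congr (fun_of_matrix _ j 0); congr (_ *: _); apply: eq_bigr => s _.
by rewrite /sample_error /oracle_error addrC subrK.
Qed.

(** The samples of round [t] enter the state only at [t + 1], so the queries of round [t] are
    functions of the past, as conditioning on the past requires. *)
Lemma state_measurable t : (t <= T)%N ->
  state_entries (fun X : Omega -> R =>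
    measurable_fun setT (X : g_sigma_algebraType (history xi t) -> R)) (S t).
Proof.
elim: t => [|t IH] tT; first exact/state_entries0/linearly_closed_measurable.
have mono (X : Omega -> R) :
    measurable_fun setT (X : g_sigma_algebraType (history xi t) -> R) ->
    measurable_fun setT (X : g_sigma_algebraType (history xi t.+1) -> R).
  exact: measurable_fun_gen_mono (@history_mono t).
have [hX hZ hQ hp] := IH (ltnW tT).
apply: state_entries_step.
- exact: linearly_closed_measurable.
- by split=> j i; apply: mono; [exact: hX|exact: hZ|exact: hQ|exact: hp].
move=> j i.
rewrite (_ : (fun w => _) = fun w => B%:R^-1 *
   (\sum_(s < B) (grad (f i) (q t i w) j 0 + sample_error t i s w j 0))); last first.
  apply/funext => w; have := congr1 (fun v : 'cV[R]_d => v j 0) (minibatch_col t i w).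
  rewrite mxE => ->; rewrite mxE summxE; congr (_ * _).
  by apply: eq_bigr => s _; rewrite mxE.
have mq k : measurable_fun setT ((fun w => q t i w k 0) : g_sigma_algebraType (history xi t.+1) -> R).
  by under eq_fun do rewrite mxE; apply: mono; exact: hQ.
apply: measurable_funM; first exact: measurable_cst.
apply: measurable_sum => s; apply: measurable_funD.
  exact: (measurableT_comp (measurable_grad_coord L_ge0 (f_smooth i) j) (measurable_fun_borel_cV mq)).
apply: (measurable_oracle_error L_ge0 (f_smooth i) (oracle i)) => //.
exact: history_sample.
Qed.

Let mqF t i : (t <= T)%N -> forall j, measurable_fun setT
  ((fun w => q t i w j 0) : g_sigma_algebraType (history xi t) -> R).
Proof.
move=> tT j; have [_ _ hQ _] := state_measurable tT.
by under eq_fun do rewrite mxE; exact: hQ.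
Qed.

Lemma sample_law t i s H A : (t <= T)%N -> <<s history xi t >> H -> measurable A ->
  Pr (xi t i s @^-1` A `&` H) = (\int[Pr]_(w in H) D i (q t i w) A)%E.
Proof.
move=> tT mH mA; have [_ law] := samples tT.
(* All other samples are left unconstrained; their kernels have mass one, so the product reduces to
   a single factor. *)
pose A' i' s' := if (i', s') == (i, s) then A else setT.
have [|_ /(_ H mH) E] := law A'.
  by move=> i' s'; rewrite /A'; case: ifP.
rewrite (_ : xi t i s @^-1` A = [set w | forall i' s', A' i' s' (xi t i' s' w)]); last first.
  apply/seteqP; split => [w Aw i' s'|w /(_ i s)]; last by rewrite /A' eqxx.
  by rewrite /A'; case: ifP => // /eqP[-> ->].
rewrite -E; apply: eq_integral => w _.
rewrite (bigD1 i)//= (bigD1 s)//= [X in (_ * X * _)%E]big1 => [|s' s's]; last first.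
  by rewrite /A' xpair_eqE (negbTE s's) andbF prob_kernel.
rewrite big1 => [|i' i'i]; last first.
  by rewrite big1// => s' _; rewrite /A' xpair_eqE (negbTE i'i) prob_kernel.
by rewrite /A' eqxx !mule1.
Qed.

Lemma sample_pair_law t i1 s1 i2 s2 H A1 A2 : (t <= T)%N -> (i1, s1) != (i2, s2) ->
  <<s history xi t >> H -> measurable A1 -> measurable A2 ->
  Pr ((xi t i1 s1 @^-1` A1 `&` xi t i2 s2 @^-1` A2) `&` H) =
  (\int[Pr]_(w in H) (D i1 (q t i1 w) A1 * D i2 (q t i2 w) A2))%E.
Proof.
move=> tT ne mH mA1 mA2; have [_ law] := samples tT.
pose A' i' s' := if (i', s') == (i1, s1) then A1 else
  if (i', s') == (i2, s2) then A2 else setT.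
have [|_ /(_ H mH) E] := law A'.
  by move=> i' s'; rewrite /A'; case: ifP => // _; case: ifP.
have A'1 : A' i1 s1 = A1 by rewrite /A' eqxx.
have A'2 : A' i2 s2 = A2 by rewrite /A' eq_sym (negbTE ne) eqxx.
rewrite (_ : _ `&` _ `&` H = [set w | forall i' s', A' i' s' (xi t i' s' w)] `&` H); last first.
  congr (_ `&` H); apply/seteqP; split => [w [Aw1 Aw2] i' s'|w AA].
    rewrite /A'; case: ifP => [/eqP[-> ->]//|_].
    by case: ifP => // /eqP[-> ->].
  by split; [have := AA i1 s1; rewrite A'1|have := AA i2 s2; rewrite A'2].
rewrite -E; apply: eq_integral => w _.
rewrite (pair_bigA _ (fun i s => D i (q t i w) (A' i s))) /=.
rewrite (bigD1 (i1, s1))//= (bigD1 (i2, s2))/= 1?eq_sym// big1 => [|[i s] /= /andP[n1 n2]]; last first.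
  by rewrite /A' (negbTE n1) (negbTE n2) prob_kernel.
by rewrite A'1 A'2 mule1.
Qed.

Let mqO t i : (t <= T)%N -> forall j, measurable_fun setT (fun w => q t i w j 0).
Proof.
move=> tT j; apply: measurable_fun_sub_salgebra (mqF i tT j).
exact: history_sub (leqW tT).
Qed.

Lemma sample_error_moment t i s : (t <= T)%N ->
  L1 Pr (fun w => sqn (sample_error t i s w)) /\
  mean Pr (fun w => sqn (sample_error t i s w)) <= sigma ^+ 2.
Proof.
move=> tT; apply: (L1_oracle_error L_ge0 (f_smooth i) (oracle i) (history_sub (leqW tT)) (mqF i tT)).
  exact: measurable_sample.
by move=> H A; exact: sample_law.
Qed.

Lemma sample_error_L2 t i s : (t <= T)%N -> L2mx Pr (sample_error t i s).
Proof.
move=> tT; apply: L2mx_sqn; last exact: (sample_error_moment i s tT).1.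
move=> j; apply: (measurable_oracle_error L_ge0 (f_smooth i) (oracle i)); first exact: mqO.
exact: measurable_sample.
Qed.

Lemma sample_error_centered t i s (h : Omega -> 'cV[R]_d) : (t <= T)%N ->
  entries (fun X : Omega -> R =>
    measurable_fun setT (X : g_sigma_algebraType (history xi t) -> R)) h ->
  L2mx Pr h -> mean Pr (fun w => dotv (h w) (sample_error t i s w)) = 0.
Proof.
move=> tT mh Lh; have Le := sample_error_L2 i s tT.
rewrite mean_sum => [|j]; last exact: L2M.
apply: big1 => j _.
apply: (mean_oracle_error L_ge0 (f_smooth i) (oracle i) (history_sub (leqW tT)) (mqF i tT)).
- exact: measurable_sample.
- by move=> H A; exact: sample_law.
- exact: mh.
- exact: L2M.
Qed.

Lemma sample_error_uncorrelated t i1 s1 i2 s2 : (t <= T)%N -> (i1, s1) != (i2, s2) ->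
  mean Pr (fun w => dotv (sample_error t i1 s1 w) (sample_error t i2 s2 w)) = 0.
Proof.
move=> tT ne; have Le1 := sample_error_L2 i1 s1 tT; have Le2 := sample_error_L2 i2 s2 tT.
rewrite mean_sum => [|j]; last exact: L2M.
apply: big1 => j _.
apply: (mean_oracle_error_pair L_ge0 (f_smooth i1) (f_smooth i2) (oracle i1) (oracle i2)
  (history_sub (leqW tT)) (mqF i1 tT) (mqF i2 tT)).
- exact: measurable_sample.
- exact: measurable_sample.
- by move=> H A1 A2; exact: sample_pair_law.
- exact: L2M.
Qed.

Definition node_error t i w : 'cV[R]_d := B%:R^-1 *: \sum_s sample_error t i s w.
Definition mean_error t w : 'cV[R]_d := M%:R^-1 *: \sum_i node_error t i w.

Lemma node_error_L2 t i : (t <= T)%N -> L2mx Pr (node_error t i).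
Proof.
by move=> tT; apply: L2mxZ; apply: L2mx_sum => s; exact: sample_error_L2.
Qed.

Lemma mean_error_L2 t : (t <= T)%N -> L2mx Pr (mean_error t).
Proof.
by move=> tT; apply: L2mxZ; apply: L2mx_sum => i; exact: node_error_L2.
Qed.

(** Convexity of the square suffices, without the gain [1 / B]: this bound feeds only the
    dispersions, which the gossip factor makes negligible. *)
Lemma node_error_moment t i : (t <= T)%N ->
  mean Pr (fun w => sqn (node_error t i w)) <= sigma ^+ 2.
Proof.
move=> tT; have B0 : B%:R != 0 :> R by rewrite pnatr_eq0 -lt0n.
have Ls s : L1 Pr (fun w => sqn (sample_error t i s w)).
  exact: (sample_error_moment i s tT).1.
apply: (@le_trans _ _ (mean Pr (fun w => B%:R^-1 * \sum_s sqn (sample_error t i s w)))).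
  apply: le_mean; first exact/L1_sqn/node_error_L2.
    by apply: L1Z; exact: L1_sum.
  move=> w; rewrite sqnZ.
  apply: le_trans (ler_wpM2l (sqr_ge0 _) (sqn_sum_le _)) _.
  by rewrite mulrA (_ : B%:R^-1 ^+ 2 * B%:R = B%:R^-1)//; field.
rewrite meanZ; last exact: L1_sum.
rewrite mean_sum// ler_pdivrMl ?ltr0n//.
apply: (@le_trans _ _ (\sum_(s < B) sigma ^+ 2)).
  by apply: ler_sum => s _; exact: (sample_error_moment i s tT).2.
by rewrite sumr_const card_ord mulr_natl.
Qed.

Lemma mean_error_centered t (h : Omega -> 'cV[R]_d) : (t <= T)%N ->
  entries (fun X : Omega -> R =>
    measurable_fun setT (X : g_sigma_algebraType (history xi t) -> R)) h ->
  L2mx Pr h -> mean Pr (fun w => dotv (mean_error t w) (h w)) = 0.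
Proof.
move=> tT mh Lh.
have Le i s : L1 Pr (fun w => dotv (h w) (sample_error t i s w)).
  by apply: L1_dotv => //; exact: sample_error_L2.
have -> : (fun w => dotv (mean_error t w) (h w)) = fun w =>
    M%:R^-1 * \sum_i B%:R^-1 * \sum_s dotv (h w) (sample_error t i s w).
  apply/funext => w; rewrite dotvZl dotv_suml; congr (_ * _).
  apply: eq_bigr => i _; rewrite dotvZl dotv_suml; congr (_ * _).
  by apply: eq_bigr => s _; rewrite dotvC.
have Li i : L1 Pr (fun w => B%:R^-1 * \sum_s dotv (h w) (sample_error t i s w)).
  by apply: L1Z; exact: L1_sum.
rewrite meanZ; last exact: L1_sum.
rewrite mean_sum// big1 ?mulr0// => i _.
rewrite meanZ; last exact: L1_sum.
by rewrite mean_sum// big1 ?mulr0// => s _; exact: sample_error_centered.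
Qed.

(** The error is an average of [M B] pairwise uncorrelated terms, across nodes as well as within
    minibatches, so only the diagonal of the expanded square survives. *)
Lemma mean_error_moment t : (t <= T)%N ->
  mean Pr (fun w => sqn (mean_error t w)) <= sigma ^+ 2 / (M * B)%:R.
Proof.
move=> tT.
pose e (p : 'I_M * 'I_B) w := sample_error t p.1 p.2 w.
have Le p : L2mx Pr (e p) by exact: sample_error_L2.
have Lee p p' : L1 Pr (fun w => dotv (e p w) (e p' w)) by exact: L1_dotv.
have -> : (fun w => sqn (mean_error t w)) = fun w =>
    (M * B)%:R^-1 ^+ 2 * \sum_p \sum_p' dotv (e p w) (e p' w).
  apply/funext => w.
  have -> : mean_error t w = (M * B)%:R^-1 *: \sum_p e p w.
    rewrite /mean_error /node_error -scaler_sumr scalerA natrM invfM.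
    by rewrite pair_bigA.
  rewrite sqnZ; congr (_ * _); rewrite /sqn dotv_suml; apply: eq_bigr => p _.
  by rewrite dotvC dotv_suml; apply: eq_bigr => p' _; rewrite dotvC.
rewrite meanZ; last by apply: L1_sum => p; exact: L1_sum.
rewrite mean_sum => [|p]; last exact: L1_sum.
have MB0 : (0 < M * B)%N by rewrite muln_gt0 M_gt0.
apply: (@le_trans _ _ ((M * B)%:R^-1 ^+ 2 * \sum_(p : 'I_M * 'I_B) sigma ^+ 2)).
  apply: ler_wpM2l; first exact: sqr_ge0.
  apply: ler_sum => p _; rewrite mean_sum// (bigD1 p)//= big1 => [|p' pp'].
    by rewrite addr0; exact: (sample_error_moment p.1 p.2 tT).2.
  by apply: sample_error_uncorrelated => //; rewrite -!surjective_pairing eq_sym.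
rewrite sumr_const card_prod !card_ord -[sigma ^+ 2 *+ _]mulr_natl.
rewrite [leLHS](_ : _ = sigma ^+ 2 / (M * B)%:R)//; field.
by rewrite !pnatr_eq0 -!lt0n B_gt0 M_gt0.
Qed.

Lemma minibatch_L2 t : (t <= T)%N -> L2mx Pr (fun w => capQ (S t w)) ->
  L2mx Pr (fun w => minibatch G (capQ (S t w)) (fun i s => xi t i s w)).
Proof.
move=> tT hQ j i.
rewrite (_ : (fun w => _) = fun w => grad (f i) (q t i w) j 0 + node_error t i w j 0); last first.
  apply/funext => w; have := congr1 (fun v : 'cV[R]_d => v j 0) (minibatch_col t i w).
  rewrite mxE => ->; rewrite big_split sumr_const card_ord /= scalerDr -[grad _ _ *+ _]scaler_nat.
  rewrite scalerA mulVf ?scale1r; first by rewrite mxE.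
  by rewrite pnatr_eq0 -lt0n.
apply: L2D; last exact: node_error_L2.
have Lq : L1 Pr (fun w => sqn (q t i w)) by apply: L1_sqn => k l; under eq_fun do rewrite mxE; exact: hQ.
have mg : measurable_fun setT (fun w => grad (f i) (q t i w) j 0).
  exact: (measurableT_comp (measurable_grad_coord L_ge0 (f_smooth i) j)
    (measurable_fun_borel_cV (mqO i tT))).
split => //.
(* The gradient inherits square integrability from the query by comparison with its value at the
   origin. *)
apply: L1_dominated (L1Z 2 (L1D (L1Z (L ^+ 2) Lq) (L1_cst Pr (sqn (grad (f i) 0))))) _.
  exact: measurable_funX.
move=> w; rewrite ger0_norm ?sqr_ge0//.
apply: le_trans (coord_sqr_le _ _) _.
rewrite -[grad (f i) (q t i w)](subrK (grad (f i) 0)).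
apply: le_trans (sqnD_le _ _) _; rewrite ler_pM2l ?ltr0n// lerD2r.
by have := smooth_sqn L_ge0 (f_smooth i) (q t i w) 0; rewrite subr0.
Qed.

Lemma state_L2 t : (t <= T)%N -> state_entries (L2 Pr) (S t).
Proof.
elim: t => [|t IH] tT; first exact/state_entries0/linearly_closed_L2.
have tT' := ltnW tT; have [hX hZ hQ hp] := IH tT'.
by apply: state_entries_step; [exact: linearly_closed_L2|by []|exact: minibatch_L2].
Qed.

End History.

(** * Recursion of the moments *)

Section MomentRecursion.
Context {R : realType}.
Variables (M B T : nat) (L r sigma zeta delta2 : R).
Hypotheses (M_gt0 : (0 < M)%N) (B_gt0 : (0 < B)%N) (T_gt0 : (0 < T)%N)
  (L_gt0 : 0 < L) (r_gt0 : 0 < r) (sigma_ge0 : 0 <= sigma) (zeta_ge0 : 0 <= zeta)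
  (delta2_ge0 : 0 <= delta2).
Local Notation theta := (step_theta L T).
Local Notation beta := (step_beta M B T L sigma r).
Local Notation eta := (step_eta M B T L sigma r).
Local Notation a := (step_a L).
Local Notation A := (step_A L).
Let kappa := 1 + (zeta + sigma) / (L * r).
Hypothesis delta2_small : 25 * M%:R * T%:R ^+ 7 * kappa ^+ 2 * delta2 <= 1.

(** These stand for expectations: [ex] of the excess at the averaged iterate, [px], [pz], [pq] of
    the squared distances of the averages of [X], [Z], [Q] to [xstar], and [cQ], [cX], [cZ], [cG] of
    the dispersions. *)
Variables (ex px pz pq cQ cX cZ cG : nat -> R).
Hypotheses (ex_ge0 : forall t, 0 <= ex t) (px0 : px 0 <= r ^+ 2) (pz0 : pz 0 <= r ^+ 2)
  (pq0 : pq 0 <= r ^+ 2) (cQ0 : cQ 0 = 0) (cX0 : cX 0 = 0).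
Hypothesis pz_ge0 : forall t, 0 <= pz t.
Hypothesis cG_ge0 : forall t, 0 <= cG t.
Hypothesis cQ_ge0 : forall t, 0 <= cQ t.
Hypothesis potential_le : forall t, (t <= T)%N ->
  (if t is s.+1 then A s else 0) * ex t + beta / 2 * pz t <=
  beta / 2 * r ^+ 2 + \sum_(s < t) (a s ^+ 2 / beta * (sigma ^+ 2 / (M * B)%:R)
    + L * A s * (M%:R^-1 * cQ s)).
Hypothesis px_le : forall t, (t < T)%N -> px t.+1 <= (1 - theta t) * px t + theta t * pz t.+1.
Hypothesis pq_le : forall t, (t < T)%N -> pq t.+1 <= 15 * px t + 10 * px t.-1.
Hypothesis cX_le : forall t, (t < T)%N -> cX t.+1 <= (1 - theta t) * cX t + theta t * cZ t.+1.
Hypothesis cZ_le : forall t, (t <= T)%N -> cZ t <= t%:R * \sum_(s < t) eta s ^+ 2 * cG s.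
Hypothesis cG_le : forall t, (t < T)%N ->
  cG t <= 3 * (M%:R * sigma ^+ 2 + M%:R * zeta ^+ 2 + L ^+ 2 * (cQ t + M%:R * pq t)).
Hypothesis cQ_le : forall t, (t < T)%N -> cQ t.+1 <= delta2 * (15 * cX t + 10 * cX t.-1).

Let H2 : R := \sum_(0 <= i < T) a i ^+ 2.
Let h : R := sigma / (r * Num.sqrt (M * B)%:R) * Num.sqrt H2.
Let K : R := (M * B)%:R.
Let K_gt0 : 0 < K. Proof. by rewrite ltr0n muln_gt0 M_gt0. Qed.
Let T1 : 1 <= T%:R :> R. Proof. by rewrite ler1n. Qed.
Let M1 : 1 <= M%:R :> R. Proof. by rewrite ler1n. Qed.

Let H2_ge0 : 0 <= H2. Proof. by apply: sumr_ge0 => i _; exact: sqr_ge0. Qed.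

Let betaE : beta = 1 + h. Proof. by []. Qed.

Let h_ge0 : 0 <= h.
Proof. by rewrite mulr_ge0 ?sqrtr_ge0// divr_ge0// mulr_ge0 ?sqrtr_ge0// ltW. Qed.

(** The part [h] of [beta] above 1 is tuned so that the accumulated noise [H2 sigma^2 / K] equals
    [h^2 r^2]; divided by [beta], it is comparable with [beta r^2]. *)
Let hE : h ^+ 2 * r ^+ 2 = H2 * (sigma ^+ 2 / K).
Proof.
rewrite /h !exprMn exprVn exprMn sqr_sqrtr ?(ltW K_gt0)// sqr_sqrtr// -/K.
by field; rewrite !pnatr_eq0 -!lt0n M_gt0 B_gt0 gt_eqF.
Qed.

(** Tolerance on the query dispersions: with [L A_s <= T^2 / 128] and at most [T] rounds, their
    total contribution to the potential is at most [r^2 / 128]. *)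
Let eps : R := M%:R * r ^+ 2 / T%:R ^+ 3.

Let LA_le s : (s < T)%N -> L * A s <= T%:R ^+ 2 / 128.
Proof.
move=> sT; rewrite step_AE//.
have s1 : s.+1%:R <= T%:R :> R by rewrite ler_nat.
have s2 : s.+2%:R <= 2 * T%:R :> R.
  by rewrite -natrM ler_nat mul2n -addnn -add1n leq_add.
have s0 : 0 <= s.+1%:R :> R by [].
rewrite (_ : L * _ = s.+1%:R * s.+2%:R / 256); last by field; rewrite gt_eqF.
have : s.+1%:R * s.+2%:R <= T%:R * (2 * T%:R) :> R by exact: ler_pM.
lra.
Qed.

Let sum_cQ t : (t <= T)%N -> (forall s, (s < t)%N -> cQ s <= eps) ->
  \sum_(s < t) L * A s * (M%:R^-1 * cQ s) <= r ^+ 2 / 8.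
Proof.
move=> tT cQe.
have M0 : 0 < M%:R :> R by rewrite ltr0n.
have T0 : 0 < T%:R :> R by rewrite ltr0n.
apply: (@le_trans _ _ (\sum_(s < t) T%:R ^+ 2 / 128 * (M%:R^-1 * eps))).
  apply: ler_sum => s _; have sT := leq_trans (ltn_ord s) tT.
  apply: ler_pM; last 2 first.
  - exact: LA_le.
  - by rewrite ler_pM2l ?invr_gt0//; exact: cQe.
  - exact: ltW (mulr_gt0 L_gt0 (step_A_gt0 L_gt0 s)).
  - by rewrite mulr_ge0 ?invr_ge0.
rewrite sumr_const card_ord -[leLHS]mulr_natl.
have -> : T%:R ^+ 2 / 128 * (M%:R^-1 * eps) = r ^+ 2 / (128 * T%:R).
  by rewrite /eps; field; rewrite !gt_eqF.
have tT' : t%:R <= T%:R :> R by rewrite ler_nat.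
apply: (@le_trans _ _ (T%:R * (r ^+ 2 / (128 * T%:R)))).
  rewrite ler_wpM2r// divr_ge0 ?sqr_ge0// mulr_ge0 ?ler0n//.
rewrite (_ : _ * _ = r ^+ 2 / 128); last by field; rewrite gt_eqF.
have := sqr_ge0 r; lra.
Qed.

Let sum_noise t : (t <= T)%N ->
  \sum_(s < t) a s ^+ 2 / beta * (sigma ^+ 2 / K) <= h ^+ 2 * r ^+ 2 / beta.
Proof.
move=> tT; have b0 : 0 < beta := lt_le_trans ltr01 (step_beta_ge1 L T r_gt0 sigma_ge0).
rewrite hE -!mulr_suml [leRHS]mulrAC ler_wpM2r ?divr_ge0 ?sqr_ge0 ?(ltW K_gt0)//.
rewrite ler_wpM2r ?invr_ge0 ?(ltW b0)//.
rewrite /H2 (big_mkord xpredT (fun s => a s ^+ 2)) (big_ord_widen T (fun s => a s ^+ 2) tT).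
rewrite [leRHS](bigID (fun s : 'I_T => (s < t)%N))/= lerDl.
by apply: sumr_ge0 => s _; exact: sqr_ge0.
Qed.

Let main_le t : (t <= T)%N -> (forall s, (s < t)%N -> cQ s <= eps) ->
  (if t is s.+1 then A s else 0) * ex t + beta / 2 * pz t <=
  beta / 2 * r ^+ 2 + h ^+ 2 * r ^+ 2 / beta + r ^+ 2 / 8.
Proof.
move=> tT cQe; apply: le_trans (potential_le tT) _.
by rewrite big_split /= addrA lerD ?lerD2l ?sum_noise ?sum_cQ.
Qed.

Let beta_ge1 : 1 <= beta. Proof. exact: step_beta_ge1. Qed.
Let beta_gt0 : 0 < beta. Proof. exact: lt_le_trans ltr01 beta_ge1. Qed.

(** The three terms of [main_le] are at most [1 / 2], [1] and [1 / 8] times [beta r^2], which gives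
    [13 / 4] before rounding up. *)
Let pz_le4 t : (t <= T)%N -> (forall s, (s < t)%N -> cQ s <= eps) -> pz t <= 4 * r ^+ 2.
Proof.
move=> tT cQe; have := main_le tT cQe.
have Aex : 0 <= (if t is s.+1 then A s else 0) * ex t.
  apply: mulr_ge0 => //; case: (t) => // s; exact: ltW (step_A_gt0 L_gt0 s).
have hb : h ^+ 2 * r ^+ 2 / beta <= beta * r ^+ 2.
  rewrite ler_pdivrMr// [leRHS](_ : _ = beta ^+ 2 * r ^+ 2); last by ring.
  rewrite ler_wpM2r ?sqr_ge0//.
  by rewrite ler_sqr ?nnegrE ?(ltW beta_gt0)// betaE lerDr.
have rb : r ^+ 2 <= beta * r ^+ 2 by rewrite ler_peMl ?sqr_ge0.
move=> main; rewrite -(ler_pM2l beta_gt0); move: main Aex hb rb (sqr_ge0 r); lra.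
Qed.

Let conv_le t (u v c : R) : u <= c -> v <= c -> (1 - theta t) * u + theta t * v <= c.
Proof.
move=> uc vc; have /andP[t0 t1] := step_theta01 T L_gt0 t.
have -> : c = (1 - theta t) * c + theta t * c by ring.
by apply: lerD; apply: ler_wpM2l => //; rewrite subr_ge0.
Qed.

(** Bound for the dispersions of [Z] and [X]: two factors [T] come from the sum over rounds, two
    more from [eta^2 <= (T / (128 L))^2], and the rest from the gradient dispersion. *)
Let W : R := T%:R ^+ 4 * M%:R * r ^+ 2 * kappa ^+ 2.

Let W_ge0 : 0 <= W.
Proof.
apply: mulr_ge0 (sqr_ge0 _).
exact: mulr_ge0 (mulr_ge0 (exprn_ge0 _ (ler0n _ _)) (ler0n _ _)) (sqr_ge0 _).
Qed.

Let eps_le : eps <= M%:R * r ^+ 2.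
Proof.
by rewrite ler_pdivrMr ?exprn_gt0 ?ltr0n// ler_peMr ?exprn_ege1// mulr_ge0 ?sqr_ge0.
Qed.

(* Bootstrap: small query dispersions up to round [t] bound the potential, hence
   all second moments by powers of [T], and the gossip factor [delta2] absorbs
   these to keep the next query dispersion small. *)
Let step t : (t <= T)%N -> (forall s, (s <= t)%N -> cQ s <= eps) ->
  [/\ forall s, (s <= t)%N -> px s <= 4 * r ^+ 2
    & forall s, (s <= t)%N -> cX s <= W].
Proof.
move=> tT cQe.
have r2 : 0 <= r ^+ 2 by exact: sqr_ge0.
have hpx s : (s <= t)%N -> px s <= 4 * r ^+ 2.
  elim: s => [_|s IH st]; first by move: px0 r2; lra.
  apply: le_trans (px_le (leq_trans st tT)) (conv_le _ _ _); first exact/IH/ltnW.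
  apply: pz_le4 => [|u us]; first exact: leq_trans st tT.
  by apply: cQe; apply: leq_trans (ltnW us) st.
have hpq s : (s <= t)%N -> pq s <= 100 * r ^+ 2.
  case: s => [_|s st]; first by move: pq0 r2; lra.
  have := pq_le (leq_trans st tT).
  have := hpx s (ltnW st); have := hpx s.-1 (leq_trans (leq_pred s) (ltnW st)).
  lra.
(* The distance bound [4 r^2] gives [100 = 15 * 4 + 10 * 4] for the queries. Their dispersion adds
   one more [M r^2], and the factor 3 makes 303. *)
have hcG s : (s < t)%N -> cG s <= 303 * M%:R * (L ^+ 2 * r ^+ 2 * kappa ^+ 2).
  move=> st; apply: le_trans (cG_le (leq_trans st tT)) _.
  have cQs : cQ s <= M%:R * r ^+ 2 := le_trans (cQe s (ltnW st)) eps_le.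
  have pqs : M%:R * pq s <= M%:R * (100 * r ^+ 2).
    by rewrite ler_wpM2l//; exact/hpq/ltnW.
  have L2 : L ^+ 2 * (cQ s + M%:R * pq s) <= L ^+ 2 * (101 * (M%:R * r ^+ 2)).
    by rewrite ler_wpM2l ?sqr_ge0//; move: cQs pqs; lra.
  have kE : L ^+ 2 * r ^+ 2 * kappa ^+ 2 = (L * r + zeta + sigma) ^+ 2.
    by rewrite /kappa; field; rewrite !gt_eqF.
  have Lr : 0 <= L * r by rewrite mulr_ge0 ?ltW.
  have sq : sigma ^+ 2 + zeta ^+ 2 + L ^+ 2 * r ^+ 2 <= L ^+ 2 * r ^+ 2 * kappa ^+ 2.
    rewrite kE -subr_ge0 (_ : _ - _ = 2 * (L * r * zeta + L * r * sigma + zeta * sigma)).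
      apply: mulr_ge0; rewrite ?ler0n//.
      by apply: addr_ge0; [apply: addr_ge0|]; apply: mulr_ge0.
    by ring.
  have := ler_wpM2l (ler0n R M) sq; have := mulr_ge0 (ler0n R M) (sqr_ge0 sigma).
  have := mulr_ge0 (ler0n R M) (sqr_ge0 zeta).
  move: L2; lra.
have hcZ s : (s <= t)%N -> cZ s <= W.
  move=> st; apply: le_trans (cZ_le (leq_trans st tT)) _.
  set g := 303 * M%:R * _ in hcG.
  have etaT u : (u < s)%N -> eta u ^+ 2 * cG u <= (T%:R / (128 * L)) ^+ 2 * g.
    move=> us; have /andP[e0 ea] := @step_eta_le R M B L r sigma T L_gt0 r_gt0 sigma_ge0 u.
    apply: ler_pM; rewrite ?sqr_ge0//; last exact/hcG/(leq_trans us st).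
    rewrite ler_sqr ?nnegrE//; last first.
      by rewrite divr_ge0// mulr_ge0 ?ler0n ?ltW.
    apply: le_trans ea _; rewrite ler_pM2r ?invr_gt0 ?mulr_gt0 ?ltr0n//.
    by rewrite ler_nat (leq_trans us)// (leq_trans st).
  apply: (@le_trans _ _ (s%:R * \sum_(u < s) (T%:R / (128 * L)) ^+ 2 * g)).
    by rewrite ler_wpM2l//; apply: ler_sum => u _; exact: etaT.
  rewrite sumr_const card_ord -(mulr_natl (_ ^+ 2 * g)).
  have sT : s%:R <= T%:R :> R by rewrite ler_nat (leq_trans st).
  have g0 : 0 <= (T%:R / (128 * L)) ^+ 2 * g.
    apply: mulr_ge0 (sqr_ge0 _) _.
    apply: mulr_ge0 (mulr_ge0 (ler0n _ _) (ler0n _ _)) _.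
    exact: mulr_ge0 (mulr_ge0 (sqr_ge0 _) (sqr_ge0 _)) (sqr_ge0 _).
  apply: (@le_trans _ _ (T%:R * (T%:R * ((T%:R / (128 * L)) ^+ 2 * g)))).
    by apply: ler_pM => //; [exact: mulr_ge0|exact: ler_wpM2r].
  rewrite (_ : T%:R * _ = 303 / 16384 * W); last first.
    by rewrite /g /W; field; rewrite gt_eqF.
  by move: W_ge0; lra.
split=> // s; elim: s => [_|s IH st].
  by rewrite cX0 W_ge0.
apply: le_trans (cX_le (leq_trans st tT)) (conv_le _ _ _); first exact/IH/ltnW.
exact: hcZ.
Qed.

Let cQ_small t : (t <= T)%N -> forall s, (s <= t)%N -> cQ s <= eps.
Proof.
elim: t => [_ s|t IH tT s].
  by rewrite leqn0 => /eqP->; rewrite cQ0 divr_ge0 ?mulr_ge0 ?exprn_ge0 ?ler0n// ltW.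
rewrite leq_eqVlt => /orP[/eqP->|]; last exact: IH (ltnW tT) s.
have [_ hcX] := step (ltnW tT) (IH (ltnW tT)).
apply: le_trans (cQ_le tT) _.
(* With [25 = 15 + 10], the [T^4] of [W] and the [T^3] of [eps] combine to the seventh power in
   [delta2_small]. *)
have : delta2 * (15 * cX t + 10 * cX t.-1) <= delta2 * (25 * W).
  rewrite ler_wpM2l//; have := hcX t (leqnn _); have := hcX t.-1 (leq_pred t).
  lra.
move/le_trans; apply; rewrite /eps ler_pdivlMr ?exprn_gt0 ?ltr0n//.
rewrite [leLHS](_ : _ = (25 * M%:R * T%:R ^+ 7 * kappa ^+ 2 * delta2) * r ^+ 2); last first.
  by rewrite /W; ring.
apply: (@le_trans _ _ (1 * r ^+ 2)); first by rewrite ler_wpM2r ?sqr_ge0.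
by rewrite ler_wpM2r ?sqr_ge0.
Qed.

Let h_le : h <= sigma / (r * Num.sqrt K) * (T%:R * Num.sqrt T%:R / (128 * L)).
Proof.
have L128 : 0 < 128 * L by rewrite mulr_gt0 ?ltr0n.
have T0 : 0 <= T%:R :> R by exact: ler0n.
apply: ler_wpM2l.
  by rewrite divr_ge0// mulr_ge0 ?sqrtr_ge0// ltW.
have q0 : 0 <= T%:R * Num.sqrt T%:R / (128 * L).
  by rewrite divr_ge0 ?(ltW L128)// mulr_ge0 ?sqrtr_ge0.
rewrite -(ger0_norm q0) -sqrtr_sqr ler_wsqrtr//.
rewrite exprMn exprMn sqr_sqrtr// exprVn.
apply: (@le_trans _ _ (\sum_(0 <= i < T) (T%:R / (128 * L)) ^+ 2)).
  rewrite /H2 !big_mkord; apply: ler_sum => i _.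
  have a0 := ltW (step_a_gt0 L_gt0 i).
  rewrite ler_sqr ?nnegrE// ?divr_ge0 ?(ltW L128)//.
  by rewrite /step_a ler_pM2r ?invr_gt0// ler_nat ltn_ord.
rewrite sumr_const_nat subn0 -(mulr_natl (_ ^+ 2)) exprMn exprVn.
by rewrite mulrA [T%:R * _]mulrC.
Qed.

Lemma moment_recursion : 2 * ex T + L * (delta2 * cX T) <=
  6 * sigma * r / Num.sqrt ((M * B)%:R * T%:R) + 321 * L * r ^+ 2 / T%:R ^+ 2.
Proof.
have [_ hcX] := step (leqnn T) (cQ_small (leqnn T)).
have r2 : 0 <= r ^+ 2 := sqr_ge0 r.
have T0 : 0 < T%:R :> R by rewrite ltr0n.
have T20 : 0 < T%:R ^+ 2 :> R by rewrite exprn_gt0.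
have cXT : L * (delta2 * cX T) <= L * r ^+ 2 / T%:R ^+ 2.
  rewrite -mulrA ler_pM2l// ler_pdivlMr//.
  apply: (@le_trans _ _ (delta2 * W * T%:R ^+ 2)).
    by rewrite ler_pM2r// ler_wpM2l// hcX.
  rewrite (_ : delta2 * W * _ = (M%:R * T%:R ^+ 6 * kappa ^+ 2 * delta2) * r ^+ 2); last first.
    by rewrite /W; ring.
  rewrite ler_piMl//; apply: le_trans delta2_small.
  rewrite (_ : 25 * _ * _ * _ * _ = (M%:R * T%:R ^+ 6 * kappa ^+ 2 * delta2) * (25 * T%:R)); last by ring.
  rewrite ler_peMr//; last by move: T1; lra.
  exact: mulr_ge0 (mulr_ge0 (mulr_ge0 (ler0n _ _) (exprn_ge0 _ (ler0n _ _))) (sqr_ge0 _)) delta2_ge0.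
have main := main_le (leqnn T) (fun s sT => cQ_small (leqnn T) (ltnW sT)).
rewrite (_ : (if T is s.+1 then A s else 0) = A T.-1) in main; last first.
  by case: (T) T_gt0.
(* [beta] dominates [h], so the noise costs only a term linear in [h]. *)
have hb : h ^+ 2 * r ^+ 2 / beta <= h * r ^+ 2.
  rewrite ler_pdivrMr// [leLHS](_ : _ = h * r ^+ 2 * h); last by ring.
  apply: (ler_wpM2l (mulr_ge0 h_ge0 r2)).
  by rewrite betaE lerDr.
have bp : 0 <= beta / 2 * pz T by rewrite mulr_ge0// divr_ge0// ltW.
(* [beta / 2] contributes [1 / 2 + h / 2], the noise [h] and the dispersions [1 / 8]. *)
have Aex : A T.-1 * ex T <= 5 / 8 * r ^+ 2 + 3 / 2 * (h * r ^+ 2).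
  move: main hb bp; rewrite betaE; lra.
have AT : T%:R ^+ 2 / (256 * L) <= A T.-1.
  rewrite step_AE// prednK// -[in leLHS](mulr1 T%:R) ler_pM2r ?invr_gt0 ?mulr_gt0 ?ltr0n//.
  by rewrite mulr1 expr2 ler_pM2l// ler_nat.
have exT : ex T <= (5 / 8 * r ^+ 2 + 3 / 2 * (h * r ^+ 2)) * (256 * L) / T%:R ^+ 2.
  rewrite ler_pdivlMr// -ler_pdivrMr ?mulr_gt0 ?ltr0n//.
  apply: le_trans Aex; rewrite -mulrA [leRHS]mulrC.
  by rewrite ler_wpM2l.
have hr : h * r ^+ 2 * (768 * L) / T%:R ^+ 2 <=
    6 * sigma * r / Num.sqrt ((M * B)%:R * T%:R).
  have sK : 0 < Num.sqrt K by rewrite sqrtr_gt0.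
  have sT : 0 < Num.sqrt T%:R :> R by rewrite sqrtr_gt0.
  rewrite sqrtrM ?ler0n// -/K.
  apply: (@le_trans _ _ (sigma / (r * Num.sqrt K) * (T%:R * Num.sqrt T%:R / (128 * L))
      * r ^+ 2 * (768 * L) / T%:R ^+ 2)).
    rewrite ler_pM2r ?invr_gt0// ler_pM2r ?mulr_gt0 ?ltr0n//.
    by rewrite ler_wpM2r// h_le.
  move: (Num.sqrt K) sK => k k0.
  rewrite -{1 3}(@sqr_sqrtr _ T%:R) ?(ltW T0)//; move: (Num.sqrt T%:R) sT => t t0.
  rewrite le_eqVlt; apply/orP; left; apply/eqP; field.
  by rewrite !gt_eqF.
move: exT hr cXT; set u := T%:R ^+ 2.
have u0 : 0 < u by [].
set v := 6 * sigma * r / _; set c := delta2 * _.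
move=> exT hr cXT.
(* Twice [5 / 8] and [3 / 2], times 256, give 320 and 768. Dividing 768 by the 128 of [h_le] gives
   the 6, and the final dispersion raises 320 to 321. *)
have e1 : 2 * ((5 / 8 * r ^+ 2 + 3 / 2 * (h * r ^+ 2)) * (256 * L) / u) =
   320 * (L * r ^+ 2 / u) + h * r ^+ 2 * (768 * L) / u.
  by field; rewrite gt_eqF.
have e2 : 321 * L * r ^+ 2 / u = 321 * (L * r ^+ 2 / u) by ring.
rewrite e2; move: e1 exT hr cXT; lra.
Qed.

End MomentRecursion.

(** * Numerical consequences of the choice of the batch length *)

Section ParameterBounds.
Context {R : realType}.
Variables (M N B T : nat) (L r sigma zeta rho : R).
Hypotheses (L_gt0 : 0 < L) (r_gt0 : 0 < r) (sigma_ge0 : 0 <= sigma)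
  (zeta_ge0 : 0 <= zeta) (hrho : 0 < rho <= 1) (T_gt0 : (0 < T)%N).
Let Lam : R := LambdaN M N L sigma zeta r.
Let kappa : R := 1 + (zeta + sigma) / (L * r).
Hypotheses (BE : B = batch_len rho Lam) (TE : T%:R = N%:R / (M * B)%:R :> R).

Let ell : R := ln (Lam / rho).
Let rho_gt0 : 0 < rho. Proof. by case/andP: hrho. Qed.
Let rho_le1 : rho <= 1. Proof. by case/andP: hrho. Qed.
Let T1 : 1 <= T%:R :> R. Proof. by rewrite ler1n. Qed.

Let MB_neq0 : (M * B)%:R != 0 :> R.
Proof.
(* Division by zero yields zero, so [M B = 0] would force [T = 0]. *)
apply/eqP => MB0; move: T1; rewrite TE MB0 invr0 mulr0; lra.
Qed.

Lemma params_M_gt0 : (0 < M)%N.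
Proof. by move: MB_neq0; rewrite pnatr_eq0 muln_eq0 negb_or -!lt0n => /andP[]. Qed.

Lemma params_B_gt0 : (0 < B)%N.
Proof. by move: MB_neq0; rewrite pnatr_eq0 muln_eq0 negb_or -!lt0n => /andP[]. Qed.

Lemma params_NE : N%:R = (M * B)%:R * T%:R :> R.
Proof. by rewrite TE mulrC divfK. Qed.

Let M1 : 1 <= M%:R :> R. Proof. by rewrite ler1n params_M_gt0. Qed.
Let B1 : 1 <= B%:R :> R. Proof. by rewrite ler1n params_B_gt0. Qed.
Let sM1 : 1 <= Num.sqrt M%:R :> R.
Proof. by rewrite -[leLHS]sqrtr1 ler_wsqrtr. Qed.

Let kappa1 : 1 <= kappa.
Proof. by rewrite lerDl divr_ge0 ?addr_ge0// mulr_ge0 ?ltW. Qed.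

(** With [N = M B T] every factor is at least 1, so [Lam] dominates each of [B], [T], [kappa] and
    [sqrt M]. *)
Lemma LambdaE : Lam = 100 * Num.sqrt M%:R * B%:R * T%:R * kappa.
Proof.
rewrite /Lam /LambdaN params_NE natrM -/kappa -[in M%:R * _](@sqr_sqrtr _ M%:R)//.
by field; rewrite gt_eqF// (lt_le_trans ltr01).
Qed.

Let prod_ge1 (x y : R) : 1 <= x -> 1 <= y -> 1 <= x * y.
Proof. by move=> x1 y1; rewrite -[leLHS]mulr1 ler_pM. Qed.

Let le_mull (x y : R) : 1 <= x -> 1 <= y -> y <= x * y.
Proof. by move=> x1 y1; rewrite ler_peMl// (le_trans ler01). Qed.

Let le_mulr (x y : R) : 1 <= x -> 1 <= y -> x <= x * y.
Proof. by move=> x1 y1; rewrite ler_peMr// (le_trans ler01). Qed.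

Let S1 : 1 <= Num.sqrt M%:R * B%:R * T%:R * kappa. Proof. by rewrite !prod_ge1. Qed.

Let LamE' : Lam = 100 * (Num.sqrt M%:R * B%:R * T%:R * kappa).
Proof. by rewrite LambdaE !mulrA. Qed.

Let Lam100 : 100 <= Lam.
Proof. by rewrite LamE' -[leLHS]mulr1 ler_pM2l ?ltr0n. Qed.

Let Lam_gt0 : 0 < Lam. Proof. by rewrite (lt_le_trans _ Lam100) ?ltr0n. Qed.

(** A crude bound, from [ln (1 + x) <= x] at the inverse of [Lam / rho]. It makes
    [20 ell / sqrt rho] at least 10, so the maximum in [batch_len] is never 1. *)
Let ell_ge : 1 / 2 <= ell.
Proof.
have LR : 100 <= Lam / rho.
  by rewrite ler_pdivlMr//; apply: le_trans Lam100; rewrite ger_pMr ?ltr0n.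
have LR0 : 0 < Lam / rho by rewrite divr_gt0.
have inv : (Lam / rho)^-1 <= 1 / 100.
  by rewrite div1r lef_pV2 ?posrE ?ltr0n.
have I0 : 0 < (Lam / rho)^-1 by rewrite invr_gt0.
have := @le_ln1Dx R ((Lam / rho)^-1 - 1).
rewrite (_ : 1 + (_ - 1) = (Lam / rho)^-1); last by ring.
rewrite lnV ?posrE// -/ell => H.
have : - ell <= (Lam / rho)^-1 - 1 by apply: H; lra.
lra.
Qed.

Let srho : R := Num.sqrt rho.
Let srho_gt0 : 0 < srho. Proof. by rewrite sqrtr_gt0. Qed.
Let srho_sqr : srho ^+ 2 = rho. Proof. by rewrite sqr_sqrtr// ltW. Qed.
Let srho_le1 : srho <= 1. Proof. by rewrite -[leRHS]sqrtr1 ler_wsqrtr. Qed.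

Let batch_bounds : 20 / srho * ell <= B%:R <= 22 * ell / srho.
Proof.
set u := 20 / srho * ell.
have isr : 1 <= srho^-1 by rewrite invf_ge1.
have e0 : 0 <= ell by move: ell_ge; lra.
have u10 : 10 <= u.
  rewrite /u mulrAC (_ : 10 = 10 * 1) ?mulr1//.
  rewrite -[leLHS]mulr1; apply: ler_pM => //; move: ell_ge; lra.
have max_u : Num.max 1 u = u by rewrite max_r//; lra.
have cu : (0 : R) <= (Num.ceil u)%:~R.
  apply: le_trans (ceil_ge u); lra.
have BceilE : B%:R = (Num.ceil u)%:~R :> R.
  rewrite BE /batch_len -/ell -/srho -/u max_u natr_absz ger0_norm//.
  by rewrite -(ler0z R).
rewrite BceilE ceil_ge /=.
have : (Num.ceil u)%:~R < u + 1.
  by have := ceilB1_lt u; rewrite intrB ltrBlDr.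
(* The 1 lost to the ceiling is absorbed here, raising 20 to 22. *)
have : 1 <= 2 * ell * srho^-1.
  by apply: prod_ge1 => //; move: ell_ge; lra.
rewrite /u; lra.
Qed.

Lemma batch_smoothness_bound :
  321 * L * r ^+ 2 / T%:R ^+ 2 <=
  2 ^+ 19 * L * r ^+ 2 * M%:R ^+ 2 / (rho * N%:R ^+ 2) * ell ^+ 2.
Proof.
have [_ Bub] := andP batch_bounds.
have M0 : 0 < M%:R :> R by apply: lt_le_trans ltr01 M1.
have B0 : 0 < B%:R :> R by apply: lt_le_trans ltr01 B1.
have T0 : 0 < T%:R :> R by apply: lt_le_trans ltr01 T1.
have B2 : rho * B%:R ^+ 2 <= 484 * ell ^+ 2.
  have sB : srho * B%:R <= 22 * ell by rewrite mulrC -ler_pdivlMr.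
  have -> : 484 * ell ^+ 2 = (22 * ell) ^+ 2 by ring.
  rewrite -srho_sqr -exprMn ler_sqr ?nnegrE//; first by rewrite mulr_ge0 ?ltW.
  by move: ell_ge; lra.
(* [484 = 22^2]; both factors are below [2^9]. *)
have : 321 * 484 <= 2 ^+ 19 :> R.
  apply: (@le_trans _ _ (2 ^+ 9 * 2 ^+ 9)).
    by apply: ler_pM; rewrite ?ler0n// -natrX ler_nat.
  by rewrite -exprD ler_weXn2l// ler1n.
move: (2 ^+ 19) => c c19.
have -> : c * L * r ^+ 2 * M%:R ^+ 2 / (rho * N%:R ^+ 2) * ell ^+ 2 =
   (L * r ^+ 2 / T%:R ^+ 2) / (rho * B%:R ^+ 2) * (c * ell ^+ 2).
  by rewrite params_NE natrM; field; rewrite !gt_eqF.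
have -> : 321 * L * r ^+ 2 / T%:R ^+ 2 =
   (L * r ^+ 2 / T%:R ^+ 2) / (rho * B%:R ^+ 2) * (321 * (rho * B%:R ^+ 2)).
  by field; rewrite !gt_eqF.
rewrite ler_wpM2l//.
  exact: divr_ge0 (divr_ge0 (mulr_ge0 (ltW L_gt0) (sqr_ge0 _)) (sqr_ge0 _))
    (mulr_ge0 (ltW rho_gt0) (sqr_ge0 _)).
have := ler_wpM2r (sqr_ge0 ell) c19; move: B2; lra.
Qed.

(** Since [sqrt (rho / 2) >= sqrt rho / 2], the choice of [B] gives
    [(1 - s)^B <= exp (- 10 ell) <= Lam^-10], and [B + 1 <= Lam] leaves a rate below [Lam^-9]. Its
    square outweighs the prefactor, which is at most [Lam^(2 + 7 + 2)]. *)
Lemma gossip_rate_small :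
  25 * M%:R * T%:R ^+ 7 * kappa ^+ 2 * gossip_rate rho B ^+ 2 <= 1.
Proof.
have [Blb _] := andP batch_bounds.
pose s := Num.sqrt (rho / 2).
have s_lb : srho / 2 <= s.
  have h0 : 0 <= srho / 2 by rewrite divr_ge0// ltW.
  rewrite -[leLHS]ger0_norm// -sqrtr_sqr ler_wsqrtr// exprMn srho_sqr.
  by move: rho_gt0; lra.
have s1 : s <= 1 by rewrite -[leRHS]sqrtr1 ler_wsqrtr//; move: rho_le1; lra.
have pow : (1 - s) ^+ B <= Lam ^- 10.
  apply: (@le_trans _ _ (expR (- s) ^+ B)).
    by rewrite lerXn2r ?nnegrE ?subr_ge0 ?expR_ge0//; exact: expR_ge1Dx.
  rewrite -expRM_natr.
  apply: (@le_trans _ _ (expR (- (10%:R * ell)))).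
    rewrite ler_expR mulNr lerN2.
    apply: (@le_trans _ _ (srho / 2 * (20 / srho * ell))).
      by rewrite le_eqVlt; apply/orP; left; apply/eqP; field; rewrite gt_eqF.
    apply: ler_pM => //; first by rewrite divr_ge0// ltW.
    rewrite mulr_ge0// ?divr_ge0 ?(ltW srho_gt0)//; move: ell_ge; lra.
  rewrite expRN lef_pV2 ?posrE ?exprn_gt0 ?expR_gt0//.
  rewrite mulrC expRM_natr lnK ?posrE ?divr_gt0//.
  rewrite lerXn2r ?nnegrE ?divr_ge0 ?(ltW Lam_gt0) ?(ltW rho_gt0)//.
  by rewrite ler_pdivlMr// ger_pMr.
have Lam1 : 1 <= Lam by apply: le_trans Lam100; rewrite ler1n.
have BL : B.+1%:R <= Lam.
  rewrite LamE' -natr1.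
  apply: (@le_trans _ _ (100 * B%:R)); first by move: B1; lra.
  rewrite ler_pM2l ?ltr0n// (_ : _ * kappa = Num.sqrt M%:R * (T%:R * kappa) * B%:R); last by ring.
  by rewrite le_mull// !prod_ge1.
have TL : T%:R <= Lam.
  rewrite LamE' (_ : 100 * _ = (100 * (Num.sqrt M%:R * B%:R * kappa)) * T%:R); last by ring.
  by rewrite le_mull// prod_ge1 ?ler1n// !prod_ge1.
have kL : kappa <= Lam.
  rewrite LamE' mulrA le_mull//.
  by rewrite prod_ge1 ?ler1n// !prod_ge1.
have ML : 25 * M%:R <= Lam ^+ 2.
  apply: (@le_trans _ _ ((100 * Num.sqrt M%:R) ^+ 2)).
    by rewrite exprMn sqr_sqrtr// ler_wpM2r// -natrX ler_nat.
  have h : 100 * Num.sqrt M%:R <= Lam.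
    by rewrite LamE' ler_pM2l ?ltr0n// -!mulrA le_mulr// !prod_ge1.
  have h0 : 0 <= 100 * Num.sqrt M%:R :> R by rewrite mulr_ge0 ?sqrtr_ge0.
  by apply: lerXn2r; rewrite ?nnegrE// ltW.
have Lam0 := ltW Lam_gt0.
have rate : gossip_rate rho B <= Lam ^- 9.
  rewrite /gossip_rate -/s.
  apply: (@le_trans _ _ (Lam * Lam ^- 10)).
    by apply: ler_pM => //; rewrite exprn_ge0 ?subr_ge0.
  by rewrite (exprS _ 9) invfM mulrA mulfV ?gt_eqF// mul1r.
have rate0 : 0 <= gossip_rate rho B by rewrite mulr_ge0 ?exprn_ge0 ?subr_ge0.
apply: (@le_trans _ _ (Lam ^+ 2 * Lam ^+ 7 * Lam ^+ 2 * (Lam ^- 9) ^+ 2)).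
  have kappa0 : 0 <= kappa := le_trans ler01 kappa1.
  have M0 : 0 <= 25 * M%:R :> R by rewrite mulr_ge0 ?ler0n.
  have T7 : 0 <= T%:R ^+ 7 :> R by rewrite exprn_ge0.
  have p1 : 25 * M%:R * T%:R ^+ 7 <= Lam ^+ 2 * Lam ^+ 7.
    by apply: ler_pM => //; apply: lerXn2r; rewrite ?nnegrE.
  have p2 : kappa ^+ 2 <= Lam ^+ 2 by apply: lerXn2r; rewrite ?nnegrE.
  have p3 : gossip_rate rho B ^+ 2 <= (Lam ^- 9) ^+ 2.
    by apply: lerXn2r; rewrite ?nnegrE ?invr_ge0 ?exprn_ge0.
  have p12 := ler_pM (mulr_ge0 M0 T7) (sqr_ge0 _) p1 p2.
  exact: ler_pM (mulr_ge0 (mulr_ge0 M0 T7) (sqr_ge0 _)) (sqr_ge0 _) p12 p3.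
rewrite (_ : _ * _ = Lam ^- 7); last by field; rewrite gt_eqF.
by rewrite invf_le1 ?exprn_gt0// exprn_ege1.
Qed.

End ParameterBounds.

(** * Integrating the pathwise inequalities *)

Section Expectations.
Context {R : realType} {d M B T : nat} {dO dX : measure_display}
  {Omega : measurableType dO} {Xi : measurableType dX}.
Variables (f : 'I_M -> 'cV[R]_d -> R) (L sigma zeta r rho : R) (x0 xstar : 'cV[R]_d)
  (P : 'M[R]_M) (lam : seq R) (Pr : probability Omega R)
  (D : 'I_M -> R.-pker (borel_cV R d) ~> Xi) (G : 'I_M -> 'cV[R]_d -> Xi -> 'cV[R]_d)
  (xi : nat -> 'I_M -> 'I_B -> Omega -> Xi).
Hypotheses (M_gt0 : (0 < M)%N) (B_gt0 : (0 < B)%N) (T_gt0 : (0 < T)%N)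
  (L_gt0 : 0 < L) (r_gt0 : 0 < r) (sigma_ge0 : 0 <= sigma) (zeta_ge0 : 0 <= zeta).
Hypotheses (f_convex : forall i, convex_function setT (f i))
  (f_diff : forall i x, differentiable (f i) x)
  (f_smooth : forall i, smooth L (f i)).
Hypothesis xstar_min : is_minimizer (average f) xstar.
Hypothesis oracle : forall i, stochastic_gradient_oracle (f i) sigma (D i) (G i).
Hypothesis heterogeneity : M%:R^-1 * \sum_(i < M)
      enorm (grad (f i) xstar - grad (average f) xstar) ^+ 2 <= zeta ^+ 2.
Hypotheses (P_sym : P^T = P) (P_stoch : doubly_stochastic P)
  (P_spec : spectrum P lam) (gap : (1 < M)%N -> rho <= 1 - lam`_1)
  (hrho : 0 < rho <= 1).
Hypothesis hdist : enorm (x0 - xstar) <= r.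
Let smp w t i s := xi t i s w.
Hypothesis samples :
    fresh_samples Pr D
      (fun w => dda_query P (1 / 2) (gossip_momentum rho)
         (step_theta L T) (step_m T) (step_eta M B T L sigma r) x0 G
         (smp w))
      xi T.
Hypothesis rate_small : 25 * M%:R * T%:R ^+ 7 * (1 + (zeta + sigma) / (L * r)) ^+ 2
  * gossip_rate rho B ^+ 2 <= 1.

Let L_ge0 := ltW L_gt0.
Local Notation beta := (step_beta M B T L sigma r).
Local Notation eta := (step_eta M B T L sigma r).
Local Notation theta := (step_theta L T).
Local Notation a := (step_a L).
Local Notation A := (step_A L).
Local Notation delta2 := (gossip_rate rho B ^+ 2).
Local Notation E := (mean Pr).
Local Notation sqnE V := (E (fun w => sqn (V w))).
Local Notation dispE V := (E (fun w => dispersion (V w))).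

Let S t w := dda P (1 / 2) (gossip_momentum rho) theta (step_m T) eta x0 G (smp w) t.
Let X t w := capX (S t w).
Let Z t w := capZ (S t w).
Let Q t w := capQ (S t w).
Let Gr t w := minibatch G (Q t w) (smp w t).
Let n t w := mean_error f x0 P (1 / 2) (gossip_momentum rho) theta (step_m T) eta G xi t w.
Let nn t i w := node_error f x0 P (1 / 2) (gossip_momentum rho) theta (step_m T) eta G xi t i w.

Let node_noiseE t i w : node_noise f L r sigma rho T x0 P G (smp w) t i = nn t i w.
Proof.
rewrite /node_noise /nn /node_error.
have := minibatch_col f x0 P (1 / 2) (gossip_momentum rho) theta (step_m T) eta G xi t i w.
move=> /= ->.
rewrite big_split sumr_const card_ord /= scalerDr -[grad _ _ *+ _]scaler_nat.
rewrite scalerA mulVf ?scale1r; first by rewrite addrC addrA addNr add0r.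
by rewrite pnatr_eq0 -lt0n.
Qed.

Let mean_noiseE t w : mean_noise f L r sigma rho T x0 P G (smp w) t = n t w.
Proof. by congr (_ *: _); apply: eq_bigr => i _; exact: node_noiseE. Qed.

Let S_L2 t : (t <= T)%N -> state_entries (L2 Pr) (S t).
Proof. exact: state_L2 L_ge0 f_smooth B_gt0 oracle samples t. Qed.

Let L2_colavg (V : Omega -> 'M[R]_(d, M)) : L2mx Pr V -> L2mx Pr (fun w => colavg (V w)).
Proof.
by move=> hV; apply: L2mxZ; apply: L2mx_sum => i; exact: L2mx_col.
Qed.

Let L1_dispersion (V : Omega -> 'M[R]_(d, M)) : L2mx Pr V -> L1 Pr (fun w => dispersion (V w)).
Proof.
move=> hV; apply: L1_sum => i; apply: L1_sqn; apply: L2mxB; first exact: L2mx_col.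
exact: L2_colavg.
Qed.

Let L1_sqnB (V : Omega -> 'cV[R]_d) v : L2mx Pr V -> L1 Pr (fun w => sqn (V w - v)).
Proof. by move=> hV; apply: L1_sqn; apply: L2mxB => //; exact: L2mx_cst. Qed.

(** [excess_perturb] at the minimizer dominates the excess by [L] times the squared distance to
    [xstar]. *)
Let L1_excess (V : Omega -> 'cV[R]_d) : L2mx Pr V -> L1 Pr (fun w => excess f xstar (V w)).
Proof.
move=> hV; apply: L1_dominated (L1Z L (L1_sqnB xstar hV)) _ => [|w].
  apply: measurable_funB; last exact: measurable_cst.
  apply: measurable_funM; first exact: measurable_cst.
  apply: measurable_sum => i.
  have mV := measurable_fun_borel_cV (fun j => (hV j 0).1).
  have cf : continuous (f i) by move=> x; exact: differentiable_continuous.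
  exact: (measurableT_comp (measurable_continuous_cV cf) mV).
rewrite ger0_norm; last exact: excess_ge0.
have := excess_perturb M_gt0 L_gt0 f_diff f_smooth xstar_min xstar (V w).
by rewrite {2}/excess subrr mulr0 add0r.
Qed.

Let XL t : (t <= T)%N -> L2mx Pr (X t). Proof. by move=> /S_L2[]. Qed.
Let ZL t : (t <= T)%N -> L2mx Pr (Z t). Proof. by move=> /S_L2[]. Qed.
Let QL t : (t <= T)%N -> L2mx Pr (Q t). Proof. by move=> /S_L2[]. Qed.
Let GL t : (t <= T)%N -> L2mx Pr (Gr t).
Proof.
move=> tT; apply: (minibatch_L2 L_ge0 f_smooth B_gt0 oracle samples tT); exact: QL.
Qed.

Let nL t : (t <= T)%N -> L2mx Pr (n t).
Proof. exact: (mean_error_L2 L_ge0 f_smooth oracle samples). Qed.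

Let init_dist : sqn (x0 - xstar) <= r ^+ 2.
Proof. by rewrite -sqr_enorm lerXn2r ?nnegrE ?enorm_ge0 ?(ltW r_gt0). Qed.

Let pot t w := potential f L r sigma rho T x0 xstar P G (smp w) t.

Let L1_pot t : (t <= T)%N -> L1 Pr (pot t).
Proof.
move=> tT; apply: L1D; first apply: L1D.
- by apply: L1Z; apply: L1_excess; apply: L2_colavg; exact: XL.
- by apply: L1Z; apply: L1_sqnB; apply: L2_colavg; exact: ZL.
- apply: L1Z; case: t tT => [_|t tT]; first exact: L1_cst.
  have hZ1 := ZL tT; have hZ0 := ZL (ltnW tT).
  exact: L1_sqn (L2mxB (L2_colavg hZ1) (L2_colavg hZ0)).
Qed.

Let L1_step t : (t < T)%N -> 
  [/\ L1 Pr (fun w => dotv (n t w) (colavg (Z t w) - xstar)),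
      L1 Pr (fun w => sqn (n t w)) & L1 Pr (fun w => dispersion (Q t w))].
Proof.
move=> tT; split.
- apply: L1_dotv; first exact/nL/ltnW.
  by apply: L2mxB; [apply: L2_colavg; exact/ZL/ltnW|exact: L2mx_cst].
- exact/L1_sqn/nL/ltnW.
- exact/L1_dispersion/QL/ltnW.
Qed.

Let mean_potential_step t : (t < T)%N ->
  E (pot t.+1) <= E (pot t) + (a t ^+ 2 / beta * (sigma ^+ 2 / (M * B)%:R)
    + L * A t * (M%:R^-1 * dispE (Q t))).
Proof.
move=> tT; have [i1 i2 i3] := L1_step tT.
have ip := L1_pot (ltnW tT).
have j1 := L1B ip (L1Z (a t) i1).
have j2 := L1D j1 (L1Z (a t ^+ 2 / beta) i2).
have j3 := L1D j2 (L1Z (L * A t) (L1Z M%:R^-1 i3)).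
have path w : pot t.+1 w <= pot t w - a t * dotv (n t w) (colavg (Z t w) - xstar)
    + a t ^+ 2 / beta * sqn (n t w) + L * A t * (M%:R^-1 * dispersion (Q t w)).
  have := potential_step rho x0 xstar G (smp w) M_gt0 L_gt0 r_gt0 sigma_ge0 f_convex
    f_diff f_smooth P_stoch tT.
  by rewrite mean_noiseE.
apply: le_trans (le_mean (L1_pot tT) _ path) _.
  exact: j3.
rewrite (meanD j2 (L1Z _ (L1Z _ i3))) (meanD j1 (L1Z _ i2)) (meanB ip (L1Z _ i1)).
rewrite (meanZ _ i1) (meanZ _ i2) (meanZ _ (L1Z _ i3)) (meanZ _ i3).
(* The average of [Z_t] depends only on samples drawn before round [t], given which the noise of
   round [t] is centered. *)
have -> : E (fun w => dotv (n t w) (colavg (Z t w) - xstar)) = 0.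
  apply: (mean_error_centered L_ge0 f_smooth oracle samples (ltnW tT)).
    have [_ hZ _ _] := state_measurable x0 P (1 / 2) (gossip_momentum rho) theta (step_m T)
      eta xi L_ge0 f_smooth oracle (ltnW tT).
    have lin := linearly_closed_measurable R (g_sigma_algebraType (history xi t)).
    apply: (entriesB lin); last by move=> j i; exact: measurable_cst.
    apply: (entriesZ lin) => j i.
    under eq_fun do rewrite summxE; apply: (closed_sum lin) => k.
    by under eq_fun do rewrite mxE; exact: hZ.
  by apply: L2mxB; [apply: L2_colavg; exact/ZL/ltnW|exact: L2mx_cst].
rewrite mulr0 subr0 -addrA lerD2l lerD2r.
apply: ler_wpM2l; last exact: (mean_error_moment L_ge0 f_smooth B_gt0 M_gt0 oracle samples (ltnW tT)).
by rewrite divr_ge0 ?sqr_ge0// (le_trans ler01)// step_beta_ge1.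
Qed.

Let mean_potential t : (t <= T)%N ->
  E (pot t) <= beta / 2 * r ^+ 2 + \sum_(s < t) (a s ^+ 2 / beta * (sigma ^+ 2 / (M * B)%:R)
    + L * A s * (M%:R^-1 * dispE (Q s))).
Proof.
elim: t => [_|t IH tT].
  rewrite big_ord0 addr0 (_ : pot 0 = fun=> beta / 2 * sqn (x0 - xstar)); last first.
    apply/funext => w; rewrite /pot /potential mul0r mulr0 add0r addr0.
    by rewrite (z0E L r sigma rho T x0 P G (smp w) M_gt0).
  rewrite mean_cst ler_wpM2l// divr_ge0// (le_trans ler01)// step_beta_ge1//.
rewrite big_ord_recr /= addrA.
by apply: le_trans (mean_potential_step tT) _; rewrite lerD2r; exact/IH/ltnW.
Qed.

Let ex t := E (fun w => excess f xstar (colavg (X t w))).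
Let px t := sqnE (fun w => colavg (X t w) - xstar).
Let pz t := sqnE (fun w => colavg (Z t w) - xstar).
Let pq t := sqnE (fun w => colavg (Q t w) - xstar).
Let cX t := dispE (X t).
Let cZ t := dispE (Z t).
Let cQ t := dispE (Q t).
Let cG t := dispE (Gr t).

Let moment_init v : (forall w, colavg (v w) = x0) ->
  sqnE (fun w => colavg (v w : 'M[R]_(d, M)) - xstar) <= r ^+ 2.
Proof.
move=> vE; rewrite (_ : (fun w => _) = fun=> sqn (x0 - xstar)) ?mean_cst//.
by apply/funext => w; rewrite vE.
Qed.

Let moment_potential t : (t <= T)%N ->
  (if t is s.+1 then A s else 0) * ex t + beta / 2 * pz t <=
  beta / 2 * r ^+ 2 + \sum_(s < t) (a s ^+ 2 / beta * (sigma ^+ 2 / (M * B)%:R)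
    + L * A s * (M%:R^-1 * cQ s)).
Proof.
move=> tT; apply: le_trans (mean_potential tT).
have h1 := L1_excess (L2_colavg (XL tT)).
have h2 := L1_sqnB xstar (L2_colavg (ZL tT)).
rewrite -(meanZ _ h1) -(meanZ _ h2) -(meanD (L1Z _ h1) (L1Z _ h2)).
apply: le_mean (L1_pot tT) _ => [|w]; first exact: L1D (L1Z _ h1) (L1Z _ h2).
rewrite /pot /potential lerDl mulr_ge0// ?divr_ge0//.
by case: (t) => [|s]; rewrite ?sqn_ge0.
Qed.

Let moment_px t : (t < T)%N -> px t.+1 <= (1 - theta t) * px t + theta t * pz t.+1.
Proof.
move=> tT.
have h1 := L1_sqnB xstar (L2_colavg (XL (ltnW tT))).
have h2 := L1_sqnB xstar (L2_colavg (ZL tT)).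
rewrite -(meanZ _ h1) -(meanZ _ h2) -(meanD (L1Z _ h1) (L1Z _ h2)).
apply: le_mean => [||w].
- exact: L1_sqnB xstar (L2_colavg (XL tT)).
- exact: L1D (L1Z _ h1) (L1Z _ h2).
- exact: excess_position_le.
Qed.

Let moment_pq t : (t < T)%N -> pq t.+1 <= 15 * px t + 10 * px t.-1.
Proof.
move=> tT; have tT' := ltnW tT; have pT := leq_trans (leq_pred t) tT'.
have h1 := L1_sqnB xstar (L2_colavg (XL tT')).
have h2 := L1_sqnB xstar (L2_colavg (XL pT)).
rewrite -(meanZ _ h1) -(meanZ _ h2) -(meanD (L1Z _ h1) (L1Z _ h2)).
apply: le_mean => [||w].
- exact: L1_sqnB xstar (L2_colavg (QL tT)).
- exact: L1D (L1Z _ h1) (L1Z _ h2).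
- exact: (query_average_le _ _ _ _ _ _ _ _ _ M_gt0 P_stoch).
Qed.

Let moment_cX t : (t < T)%N -> cX t.+1 <= (1 - theta t) * cX t + theta t * cZ t.+1.
Proof.
move=> tT.
have h1 := L1_dispersion (XL (ltnW tT)); have h2 := L1_dispersion (ZL tT).
rewrite -(meanZ _ h1) -(meanZ _ h2) -(meanD (L1Z _ h1) (L1Z _ h2)).
apply: le_mean => [||w].
- exact: L1_dispersion (XL tT).
- exact: L1D (L1Z _ h1) (L1Z _ h2).
- exact: dispersion_X_le.
Qed.

Let moment_cZ t : (t <= T)%N -> cZ t <= t%:R * \sum_(s < t) eta s ^+ 2 * cG s.
Proof.
move=> tT.
have h (s : 'I_t) := L1_dispersion (GL (leq_trans (ltnW (ltn_ord s)) tT)).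
have h' (s : 'I_t) := L1Z (eta s ^+ 2) (h s).
under eq_bigr do rewrite -(meanZ _ (h _)).
rewrite -(mean_sum _ h') -(meanZ _ (L1_sum _ h')).
apply: le_mean => [||w].
- exact: L1_dispersion (ZL tT).
- exact: L1Z (L1_sum _ h').
- exact: dispersion_Z_le.
Qed.

Let moment_cG t : (t < T)%N ->
  cG t <= 3 * (M%:R * sigma ^+ 2 + M%:R * zeta ^+ 2 + L ^+ 2 * (cQ t + M%:R * pq t)).
Proof.
move=> tT; have tT' := ltnW tT.
have hn i := L1_sqn (node_error_L2 L_ge0 f_smooth oracle samples i tT').
have hs := L1_sum (index_enum 'I_M) hn.
have h1 := L1_dispersion (QL tT').
have h2 := L1_sqnB xstar (L2_colavg (QL tT')).
have hc := L1_cst Pr (M%:R * zeta ^+ 2).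
have h12 := L1D h1 (L1Z M%:R h2).
have hall := L1D (L1D hs hc) (L1Z (L ^+ 2) h12).
have path w : dispersion (Gr t w) <= 3 * (\sum_i sqn (nn t i w) + M%:R * zeta ^+ 2
    + L ^+ 2 * (dispersion (Q t w) + M%:R * sqn (colavg (Q t w) - xstar))).
  under eq_bigr do rewrite -node_noiseE.
  exact: dispersion_Gr_le heterogeneity.
apply: le_trans (le_mean (L1_dispersion (GL tT')) (L1Z 3 hall) path) _.
rewrite (meanZ _ hall) (meanD (L1D hs hc) (L1Z _ h12)) (meanD hs hc) (mean_sum _ hn).
rewrite mean_cst (meanZ _ h12) (meanD h1 (L1Z _ h2)) (meanZ _ h2).
rewrite ler_wpM2l ?ler0n// lerD2r lerD2r.
apply: (@le_trans _ _ (\sum_(i < M) sigma ^+ 2)).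
  by apply: ler_sum => i _; exact: (node_error_moment L_ge0 f_smooth B_gt0 oracle samples).
by rewrite sumr_const card_ord mulr_natl.
Qed.

Let moment_cQ t : (t < T)%N -> cQ t.+1 <= delta2 * (15 * cX t + 10 * cX t.-1).
Proof.
move=> tT; have tT' := ltnW tT; have pT := leq_trans (leq_pred t) tT'.
have h1 := L1_dispersion (XL tT'); have h2 := L1_dispersion (XL pT).
have h12 := L1D (L1Z 15 h1) (L1Z 10 h2).
rewrite -(meanZ _ h1) -(meanZ _ h2) -(meanD (L1Z _ h1) (L1Z _ h2)) -(meanZ _ h12).
apply: le_mean => [||w].
- exact: L1_dispersion (QL tT).
- exact: L1Z h12.
- exact: (dispersion_Q_le _ _ _ _ _ _ _ M_gt0 P_sym P_stoch P_spec gap hrho).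
Qed.

Let output w i := dda_output P (1 / 2) (gossip_momentum rho) theta (step_m T) eta x0 G (smp w) T i.

Lemma L1_output_excess i : L1 Pr (fun w => excess f xstar (output w i)).
Proof.
apply: L1_excess; apply: (entries_col i).
apply: (entries_gossip (linearly_closed_L2 Pr)); exact: XL (leqnn T).
Qed.

Lemma mean_output_excess i : E (fun w => excess f xstar (output w i)) <=
  6 * sigma * r / Num.sqrt ((M * B)%:R * T%:R) + 321 * L * r ^+ 2 / T%:R ^+ 2.
Proof.
have h1 := L1_excess (L2_colavg (XL (leqnn T))).
have h2 := L1_dispersion (XL (leqnn T)).
have h12 := L1D (L1Z 2 h1) (L1Z L (L1Z delta2 h2)).
have path w : excess f xstar (output w i) <=
    2 * excess f xstar (colavg (X T w)) + L * (delta2 * dispersion (X T w)).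
  exact: (output_excess_le _ _ _ _ _ _ M_gt0 L_gt0 f_diff f_smooth xstar_min P_sym
    P_stoch P_spec gap hrho).
apply: le_trans (le_mean (L1_output_excess i) h12 path) _.
rewrite (meanD (L1Z _ h1) (L1Z _ (L1Z _ h2))) (meanZ _ h1) (meanZ _ (L1Z _ h2)) (meanZ _ h2).
apply: (moment_recursion M_gt0 B_gt0 T_gt0 L_gt0 r_gt0 sigma_ge0 zeta_ge0 (sqr_ge0 _) rate_small
  (ex := ex) (px := px) (pz := pz) (pq := pq) (cQ := cQ) (cX := cX) (cZ := cZ) (cG := cG)).
- by move=> t; apply: mean_ge0 => w; exact: excess_ge0.
- by apply: moment_init => w; exact: (x0E L r sigma rho T x0 P G (smp w) M_gt0).
- by apply: moment_init => w; exact: (x0E L r sigma rho T x0 P G (smp w) M_gt0).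
- rewrite /cQ (_ : (fun w => _) = fun=> 0) ?mean_cst//.
  by apply/funext => w; exact: (dispersion_Q0 L r sigma rho T x0 P G (smp w) M_gt0).
- rewrite /cX (_ : (fun w => _) = fun=> 0) ?mean_cst//.
  by apply/funext => w; exact: (dispersion_X0 L r sigma rho T x0 P G (smp w) M_gt0).
- by move=> t; apply: mean_ge0 => w; exact: sqn_ge0.
- by move=> t; apply: mean_ge0 => w; exact: dispersion_ge0.
- by move=> t; apply: mean_ge0 => w; exact: dispersion_ge0.
- exact: moment_potential.
- exact: moment_px.
- exact: moment_pq.
- exact: moment_cX.
- exact: moment_cZ.
- exact: moment_cG.
- exact: moment_cQ.
Qed.

End Expectations.

Theorem theorem1 (R : realType) (d M N B T : nat)
  (* objective *)
  (f : 'I_M -> 'cV[R]_d -> R) (L sigma zeta r rho : R)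
  (x0 xstar : 'cV[R]_d)
  (* gossip matrix, its graph and its eigenvalues *)
  (e : rel 'I_M) (P : 'M[R]_M) (lam : seq R)
  (* oracles and samples *)
  (dO dX : measure_display) (Omega : measurableType dO) (Xi : measurableType dX)
  (Pr : probability Omega R)
  (D : 'I_M -> R.-pker (borel_cV R d) ~> Xi)
  (G : 'I_M -> 'cV[R]_d -> Xi -> 'cV[R]_d)
  (xi : nat -> 'I_M -> 'I_B -> Omega -> Xi)
  (hL : 0 < L)
  (f_convex : forall i, convex_function setT (f i))
  (f_diff : forall i x, differentiable (f i) x)
  (f_smooth : forall i, smooth L (f i))
  (hxstar : is_minimizer (average f) xstar)
  (hsigma : 0 <= sigma)
  (oracle : forall i, stochastic_gradient_oracle (f i) sigma (D i) (G i))
  (hzeta : 0 <= zeta)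
  (heterogeneity :
    M%:R^-1 * \sum_(i < M)
      enorm (grad (f i) xstar - grad (average f) xstar) ^+ 2 <= zeta ^+ 2)
  (e_sym : symmetric e) (e_irr : irreflexive e)
  (P_sym : P^T = P) (P_stoch : doubly_stochastic P) (P_supp : supported_on e P)
  (P_spec : spectrum P lam)
  (hrho : 0 < rho <= 1)
  (* for M = 1 there is no second eigenvalue *)
  (gap : (1 < M)%N -> rho <= 1 - lam`_1)
  (hr : 0 < r) (hdist : enorm (x0 - xstar) <= r)
  (hB : B = batch_len rho (LambdaN M N L sigma zeta r))
  (hT0 : (0 < T)%N) (hT : T%:R = N%:R / (M * B)%:R :> R)
  (samples :
    fresh_samples Pr D
      (fun w => dda_query P (1 / 2) (gossip_momentum rho)
         (step_theta L T) (step_m T) (step_eta M B T L sigma r) x0 G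
         (fun t i s => xi t i s w))
      xi T) :
  forall i : 'I_M,
    ('E_Pr[fun w =>
       (average f
         (dda_output P (1 / 2) (gossip_momentum rho)
            (step_theta L T) (step_m T) (step_eta M B T L sigma r) x0 G
            (fun t i s => xi t i s w) T i)
       - average f xstar)%R]
     <= (14 * sigma * r / Num.sqrt N%:R
         + 2 ^+ 19 * L * r ^+ 2 * M%:R ^+ 2 / (rho * N%:R ^+ 2)
           * ln (LambdaN M N L sigma zeta r / rho) ^+ 2)%R%:E)%E.
Proof.
move=> i; have M_gt0 := params_M_gt0 hT0 hT; have B_gt0 := params_B_gt0 hT0 hT.
have small := gossip_rate_small hL hr hsigma hzeta hrho hT0 hB hT.
have integrable := L1_output_excess M_gt0 B_gt0 hL f_diff f_smooth hxstar oracle samples i.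
have bound := mean_output_excess M_gt0 B_gt0 hT0 hL hr hsigma hzeta f_convex f_diff f_smooth
  hxstar oracle heterogeneity P_sym P_stoch P_spec gap hrho hdist samples small i.
rewrite unlock; have -> := mean_integral integrable.
rewrite lee_fin; apply: le_trans bound _.
apply: lerD; last exact: batch_smoothness_bound hL hr hsigma hzeta hrho hT0 hB hT.
(* [N = M B T] turns the noise term into [6 sigma r / sqrt N], within the stated 14. *)
rewrite -(params_NE hT0 hT) ler_wpM2r ?invr_ge0 ?sqrtr_ge0//.
by rewrite ler_wpM2r ?(ltW hr)// ler_wpM2r// ler_nat.
Qed.
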